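(* Let $\varphi$ be a hyperbolic non-automorphism of first kind of $\mathbb{D}$. Then $C_\varphi$ does not have the single-valued extension property on $H^p(\mathbb{D})$ for any $1\le p<\infty$, and for $1<p<\infty$ the adjoint $C_\varphi^*$ on $H^p(\mathbb{D})^*$ has Dunford's property $(C)$.
   Context: A linear fractional self-map $\varphi(z)=\frac{az+b}{cz+d}$ ($ad-bc\ne0$) of $\mathbb{D}$ is a hyperbolic non-automorphism of first kind if it is not an automorphism of $\mathbb{D}$ and has two fixed points in the Riemann sphere, one on the unit circle $\mathbb{T}$ and the other in $\widehat{\mathbb{C}}\setminus\overline{\mathbb{D}}$; every such map is conjugate to $\varphi_r(z)=rz+1-r$ for some $0<r<1$. $C_\varphi f=f\circ\varphi$; $C_\varphi^*$ is the Banach adjoint. SVEP: for every open $U$ and analytic $f:U\to X$ with $(T-zI)f(z)=0$ on $U$, $f\equiv0$. Local spectrum $\sigma_T(x)$: complement of the union of open $U$ on which there is analytic $f$ with $(T-zI)f(z)=x$; $X_T(F)=\{x:\sigma_T(x)\subseteq F\}$; property $(C)$: $X_T(F)$ closed for all closed $F$. *)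

(* Defs.v *)
From HB Require Import structures.
From mathcomp Require Import all_boot all_order all_algebra.
From mathcomp Require Import all_classical all_reals all_analysis.
From mathcomp Require Import complex.
Import Order.TTheory GRing.Theory Num.Theory.

Set Implicit Arguments.
Unset Strict Implicit.
Unset Printing Implicit Defensive.

Local Open Scope classical_set_scope.
Local Open Scope ring_scope.

Section HardyDefs.
Variable R : realType.
Local Notation C := R[i].
Local Notation cabs := (@ComplexField.Normc.normc R).

Definition c_open (U : set C) : Prop :=
  forall z, U z -> exists2 e : R, 0 < e & forall w, cabs (w - z) < e -> U w.
Definition c_closed (F : set C) : Prop :=
  forall z, (forall e : R, 0 < e -> exists2 w, F w & cabs (z - w) < e) -> F z.

Definition disc : set C := [set z | cabs z < 1].

Definition holomorphic_on (U : set C) (f : C -> C) : Prop :=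
  forall z0, U z0 -> exists L : C, forall e : R, 0 < e ->
    exists2 d : R, 0 < d & forall h : C, h != 0 -> cabs h < d -> U (z0 + h) ->
      cabs ((f (z0 + h) - f z0) / h - L) < e.

Definition polar (r t : R) : C := @Complex R (r * cos t) (r * sin t).

Definition pmean (p : R) (f : C -> C) (r : R) : \bar R :=
  ((pi *+ 2)^-1)%:E *
  (\int[@lebesgue_measure R]_(t in `[0%R, (pi *+ 2)%R])
      (cabs (f (polar r t)) `^ p)%:E)%E.

Definition hardy (p : R) (f : C -> C) : Prop :=
  holomorphic_on disc f /\
  exists M : R, forall r : R, 0 <= r < 1 -> (pmean p f r <= M%:E)%E.

(** The H^p norm  ||f||_p = (sup_{0<=r<1} M_p(r,f)^p)^{1/p}
   (only meaningful for f in H^p). *)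
Definition hnorm (p : R) (f : C -> C) : R :=
  fine (ereal_sup [set pmean p f r | r in [set r : R | 0 <= r < 1]]) `^ p^-1.

Definition hdual (p : R) (L : (C -> C) -> C) : Prop :=
  (forall f g, hardy p f -> hardy p g -> L (fun w => f w + g w) = L f + L g) /\
  (forall (k : C) f, hardy p f -> L (fun w => k * f w) = k * L f) /\
  (exists K : R, forall f, hardy p f -> cabs (L f) <= K * hnorm p f).

Definition dnorm (p : R) (L : (C -> C) -> C) : R :=
  sup [set cabs (L f) | f in [set f | hardy p f /\ hnorm p f <= 1]].

Definition hardy_analytic (p : R) (U : set C) (F : C -> C -> C) : Prop :=
  (forall z, U z -> hardy p (F z)) /\
  forall z0, U z0 -> exists2 G, hardy p G & forall e : R, 0 < e ->
    exists2 d : R, 0 < d & forall h : C, h != 0 -> cabs h < d -> U (z0 + h) ->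
      hnorm p (fun w => (F (z0 + h) w - F z0 w) / h - G w) < e.

Definition dual_analytic (p : R) (U : set C)
    (F : C -> (C -> C) -> C) : Prop :=
  (forall z, U z -> hdual p (F z)) /\
  forall z0, U z0 -> exists2 G, hdual p G & forall e : R, 0 < e ->
    exists2 d : R, 0 < d & forall h : C, h != 0 -> cabs h < d -> U (z0 + h) ->
      dnorm p (fun f => (F (z0 + h) f - F z0 f) / h - G f) < e.

Definition comp_op (phi : C -> C) (f : C -> C) : C -> C := fun w => f (phi w).
Definition comp_adj (phi : C -> C) (L : (C -> C) -> C) : (C -> C) -> C :=
  fun f => L (comp_op phi f).

Definition svep_comp (p : R) (phi : C -> C) : Prop :=
  forall (U : set C) (F : C -> C -> C), c_open U -> hardy_analytic p U F ->
    (forall z, U z -> hnorm p (fun w => comp_op phi (F z) w - z * F z w) = 0) ->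
    forall z, U z -> hnorm p (F z) = 0.

Definition adj_local_resolvent (p : R) (phi : C -> C) (x : (C -> C) -> C)
  : set C :=
  [set l | exists U : set C, [/\ c_open U, U l &
     exists2 F, dual_analytic p U F &
       forall z, U z ->
         dnorm p (fun f => comp_adj phi (F z) f - z * F z f - x f) = 0]].

Definition adj_local_spectrum (p : R) (phi : C -> C) (x : (C -> C) -> C)
  : set C := ~` adj_local_resolvent p phi x.

Definition adj_spectral_subspace (p : R) (phi : C -> C) (F : set C)
  : set ((C -> C) -> C) :=
  [set x | hdual p x /\ adj_local_spectrum p phi x `<=` F].

Definition adj_property_C (p : R) (phi : C -> C) : Prop :=
  forall F : set C, c_closed F ->
    forall x, hdual p x ->
      (forall e : R, 0 < e -> exists2 y, adj_spectral_subspace p phi F y &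
          dnorm p (fun f => x f - y f) < e) ->
      adj_spectral_subspace p phi F x.

Definition lft (a b c d : C) : C -> C := fun z => (a * z + b) / (c * z + d).

(** Fixed points in the Riemann sphere, with None standing for infinity:
   a finite z is fixed iff a z + b = z (c z + d) (this forces c z + d <> 0
   when ad - bc <> 0), and infinity is fixed iff c = 0. *)
Definition lft_fixed (a b c d : C) (q : option C) : Prop :=
  match q with
  | Some z => a * z + b = z * (c * z + d)
  | None => c = 0
  end.

Definition outside_closed_disc (q : option C) : Prop :=
  match q with Some z => 1 < cabs z | None => True end.

Definition hyperbolic_nonaut_first_kind (a b c d : C) : Prop :=
  [/\ a * d - b * c != 0,
      (forall z, disc z -> c * z + d != 0 /\ disc (lft a b c d z)),
      (* not an automorphism of D (it is injective, so: not onto D) *)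
      ~ (forall w, disc w -> exists2 z, disc z & lft a b c d z = w) &
      exists zeta : C, exists eta : option C,
        [/\ cabs zeta = 1, lft_fixed a b c d (Some zeta),
            lft_fixed a b c d eta, outside_closed_disc eta &
            forall q, lft_fixed a b c d q -> q = Some zeta \/ q = eta]].

End HardyDefs.

(* Main.v *)
Require Import Defs.
From HB Require Import structures.
From mathcomp Require Import all_boot all_order all_algebra.
From mathcomp Require Import all_classical all_reals all_analysis.
From mathcomp Require Import complex.
From mathcomp Require Import ring lra.
Import Order.TTheory GRing.Theory Num.Theory.
Import numFieldNormedType.Exports.
Local Open Scope classical_set_scope.
Local Open Scope ring_scope.

Set Implicit Arguments.
Unset Strict Implicit.
Unset Printing Implicit Defensive.

(** Let [r] be the multiplier of [phi] at its boundary fixed point. In a suitable disc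
coordinate [sigma] the function [u = 1 - sigma] has positive real part and satisfies
[u \o phi = r u], so the powers [u ^ l] are eigenfunctions of composition with [phi] for the
eigenvalues [r ^ l]; they lie in H^p for [- 1 / p < re l] and depend analytically on [l].
Taking [l = log z / log r] for [z] near [1 / 2] gives a zero-free analytic solution of
[(C_phi - z) F z = 0], so the single-valued extension property fails.

For the adjoint [T], let [rho = r ^ (- 1 / p)]. If [(T - z) F z = x] holds near a point of the
open disc of radius [rho], testing against the eigenfunctions gives [x (u ^ l) = 0] for an
open set of [l], hence, by the identity theorem, for all [l] with [- 1 / p < re l] and in
particular for [l] a natural number. Polynomials in [sigma] are dense in H^p, so [x = 0]:
the local spectrum of a nonzero [x] contains the closed disc of radius [rho]. Conversely,
Littlewood's subordination principle bounds the norm of [C_phi ^ n] by a multiple of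
[rho ^ n], so the Neumann series solves [(T - z) F z = x] outside that disc. Every spectral
subspace [X_T(F)] is therefore trivial or the whole dual, hence closed.

Density of polynomials reduces to convergence of the dilates [f (t w)] to [f] as [t] tends to
[1]; since dilation does not increase the norm and converges pointwise, this follows from
uniform convexity for [1 < p]. The complex analysis starts from Goursat's theorem applied to
[F (exp z)] on a rectangle of height [2 pi]: the mean of [F] over a circle does not depend on
the radius. *)

(** * The complex plane as a normed module *)

(** The exponent [- 1 / p] and the radius [rho] fit together for one reason: along the circle
    [|u| ^ (p * re l)] is integrable near the boundary fixed point exactly when [- 1 < p * re l],
    and for such [l] the eigenvalues [r ^ l] run through the punctured disc of radius [rho]. The
    iterates reach the same radius from outside: [1 - |phi ^ n 0|] is at least a constant times
    [r ^ n], and Littlewood's constant for [phi ^ n] is [(4 / (1 - |phi ^ n 0|)) ^ (1 / p)]. The two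
    estimates leave no gap, hence the dichotomy for spectral subspaces.

    Boundary values of Hardy functions never appear. Estimates are made on circles of radius below
    [1], where integrands are continuous, and pass to the supremum defining the norm. Integrability
    of a negative power of [|u|] is obtained by domination with a positive harmonic function, whose
    circle means all equal its value at [0].

    Functions and functionals are bare maps: a function counts as zero when its norm is zero, a
    functional when it vanishes on H^p, and its values off H^p are arbitrary. *)

HB.instance Definition _ (R : realType) := NormedModule.copy R[i] (R[i]^o).

Section Modulus.
Variable R : realType.
Local Notation C := R[i].
Local Notation cabs := (@ComplexField.Normc.normc R).
Local Notation re := (@complex.Re R).
Local Notation im := (@complex.Im R).
Implicit Types (x y : R) (z w : C).

Lemma norm_cabs z : `|z| = ((cabs z)%:C)%C.
Proof. by rewrite normc_def; case: z. Qed.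

Lemma cabs_sqr z : cabs z ^+ 2 = re z ^+ 2 + im z ^+ 2.
Proof. by case: z => a b /=; rewrite sqr_sqrtr // addr_ge0 ?sqr_ge0. Qed.

Lemma cabs_ge0 z : 0 <= cabs z.
Proof. by case: z => a b /=; rewrite sqrtr_ge0. Qed.

Lemma cabs0 : cabs 0 = 0. Proof. exact: ComplexField.Normc.normc0. Qed.
Lemma cabs1 : cabs 1 = 1. Proof. exact: ComplexField.Normc.normc1. Qed.
Lemma cabsM z w : cabs (z * w) = cabs z * cabs w.
Proof. exact: ComplexField.Normc.normcM. Qed.
Lemma cabsV z : cabs z^-1 = (cabs z)^-1.
Proof. exact: ComplexField.Normc.normcV. Qed.

Lemma cabs_eq0 z : (cabs z == 0) = (z == 0).
Proof.
apply/eqP/eqP => [|->]; last exact: cabs0.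
exact: ComplexField.Normc.eq0_normc.
Qed.

Lemma cabs_gt0 z : (0 < cabs z) = (z != 0).
Proof. by rewrite lt_neqAle cabs_ge0 andbT eq_sym cabs_eq0. Qed.

Lemma cabsN z : cabs (- z) = cabs z.
Proof. by case: z => a b /=; rewrite !sqrrN. Qed.

Lemma cabsBC z w : cabs (z - w) = cabs (w - z).
Proof. by rewrite -cabsN opprB. Qed.

Lemma cabsX z n : cabs (z ^+ n) = cabs z ^+ n.
Proof.
by elim: n => [|n IH]; rewrite ?expr0 ?cabs1 // !exprS cabsM IH.
Qed.

Lemma cabsD z w : cabs (z + w) <= cabs z + cabs w.
Proof.
by have := ler_normD z w; rewrite !norm_cabs -rmorphD /= lecR.
Qed.

Lemma cabsB z w : cabs (z - w) <= cabs z + cabs w.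
Proof. by rewrite -(cabsN w) cabsD. Qed.

Lemma cabs_lbD z w : cabs z - cabs w <= cabs (z + w).
Proof. by rewrite lerBlDr -{1}(addrK w z) cabsB. Qed.

Lemma cabs_lbB z w : cabs z - cabs w <= cabs (z - w).
Proof. by rewrite -(cabsN w) cabs_lbD. Qed.

Lemma cabs_conj z : cabs (conjc z) = cabs z.
Proof. by case: z => a b /=; rewrite sqrrN. Qed.

Lemma cabs_real x : cabs x%:C%C = `|x|.
Proof. by rewrite /= expr0n addr0 sqrtr_sqr. Qed.

Lemma mulc_conj z : z * conjc z = ((cabs z ^+ 2)%:C)%C.
Proof. by rewrite -sqr_normc norm_cabs rmorphXn. Qed.

Lemma normRe_cabs z : `|re z| <= cabs z.
Proof. by have := normc_ge_Re z; rewrite norm_cabs lecR. Qed.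

Lemma Re_cabs z : re z <= cabs z.
Proof. exact: le_trans (ler_norm _) (normRe_cabs z). Qed.

Lemma normIm_cabs z : `|im z| <= cabs z.
Proof.
rewrite -ler_sqr ?nnegrE ?cabs_ge0 // real_normK ?num_real // cabs_sqr.
by rewrite lerDr sqr_ge0.
Qed.

Lemma cabs_ReIm z : cabs z <= `|re z| + `|im z|.
Proof.
case: z => a b; rewrite -[a]/(re (Complex a b)) -[b]/(im (Complex a b)).
rewrite -ler_sqr ?nnegrE ?cabs_ge0 ?addr_ge0 // cabs_sqr sqrrD !real_normK ?num_real //=.
by rewrite -addrA lerD2l lerDr mulrn_wge0 ?mulr_ge0.
Qed.

End Modulus.

(** * Limits and complex derivatives in terms of the real modulus *)

Section ComplexTopology.
Variable R : realType.
Local Notation C := R[i].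
Local Notation cabs := (@ComplexField.Normc.normc R).
Local Notation re := (@complex.Re R).
Local Notation im := (@complex.Im R).
Implicit Types (x y : R) (z w : C).

(** The norm of [R[i]] takes values in [R[i]], so balls have complex radii; a positive complex
    number is real, which gives back discs with a radius in [R]. *)
Lemma nbhs_cabsP z (P : set C) :
  nbhs z P <-> exists2 e : R, 0 < e & forall w, cabs (w - z) < e -> P w.
Proof.
split.
  case/(@nbhs_normP C C) => e /= e0 Pe.
  move: (e0); rewrite ltcE /= => /andP[/eqP e1 e2]; exists (re e) => // w wz.
  apply: Pe; rewrite /ball_ /= distrC norm_cabs ltcE /= e1 eqxx.
  exact: wz.
case=> e e0 Pe; apply/(@nbhs_normP C C); exists (e%:C)%C => /=.
  by rewrite ltcR.
by move=> w /=; rewrite distrC norm_cabs ltcR; exact: Pe.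
Qed.

Lemma cvg_cabsP (T : Type) (F : set_system T) (FF : Filter F) (f : T -> C) l :
  f @ F --> l <-> forall e : R, 0 < e -> \forall t \near F, cabs (f t - l) < e.
Proof.
split=> [fl e e0|H].
  have /fl : nbhs l [set w | cabs (w - l) < e] by apply/nbhs_cabsP; exists e.
  by [].
by move=> P /nbhs_cabsP[e e0 Pe]; move: (H e e0); apply: filterS => t /Pe.
Qed.

Lemma continuous_cabs : continuous (cabs : C -> R).
Proof.
move=> z; apply/(@cvgrPdist_lt R R C (nbhs z) (nbhs_filter z)) => e e0.
apply/nbhs_cabsP; exists e => // w wz /=.
rewrite ltr_norml; have := cabs_lbB z w; have := cabs_lbB w z.
rewrite cabsBC in wz; rewrite (cabsBC w z) => H1 H2.
apply/andP; split; last exact: le_lt_trans wz.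
by rewrite ltrNl opprB; exact: le_lt_trans wz.
Qed.

Lemma continuous_Re : continuous (re : C -> R).
Proof.
move=> z; apply/(@cvgrPdist_lt R R C (nbhs z) (nbhs_filter z)) => e e0.
apply/nbhs_cabsP; exists e => // w wz /=; apply: le_lt_trans wz.
by rewrite cabsBC (_ : re z - re w = re (z - w)) ?normRe_cabs //; case: z; case: w.
Qed.

Lemma continuous_Im : continuous (im : C -> R).
Proof.
move=> z; apply/(@cvgrPdist_lt R R C (nbhs z) (nbhs_filter z)) => e e0.
apply/nbhs_cabsP; exists e => // w wz /=; apply: le_lt_trans wz.
by rewrite cabsBC (_ : im z - im w = im (z - w)) ?normIm_cabs //; case: z; case: w.
Qed.

Lemma cvg_Complex (T : Type) (F : set_system T) (FF : Filter F) (f g : T -> R) a b :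
  f @ F --> a -> g @ F --> b ->
  (fun t => Complex (f t) (g t)) @ F --> Complex a b.
Proof.
move=> fa gb; apply/cvg_cabsP => e e0.
have e2 : 0 < e / 2 by rewrite divr_gt0.
move/cvgrPdist_lt: fa => /(_ _ e2) fa; move/cvgrPdist_lt: gb => /(_ _ e2) gb.
near=> t; apply: le_lt_trans (cabs_ReIm _) _ => /=.
rewrite [e]splitr; apply: ltrD; rewrite distrC; [near: t; exact: fa|near: t; exact: gb].
Unshelve. all: by end_near. Qed.

Lemma continuous_Complex (T : topologicalType) (f g : T -> R) (t : T) :
  {for t, continuous f} -> {for t, continuous g} ->
  {for t, continuous (fun t => Complex (f t) (g t))}.
Proof. exact: cvg_Complex. Qed.

Lemma continuous_polar : continuous (fun a : R * R => polar a.1 a.2 : C).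
Proof.
move=> [r t]; apply: (@continuous_Complex _ (fun a : R * R => a.1 * cos a.2)
  (fun a : R * R => a.1 * sin a.2)).
  apply: continuousM; first exact: cvg_fst.
  by apply: continuous_comp; [exact: cvg_snd|exact: continuous_cos].
apply: continuousM; first exact: cvg_fst.
by apply: continuous_comp; [exact: cvg_snd|exact: continuous_sin].
Qed.

Lemma differentiable_cabsP (f : C -> C) z :
  differentiable f z <-> exists L : C, forall e : R, 0 < e ->
    exists2 d : R, 0 < d & forall h : C, h != 0 -> cabs h < d ->
      cabs ((f (z + h) - f z) / h - L) < e.
Proof.
split=> [/derivable1_diffP/cvg_ex[l /cvg_cabsP H]|[L H]].
  exists l => e e0; have := H e e0.
  rewrite /dnbhs near_withinE => /nbhs_cabsP[d d0 Pd]; exists d => // h h0 hd.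
  have := Pd h; rewrite subr0 => /(_ hd h0).
  by rewrite /= [h *: 1]mulr1 [_ *: _]mulrC (addrC h).
apply/derivable1_diffP/cvg_ex; exists L; apply/cvg_cabsP => e e0.
rewrite /dnbhs near_withinE; apply/nbhs_cabsP; have [d d0 Pd] := H e e0.
exists d => // h; rewrite subr0 => hd h0; have := Pd h h0 hd.
by rewrite /= [h *: 1]mulr1 [_ *: _]mulrC (addrC h).
Qed.

Lemma holomorphic_onP (U : set C) (f : C -> C) : c_open U ->
  holomorphic_on U f <-> forall z, U z -> differentiable f z.
Proof.
move=> oU; split=> H z Uz.
  have [L HL] := H z Uz; apply/differentiable_cabsP; exists L => e e0.
  have [d d0 Hd] := HL e e0; have [d' d'0 Hd'] := oU z Uz.
  exists (Num.min d d'); first by rewrite lt_min d0.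
  move=> h h0; rewrite lt_min => /andP[hd hd']; apply: Hd => //.
  by apply: Hd'; rewrite addrAC subrr add0r.
have /differentiable_cabsP[L HL] := H z Uz; exists L => e e0.
have [d d0 Hd] := HL e e0; exists d => // h h0 hd _; exact: Hd.
Qed.

Lemma disc_open : c_open (@disc R).
Proof.
move=> z; rewrite /disc /= => z1; exists (1 - cabs z); first by rewrite subr_gt0.
move=> w; rewrite ltrBrDl => H; apply: le_lt_trans H.
by rewrite -{1}(subrK z w) addrC cabsD.
Qed.

Lemma near_disc (x : R) z : cabs z < x -> \forall w \near z, cabs w < x.
Proof.
move=> zx; have := @continuous_cabs z; move/cvgr_lt; exact.
Qed.

End ComplexTopology.

(** * Integrals of continuous functions *)

Section Integrals.
Variable R : realType.
Local Notation C := R[i].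
Local Notation cabs := (@ComplexField.Normc.normc R).
Local Notation re := (@complex.Re R).
Local Notation im := (@complex.Im R).
Local Notation mu := (@lebesgue_measure R).
Implicit Types (a b c : R) (f g : R -> R) (F G : R -> C).

Definition rint (a b : R) (f : R -> R) : R := \int[mu]_(t in `[a, b]) f t.

Lemma continuous_integrable a b (f : R -> R) : continuous f ->
  mu.-integrable `[a, b] (EFin \o f).
Proof.
move=> cf; apply: continuous_compact_integrable; first exact: segment_compact.
exact: continuous_subspaceT.
Qed.

Lemma rintD a b f g : continuous f -> continuous g ->
  rint a b (fun t => f t + g t) = rint a b f + rint a b g.
Proof.
by move=> cf cg; rewrite /rint RintegralD //; exact: continuous_integrable.
Qed.

Lemma rintZ a b (k : R) f : continuous f ->
  rint a b (fun t => k * f t) = k * rint a b f.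
Proof.
by move=> cf; rewrite /rint RintegralZl //; exact: continuous_integrable.
Qed.

Lemma rint_cst a b (k : R) : a <= b -> rint a b (fun=> k) = k * (b - a).
Proof.
move=> ab; rewrite /rint Rintegral_cst //= (lebesgue_measure_itv `[a, b]%R) /= lte_fin.
by move: ab; rewrite le_eqVlt => /predU1P[->|->] //; rewrite ltxx subrr.
Qed.

Lemma le_rint a b f g : continuous f -> continuous g ->
  (forall t, a <= t <= b -> f t <= g t) -> rint a b f <= rint a b g.
Proof.
move=> cf cg fg; apply: le_Rintegral => //; exact: continuous_integrable.
Qed.

Lemma rint_split a b c f : continuous f -> a <= c -> c <= b ->
  rint a b f = rint a c f + rint c b f.
Proof.
move=> cf ac cb; rewrite /rint.
have := @Rintegral_itvB R f (BLeft a) (BRight b) c (continuous_integrable a b cf).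
rewrite !bnd_simp => /(_ ac cb) /eqP; rewrite subr_eq => /eqP ->.
rewrite addrC Rintegral_itv_obnd_cbnd //.
apply: integrableS (continuous_integrable c b cf) => //.
exact: subset_itv_oc_cc.
Qed.

Lemma eq_rint a b f g : (forall t, a <= t <= b -> f t = g t) ->
  rint a b f = rint a b g.
Proof.
move=> fg; apply: eq_Rintegral => t; rewrite inE /= in_itv /=; exact: fg.
Qed.

(** Compactness of the segment makes a property that holds near each [t] hold for all [t] at
    once. *)
Lemma unif_near (T : Type) (F : set_system T) (FF : Filter F)
    a b (P : T -> R -> Prop) :
  (forall t, a <= t <= b -> \forall t' \near t & s \near F, P s t') ->
  \forall s \near F, forall t, a <= t <= b -> P s t.
Proof.
move=> H; have /compact_near_coveringP K := @segment_compact R a b.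
have {K} /(K T F P FF) : forall x, `[a, b]%classic x ->
    \forall x' \near x & i \near F, P i x'.
  by move=> x; rewrite /= in_itv /=; exact: H.
by apply: filterS => s Ps t tab; apply: Ps; rewrite /= in_itv.
Qed.

Lemma rint_cvg (T : Type) (F : set_system T) (FF : Filter F)
    a b (G : T -> R -> R) (g : R -> R) :
  a <= b -> (\forall s \near F, continuous (G s)) -> continuous g ->
  (forall t e, a <= t <= b -> 0 < e ->
     \forall t' \near t & s \near F, `|G s t' - g t'| < e) ->
  (fun s => rint a b (G s)) @ F --> rint a b g.
Proof.
move=> ab cG cg H; apply/cvgrPdist_le => e e0.
(* The added [1] keeps the divisor positive when [a = b]. *)
have e1 : 0 < e / (b - a + 1) by rewrite divr_gt0 // ltr_wpDl // subr_ge0.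
have := @unif_near T F FF a b (fun s t => `|G s t - g t| < e / (b - a + 1))
  (fun t tab => H t _ tab e1).
apply: filterS2 cG => s cGs Hs.
have le_e : e / (b - a + 1) * (b - a) <= e.
  rewrite -mulrA ger_pMr // mulrC ler_pdivrMr ?mul1r ?lerDl //.
  by rewrite ltr_wpDl // subr_ge0.
have cN : continuous (fun t => - 1 * G s t) by move=> x; apply: cvgM; [exact: cvg_cst|exact: cGs].
rewrite -[- _]mulN1r -rintZ // -rintD // ler_norml; apply/andP; split.
  apply: le_trans (_ : rint a b (fun=> - (e / (b - a + 1))) <= _).
    by rewrite rint_cst // mulNr lerN2.
  apply: le_rint => [x|x|t tab]; first exact: cvg_cst.
    by apply: cvgD; [exact: cg|exact: cN].
  by have := Hs t tab; rewrite distrC ltr_norml mulN1r => /andP[/ltW].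
apply: le_trans le_e; rewrite -rint_cst //.
apply: le_rint => [x||t tab]; last 1 first.
- by have := Hs t tab; rewrite distrC ltr_norml mulN1r => /andP[_ /ltW].
- by apply: cvgD; [exact: cg|exact: cN].
- by move=> x; exact: cvg_cst.
Qed.

Definition cint (a b : R) (F : R -> C) : C :=
  Complex (rint a b (re \o F)) (rint a b (im \o F)).

Lemma continuousRe (T : topologicalType) (F : T -> C) : continuous F -> continuous (re \o F).
Proof. by move=> cF t; apply: continuous_comp; [exact: cF|exact: continuous_Re]. Qed.
Lemma continuousIm (T : topologicalType) (F : T -> C) : continuous F -> continuous (im \o F).
Proof. by move=> cF t; apply: continuous_comp; [exact: cF|exact: continuous_Im]. Qed.
Lemma continuousCabs (T : topologicalType) (F : T -> C) : continuous F -> continuous (cabs \o F).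
Proof. by move=> cF t; apply: continuous_comp; [exact: cF|exact: continuous_cabs]. Qed.

Lemma continuousMl (k : R) (f : R -> R) : continuous f -> continuous (fun t => k * f t).
Proof. by move=> cf t; apply: cvgM; [exact: cvg_cst|exact: cf]. Qed.

Lemma ccontinuous_cst (T : topologicalType) (k : C) : continuous (fun _ : T => k).
Proof. by move=> t; exact: cvg_cst. Qed.

Lemma ccontinuousD (T : topologicalType) (F G : T -> C) :
  continuous F -> continuous G -> continuous (fun t => F t + G t).
Proof. by move=> cF cG t; apply: cvgD; [exact: cF|exact: cG]. Qed.

Lemma ccontinuousM (T : topologicalType) (F G : T -> C) :
  continuous F -> continuous G -> continuous (fun t => F t * G t).
Proof. by move=> cF cG t; apply: cvgM; [exact: cF|exact: cG]. Qed.

Lemma ccontinuousN (T : topologicalType) (F : T -> C) :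
  continuous F -> continuous (fun t => - F t).
Proof. by move=> cF t; apply: cvgN; exact: cF. Qed.

Lemma ccontinuousV (T : topologicalType) (F : T -> C) :
  continuous F -> (forall t, F t != 0) -> continuous (fun t => (F t)^-1).
Proof. by move=> cF F0 t; apply: cvgV; [exact: F0|exact: cF]. Qed.

Lemma cintD a b F G : continuous F -> continuous G ->
  cint a b (fun t => F t + G t) = cint a b F + cint a b G.
Proof.
move=> cF cG; rewrite /cint.
have -> : re \o (fun t => F t + G t) = (fun t => (re \o F) t + (re \o G) t).
  by apply/funext => t /=; case: (F t); case: (G t).
have -> : im \o (fun t => F t + G t) = (fun t => (im \o F) t + (im \o G) t).
  by apply/funext => t /=; case: (F t); case: (G t).
rewrite (rintD a b (continuousRe cF) (continuousRe cG)).
by rewrite (rintD a b (continuousIm cF) (continuousIm cG)).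
Qed.

Lemma cintZ a b (k : C) F : continuous F ->
  cint a b (fun t => k * F t) = k * cint a b F.
Proof.
move=> cF; rewrite /cint; case: k => x y.
have cR := continuousRe cF; have cI := continuousIm cF.
have -> : re \o (fun t => (Complex x y) * F t) =
    (fun t => x * (re \o F) t + (- y) * (im \o F) t).
  by apply/funext => t /=; case: (F t) => ? ? /=; rewrite mulNr.
have -> : im \o (fun t => (Complex x y) * F t) =
    (fun t => x * (im \o F) t + y * (re \o F) t).
  by apply/funext => t /=; case: (F t).
rewrite (rintD _ _ (continuousMl (k:=x) cR) (continuousMl (k:=- y) cI)).
rewrite (rintD _ _ (continuousMl (k:=x) cI) (continuousMl (k:=y) cR)).
by rewrite !(rintZ _ _ _ cR) !(rintZ _ _ _ cI) mulNr.
Qed.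

Lemma cint_cst a b (k : C) : a <= b -> cint a b (fun=> k) = k * ((b - a)%:C)%C.
Proof.
move=> ab; rewrite /cint !rint_cst //; case: k => x y /=.
by rewrite [RHS]/(_ * _) /= !mulr0 subr0 add0r.
Qed.

Lemma cint_split a b c F : continuous F -> a <= c -> c <= b ->
  cint a b F = cint a c F + cint c b F.
Proof.
move=> cF ac cb; rewrite /cint (rint_split (continuousRe cF) ac cb).
by rewrite (rint_split (continuousIm cF) ac cb).
Qed.

Lemma eq_cint a b F G : (forall t, a <= t <= b -> F t = G t) ->
  cint a b F = cint a b G.
Proof.
by move=> FG; congr Complex; apply: eq_rint => t /FG /= ->.
Qed.

Lemma cintN a b F : continuous F -> cint a b (fun t => - F t) = - cint a b F.
Proof.
move=> cF; rewrite -mulN1r -(cintZ a b _ cF); apply: eq_cint => t _; by rewrite mulN1r.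
Qed.

Lemma cintB a b F G : continuous F -> continuous G ->
  cint a b (fun t => F t - G t) = cint a b F - cint a b G.
Proof. by move=> cF cG; rewrite (cintD a b cF (ccontinuousN cG)) (cintN a b cG). Qed.

(* Rotating the integral onto the positive real axis. *)
Lemma cabs_cint a b F g : a <= b -> continuous F -> continuous g ->
  (forall t, a <= t <= b -> cabs (F t) <= g t) ->
  cabs (cint a b F) <= rint a b g.
Proof.
move=> ab cF cg FM; have [->|I0] := eqVneq (cint a b F) 0.
  rewrite cabs0 -[X in X <= _](_ : rint a b (fun=> 0) = _); last by rewrite rint_cst // mul0r.
  by apply: le_rint => // [x|t /FM]; [exact: cvg_cst|exact: le_trans (cabs_ge0 _)].
set I := cint a b F in I0 *; pose k := conjc I / ((cabs I)%:C)%C.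
have cI0 : cabs I != 0 by rewrite cabs_eq0.
have kI : k * I = ((cabs I)%:C)%C.
  rewrite /k mulrAC (mulrC _ I) mulc_conj -rmorphV ?unitfE // -rmorphM /=.
  by rewrite expr2 mulfK.
have k1 : cabs k = 1.
  rewrite /k cabsM cabs_conj cabsV cabs_real ger0_norm ?cabs_ge0 //.
  by rewrite divff.
have ckF : continuous (fun t => k * F t).
  by move=> t; apply: cvgM; [exact: cvg_cst|exact: cF].
have <- : rint a b (re \o (fun t => k * F t)) = cabs I.
  by have := cintZ a b k cF; rewrite -/I kI => -[].
apply: le_rint => // [|t tab]; first exact: continuousRe.
by apply: le_trans (Re_cabs _) _; rewrite cabsM k1 mul1r FM.
Qed.

Lemma cabs_cint_le a b F M : a <= b -> continuous F ->
  (forall t, a <= t <= b -> cabs (F t) <= M) ->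
  cabs (cint a b F) <= M * (b - a).
Proof.
move=> ab cF FM; rewrite -rint_cst //; apply: cabs_cint => // x; exact: cvg_cst.
Qed.

Lemma cint_cvg (T : Type) (FT : set_system T) (FF : Filter FT)
    a b (G : T -> R -> C) (g : R -> C) :
  a <= b -> (\forall s \near FT, continuous (G s)) -> continuous g ->
  (forall t e, a <= t <= b -> 0 < e ->
     \forall t' \near t & s \near FT, cabs (G s t' - g t') < e) ->
  (fun s => cint a b (G s)) @ FT --> cint a b g.
Proof.
move=> ab cG cg H; apply: cvg_Complex; apply: rint_cvg => //.
- by apply: filterS cG => s; exact: continuousRe.
- exact: continuousRe.
- move=> t e tab e0; apply: filterS (H t e tab e0) => -[t' s] /=; apply: le_lt_trans.
  apply: le_trans (normRe_cabs _); rewrite le_eqVlt; apply/orP; left.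
  by case: (G s t'); case: (g t').
- by apply: filterS cG => s; exact: continuousIm.
- exact: continuousIm.
- move=> t e tab e0; apply: filterS (H t e tab e0) => -[t' s] /=; apply: le_lt_trans.
  apply: le_trans (normIm_cabs _); rewrite le_eqVlt; apply/orP; left.
  by case: (G s t'); case: (g t').
Qed.

Lemma continuous_cabs_powR (p : R) : 0 < p -> continuous (fun z : C => cabs z `^ p).
Proof.
move=> p0 z; have [->|z0] := eqVneq z 0.
  apply/(@cvgrPdist_lt R R C (nbhs (0 : C)) (nbhs_filter _)) => e e0.
  apply/nbhs_cabsP; exists (e `^ p^-1); first exact: powR_gt0.
  move=> w; rewrite subr0 cabs0 powR0 ?gt_eqF // sub0r normrN ger0_norm ?powR_ge0 //.
  move=> we; rewrite -[ltRHS](@powRr1 R) ?ltW // -(@mulVf _ p) ?gt_eqF // powRrM.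
  by apply: gt0_ltr_powR => //; rewrite nnegrE ?cabs_ge0 ?powR_ge0.
suff H : {for z, continuous ((fun x : R => x `^ p) \o (cabs : C -> R))} by exact: H.
apply: continuous_comp; first exact: continuous_cabs.
apply: differentiable_continuous; apply/derivable1_diffP.
by apply: derivable_powR; rewrite in_itv /= andbT cabs_gt0.
Qed.

End Integrals.

(** * The complex exponential *)

Section ComplexExponential.
Variable R : realType.
Local Notation C := R[i].
Local Notation cabs := (@ComplexField.Normc.normc R).
Local Notation re := (@complex.Re R).
Local Notation im := (@complex.Im R).

Definition cexp (z : C) : C := polar (expR (re z)) (im z).

Lemma mulcE (a b c d : R) :
  Complex a b * Complex c d = Complex (a * c - b * d) (a * d + b * c) :> C.
Proof. by []. Qed.

Lemma addcE (a b c d : R) : Complex a b + Complex c d = Complex (a + c) (b + d) :> C.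
Proof. by []. Qed.

Lemma oppcE (a b : R) : - Complex a b = Complex (- a) (- b) :> C.
Proof. by []. Qed.

Lemma polarM (r s x y : R) : polar r x * polar s y = polar (r * s) (x + y) :> C.
Proof.
rewrite /polar mulcE cosD sinD; congr Complex; ring.
Qed.

Lemma cabs_polar (r t : R) : cabs (polar r t) = `|r|.
Proof.
rewrite /polar /= !exprMn -mulrDr addrC.
by rewrite (addrC (sin t ^+ 2)) cos2Dsin2 mulr1 sqrtr_sqr.
Qed.

Lemma cexpD z w : cexp (z + w) = cexp z * cexp w.
Proof. by case: z w => [a b] [c d]; rewrite /cexp polarM /= expRD. Qed.

Lemma cexp0 : cexp 0 = 1.
Proof. by rewrite /cexp /polar /= expR0 cos0 sin0 mulr1 mulr0. Qed.

Lemma cabs_cexp z : cabs (cexp z) = expR (re z).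
Proof. by rewrite cabs_polar ger0_norm ?expR_ge0. Qed.

Lemma cexp_neq0 z : cexp z != 0.
Proof. by rewrite -cabs_eq0 cabs_cexp gt_eqF ?expR_gt0. Qed.

Lemma cexpN z : cexp (- z) = (cexp z)^-1.
Proof.
by apply: (mulfI (cexp_neq0 z)); rewrite -cexpD subrr cexp0 divff ?cexp_neq0.
Qed.

Lemma cexpB z w : cexp (z - w) = cexp z / cexp w.
Proof. by rewrite cexpD cexpN. Qed.

Lemma MVT_origin (f df : R -> R) : (forall x : R, is_derive x 1 f (df x)) -> f 0 = 0 ->
  forall y, exists2 c, `|c| <= `|y| & f y = df c * y.
Proof.
move=> fdf f0 y; have cf : continuous f.
  by move=> x; apply: differentiable_continuous; apply/derivable1_diffP; have := fdf x => -[].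
have [y0|y0|<-] := ltrgtP 0 y; last by exists 0; rewrite // f0 mulr0.
- have [//|c] := @MVT R f df 0 y y0 (fun x _ => fdf x); first exact: continuous_subspaceT.
  rewrite in_itv /= => /andP[c0 cy]; rewrite f0 !subr0 => ->; exists c => //.
  by rewrite !gtr0_norm // ltW.
- have [//|c] := @MVT R f df y 0 y0 (fun x _ => fdf x); first exact: continuous_subspaceT.
  rewrite in_itv /= => /andP[c0 cy]; rewrite f0 !sub0r mulrN => /oppr_inj ->.
  by exists c => //; rewrite !ltr0_norm // lerN2 ltW.
Qed.

Lemma norm_sin_le (y : R) : `|sin y| <= `|y|.
Proof.
have [c _ ->] := @MVT_origin (@sin R) (@cos R) (fun x => is_derive_sin x) (sin0 R) y.
by rewrite normrM ler_piMl // cos_max.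
Qed.

Lemma norm_cosB1_le (y : R) : `|cos y - 1| <= y ^+ 2.
Proof.
have H (x : R) : is_derive x 1 (fun x : R => cos x - 1) (- sin x).
  by apply: is_derive_eq; rewrite subr0.
have [c cy /= ->] := MVT_origin H (etrans (congr1 (fun a => a - 1) (cos0 R)) (subrr _)) y.
rewrite -real_normK ?num_real // expr2 normrM normrN ler_wpM2r //.
exact: le_trans (norm_sin_le _) cy.
Qed.

Lemma norm_sinB_le (y : R) : `|sin y - y| <= y ^+ 2.
Proof.
have H (x : R) : is_derive x 1 (fun x : R => sin x - x) (cos x - 1).
  by apply: is_derive_eq.
have f0 : sin 0 - 0 = 0 :> R by rewrite sin0 subrr.
have [c cy /= ->] := MVT_origin H f0 y.
rewrite -real_normK ?num_real // expr2 normrM ler_wpM2r //.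
have H1 (x : R) : is_derive x 1 (fun x : R => cos x - 1) (- sin x).
  by apply: is_derive_eq; rewrite subr0.
have [d dy /= ->] := MVT_origin H1 (etrans (congr1 (fun a => a - 1) (cos0 R)) (subrr _)) c.
by apply: le_trans cy; rewrite normrM normrN ler_piMl // sin_max.
Qed.

Lemma norm_expRB1_le (x : R) : `|expR x - 1| <= `|x| * expR `|x|.
Proof.
have := expR_ge1Dx x; have := expR_ge1Dx (- x).
have e0 := expR_gt0 x; move=> H1 H2.
have H3 : expR x - 1 <= x * expR x.
  move: H1; rewrite -(ler_pM2r e0) expRN mulVf ?gt_eqF // => ?; lra.
have [x0|x0] := lerP 0 x.
  by rewrite !ger0_norm //; lra.
rewrite !ltr0_norm //; last by rewrite subr_lt0 expR_lt1.
have : 1 <= expR (- x) by rewrite -expR0 ler_expR oppr_ge0 ltW.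
move=> H4; nra.
Qed.

Lemma norm_expRB1B_le (x : R) : `|expR x - 1 - x| <= x ^+ 2 * expR `|x|.
Proof.
have := expR_ge1Dx x; have := expR_ge1Dx (- x).
have e0 := expR_gt0 x; move=> H1 H2.
have H3 : expR x - 1 <= x * expR x.
  move: H1; rewrite -(ler_pM2r e0) expRN mulVf ?gt_eqF // => ?; lra.
rewrite ger0_norm; last lra.
have := norm_expRB1_le x; have [x0|x0] := lerP 0 x.
  rewrite ger0_norm; last lra.
  rewrite (ger0_norm x0) => H4; nra.
move=> _; rewrite ltr0_norm //.
have : 1 <= expR (- x) by rewrite -expR0 ler_expR oppr_ge0 ltW.
move=> H4; nra.
Qed.

(** The error splits into four real terms built from the Taylor errors of [expR], [cos] and [sin].
    With [E = expR (cabs h)] they are at most [x ^ 2 E], [y ^ 2 E], [y ^ 2 E] and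
    [(x ^ 2 + y ^ 2) E], whence the factor [3]. *)
Lemma cexp_taylor1 (h : C) :
  cabs (cexp h - 1 - h) <= 3 * cabs h ^+ 2 * expR (cabs h).
Proof.
case: h => x y; set h := Complex x y.
have -> : cabs h ^+ 2 = x ^+ 2 + y ^+ 2 by rewrite cabs_sqr.
have hx : `|x| <= cabs h by exact: (normRe_cabs h).
have ee : expR `|x| <= expR (cabs h) by rewrite ler_expR.
have e1 : expR x <= expR (cabs h) by rewrite ler_expR (le_trans (ler_norm _)).
have e0 := expR_gt0 x; have E0 := expR_gt0 (cabs h).
have -> : cexp h - 1 - h = Complex (expR x - 1 - x + expR x * (cos y - 1))
    (expR x * (sin y - y) + (expR x - 1) * y).
  rewrite /cexp /polar /h /= (_ : (1 : C) = Complex 1 0) // !oppcE !addcE; congr Complex; ring.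
apply: le_trans (cabs_ReIm _) _ => /=.
apply: le_trans (lerD (ler_normD _ _) (ler_normD _ _)) _.
rewrite !normrM (gtr0_norm e0).
have A1 := norm_expRB1B_le x; have A2 := norm_expRB1_le x.
have A3 := norm_sinB_le y; have A4 := norm_cosB1_le y.
have B1 : `|expR x - 1 - x| <= x ^+ 2 * expR (cabs h).
  by apply: le_trans A1 _; rewrite ler_wpM2l ?sqr_ge0.
have B2 : expR x * `|cos y - 1| <= y ^+ 2 * expR (cabs h).
  by rewrite mulrC; apply: ler_pM => //; exact: ltW.
have B3 : expR x * `|sin y - y| <= y ^+ 2 * expR (cabs h).
  by rewrite mulrC; apply: ler_pM => //; exact: ltW.
have B4 : `|expR x - 1| * `|y| <= `|x| * `|y| * expR (cabs h).
  rewrite mulrAC ler_wpM2r //; apply: le_trans A2 _; rewrite ler_wpM2l //.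
have B5 : `|x| * `|y| <= x ^+ 2 + y ^+ 2.
  rewrite -(real_normK (num_real x)) -(real_normK (num_real y)).
  have := sqr_ge0 (`|x| - `|y|); have := mulr_ge0 (normr_ge0 x) (normr_ge0 y); nra.
have B6 : `|x| * `|y| * expR (cabs h) <= (x ^+ 2 + y ^+ 2) * expR (cabs h).
  by rewrite ler_pM2r.
have := mulr_ge0 (sqr_ge0 x) (ltW E0); have := mulr_ge0 (sqr_ge0 y) (ltW E0).
lra.
Qed.

Lemma differentiable_cexp (z : C) : differentiable cexp z.
Proof.
apply/differentiable_cabsP; exists (cexp z) => e e0.
set K := cabs (cexp z) * (3 * expR 1) + 1.
have K0 : 0 < K by rewrite ltr_wpDl ?mulr_ge0 ?cabs_ge0 ?expR_ge0.
exists (Num.min 1 (e / K)); first by rewrite lt_min ltr01 divr_gt0.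
move=> h h0; rewrite lt_min => /andP[h1 he].
have -> : (cexp (z + h) - cexp z) / h - cexp z = cexp z * ((cexp h - 1 - h) / h).
  by rewrite cexpD; field.
rewrite cabsM cabsM cabsV.
have ch0 : 0 < cabs h by rewrite cabs_gt0.
have H : cabs (cexp h - 1 - h) / cabs h <= 3 * expR 1 * cabs h.
  rewrite ler_pdivrMr //; apply: le_trans (cexp_taylor1 _) _.
  rewrite -(mulrA _ (expR 1)) -mulrA mulrCA (mulrA _ (expR 1)) [leRHS]mulrC expr2.
  have : expR (cabs h) <= expR 1 by rewrite ler_expR ltW.
  have : 0 < cabs h * cabs h by rewrite mulr_gt0.
  nra.
apply: le_lt_trans (_ : _ <= cabs (cexp z) * (3 * expR 1 * cabs h)) _.
  by rewrite ler_wpM2l ?cabs_ge0.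
rewrite mulrA; apply: le_lt_trans (_ : _ <= K * cabs h) _.
  by rewrite ler_pM2r // lerDl.
by rewrite mulrC -ltr_pdivlMr.
Qed.

End ComplexExponential.

(** * Goursat's theorem on rectangles *)

Section Goursat.
Variable R : realType.
Local Notation C := R[i].
Local Notation cabs := (@ComplexField.Normc.normc R).
Local Notation re := (@complex.Re R).
Local Notation iu := (Complex 0 1 : C).

Lemma nested_intervals (u v : nat -> R) :
  (forall n, u n <= u n.+1) -> (forall n, v n.+1 <= v n) -> (forall n, u n <= v n) ->
  exists x, forall n, u n <= x <= v n.
Proof.
move=> /nondecreasing_seqP hu /nonincreasing_seqP hv uv.
have uvmn m n : u m <= v n.
  apply: le_trans (hu _ _ (leq_maxl m n)) _.
  exact: le_trans (uv _) (hv _ _ (leq_maxr m n)).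
exists (sup (range u)) => n; apply/andP; split.
  apply: ub_le_sup; last by exists n.
  by exists (v n) => _ [m _ <-].
apply: ge_sup; first by exists (u 0%N); exists 0%N.
by move=> _ [m _ <-].
Qed.

Lemma rint_id (a b : R) : a <= b -> rint a b id = (b ^+ 2 - a ^+ 2) / 2.
Proof.
rewrite le_eqVlt => /predU1P[->|ab].
  by rewrite /rint set_itv1 Rintegral_set1 subrr mul0r.
pose F (x : R) := x ^+ 2 / 2.
have dF (x : R) : is_derive x 1 F x.
  rewrite /F; apply: is_derive_eq.
  rewrite /= !scaler0 add0r /GRing.scale /= mulr1 -mulr2n -[x *+ 2]mulr_natl mulrA mulVf ?mul1r //.
rewrite /rint /Rintegral (@continuous_FTC2 R id F a b ab).
- by rewrite -EFinB /= /F -mulrBl.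
- by apply: continuous_subspaceT => x; exact: cvg_id.
- have cF (x : R) : {for x, continuous F}.
    by apply: differentiable_continuous; apply/derivable1_diffP; case: (dF x).
  split => [x _|//|//]; first by case: (dF x).
    by apply: cvg_at_right_filter; exact: cF.
  by apply: cvg_at_left_filter; exact: cF.
- by move=> x _; rewrite derive1E; case: (dF x).
Qed.

Lemma cint_affine (a b : R) (P Q : C) : a <= b ->
  cint a b (fun s => P + Q * (s%:C)%C) =
  P * ((b - a)%:C)%C + Q * (((b ^+ 2 - a ^+ 2) / 2)%:C)%C.
Proof.
move=> ab; have cC : continuous (fun s : R => (s%:C)%C : C).
  by move=> s; apply: cvg_Complex; [exact: cvg_id|exact: cvg_cst].
have cQ : continuous (fun s : R => Q * (s%:C)%C).
  by move=> s; apply: cvgM; [exact: cvg_cst|exact: cC].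
have cP : continuous (fun _ : R => P) by move=> s; exact: cvg_cst.
rewrite (cintD a b cP cQ) (cint_cst _ ab) (cintZ a b Q cC).
congr (_ + _ * _); rewrite /cint -(rint_id ab); congr Complex.
rewrite -[RHS](_ : rint a b (fun=> 0) = 0) //.
by rewrite (rint_cst _ ab) mul0r.
Qed.

(** The contour integral of [g] along the boundary of [[a, b] x [c, d]], counterclockwise: the
    bottom and top edges, then the right and left ones with [dz = i dt]. *)
Definition rect (g : C -> C) (a b c d : R) : C :=
  cint a b (fun s => g (Complex s c)) - cint a b (fun s => g (Complex s d)) +
  iu * (cint c d (fun t => g (Complex b t)) - cint c d (fun t => g (Complex a t))).

Lemma continuous_horizontal (g : C -> C) (t : R) : continuous g ->
  continuous (fun s => g (Complex s t)).
Proof.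
move=> cg s; apply: (@continuous_comp _ _ _ (fun s => Complex s t) g); last exact: cg.
by apply: cvg_Complex; [exact: cvg_id|exact: cvg_cst].
Qed.

Lemma continuous_vertical (g : C -> C) (s : R) : continuous g ->
  continuous (fun t => g (Complex s t)).
Proof.
move=> cg t; apply: (@continuous_comp _ _ _ (fun t => Complex s t) g); last exact: cg.
by apply: cvg_Complex; [exact: cvg_cst|exact: cvg_id].
Qed.

Lemma rect_split (g : C -> C) (a m b c n d : R) : continuous g ->
  a <= m -> m <= b -> c <= n -> n <= d ->
  rect g a b c d = rect g a m c n + rect g m b c n + rect g a m n d + rect g m b n d.
Proof.
move=> cg am mb cn nd; rewrite /rect.
have ch t := continuous_horizontal (t:=t) cg; have cv s := continuous_vertical (s:=s) cg.
rewrite (cint_split (ch c) am mb) (cint_split (ch d) am mb).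
rewrite (cint_split (cv a) cn nd) (cint_split (cv b) cn nd).
ring.
Qed.

Lemma rectD (g h : C -> C) a b c d : continuous g -> continuous h ->
  rect (fun z => g z + h z) a b c d = rect g a b c d + rect h a b c d.
Proof.
move=> cg ch; rewrite /rect.
rewrite !(cintD a b (continuous_horizontal cg) (continuous_horizontal ch)).
rewrite !(cintD c d (continuous_vertical cg) (continuous_vertical ch)).
ring.
Qed.

Lemma rect_affine (A B : C) a b c d : a <= b -> c <= d ->
  rect (fun z => A + B * z) a b c d = 0.
Proof.
move=> ab cd; rewrite /rect.
have H t : cint a b (fun s => A + B * Complex s t) =
    cint a b (fun s => (A + B * iu * (t%:C)%C) + B * (s%:C)%C).
  apply: eq_cint => s _; rewrite -addrA -mulrA -mulrDr; congr (_ + _ * _).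
  by rewrite mulcE addcE; congr Complex; ring.
have V s : cint c d (fun t => A + B * Complex s t) =
    cint c d (fun t => (A + B * (s%:C)%C) + (B * iu) * (t%:C)%C).
  apply: eq_cint => t _; rewrite -addrA -mulrA -mulrDr; congr (_ + _ * _).
  by rewrite mulcE addcE; congr Complex; ring.
rewrite !H !V !cint_affine // !rmorphB /=; ring.
Qed.

Lemma cabs_rect_le (g : C -> C) a b c d M : continuous g -> a <= b -> c <= d ->
  (forall s t, a <= s <= b -> c <= t <= d -> cabs (g (Complex s t)) <= M) ->
  cabs (rect g a b c d) <= M * (2 * ((b - a) + (d - c))).
Proof.
move=> cg ab cd gM; rewrite /rect.
have ch t := continuous_horizontal (t:=t) cg; have cv s := continuous_vertical (s:=s) cg.
have aa : a <= a <= b by rewrite lexx.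
have bb : a <= b <= b by rewrite lexx andbT.
have cc : c <= c <= d by rewrite lexx.
have dd : c <= d <= d by rewrite lexx andbT.
have H1 := cabs_cint_le ab (ch c) (fun s sab => gM s c sab cc).
have H2 := cabs_cint_le ab (ch d) (fun s sab => gM s d sab dd).
have H3 := cabs_cint_le cd (cv b) (fun t => gM b t bb).
have H4 := cabs_cint_le cd (cv a) (fun t => gM a t aa).
apply: le_trans (cabsD _ _) _; rewrite cabsM.
have -> : cabs iu = 1 by rewrite /= expr0n add0r expr1n sqrtr1.
rewrite mul1r; apply: le_trans (lerD (cabsB _ _) (cabsB _ _)) _; lra.
Qed.

(** The integrals over the four quarters add up to the whole, so one of them carries at least a
    quarter of its modulus. *)
Lemma rect_quarter (g : C -> C) (x y l m : R) : continuous g -> 0 <= l -> 0 <= m ->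
  exists q : R * R, [/\ x <= q.1 <= x + l / 2, y <= q.2 <= y + m / 2 &
    cabs (rect g x (x + l) y (y + m)) <=
    4 * cabs (rect g q.1 (q.1 + l / 2) q.2 (q.2 + m / 2))].
Proof.
move=> cg l0 m0; set B := cabs _.
have xl : x <= x + l / 2 by rewrite lerDl divr_ge0.
have ym : y <= y + m / 2 by rewrite lerDl divr_ge0.
have xl2 : x + l / 2 <= x + l by rewrite lerD2l ler_pdivrMr // mulr_natr mulr2n lerDl.
have ym2 : y + m / 2 <= y + m by rewrite lerD2l ler_pdivrMr // mulr_natr mulr2n lerDl.
have El : x + l / 2 + l / 2 = x + l by rewrite -addrA -splitr.
have Em : y + m / 2 + m / 2 = y + m by rewrite -addrA -splitr.
pose r2 u v := cabs (rect g u (u + l / 2) v (v + m / 2)).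
pose rr (q : R * R) := r2 q.1 q.2.
have HB : B <= rr (x, y) + rr (x + l / 2, y) + rr (x, y + m / 2) + rr (x + l / 2, y + m / 2).
  change (B <= r2 x y + r2 (x + l / 2) y + r2 x (y + m / 2) + r2 (x + l / 2) (y + m / 2)).
  rewrite /B (rect_split cg xl xl2 ym ym2) /r2 El Em.
  by do 3 (apply: le_trans (cabsD _ _) _; rewrite lerD2r).
suff [q [qx [qy Hq]]] : exists q : R * R, (q.1 = x \/ q.1 = x + l / 2) /\
    (q.2 = y \/ q.2 = y + m / 2) /\ B <= 4 * rr q.
  exists q; split => //; [case: qx => ->|case: qy => ->]; by rewrite ?lexx ?xl ?ym.
have [H1|H1] := lerP B (4 * rr (x, y)); first by exists (x, y); split; [left|split=> //; left].
have [H2|H2] := lerP B (4 * rr (x + l / 2, y)); first by exists (x + l / 2, y); split; [right|split=> //; left].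
have [H3|H3] := lerP B (4 * rr (x, y + m / 2)); first by exists (x, y + m / 2); split; [left|split=> //; right].
exists (x + l / 2, y + m / 2); split; [by right|split; [by right|]].
by move: H1 H2 H3 HB; clear; lra.
Qed.

(** Repeated quartering. Continuity is asked on the whole plane and differentiability only on a
    vertical strip, to suit the clamped function of [cmean_annulus]. *)
Lemma goursat (g : C -> C) (S1 S2 a b c d : R) : continuous g ->
  (forall z, S1 < re z < S2 -> differentiable g z) ->
  S1 < a -> a <= b -> b < S2 -> c <= d -> rect g a b c d = 0.
Proof.
move=> cg dg Sa ab bS cd.
set l := b - a; set m := d - c.
have l0 : 0 <= l by rewrite subr_ge0.
have m0 : 0 <= m by rewrite subr_ge0.
pose w n := (2^-1 : R) ^+ n.
have w0 n : 0 < w n by rewrite exprn_gt0.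
have wS n : w n.+1 = w n / 2 by rewrite /w exprSr.
have step (n : nat) (p : R * R) : exists q : R * R,
    [/\ p.1 <= q.1 <= p.1 + l * w n / 2, p.2 <= q.2 <= p.2 + m * w n / 2 &
    cabs (rect g p.1 (p.1 + l * w n) p.2 (p.2 + m * w n)) <=
    4 * cabs (rect g q.1 (q.1 + l * w n / 2) q.2 (q.2 + m * w n / 2))].
  by apply: rect_quarter => //; rewrite mulr_ge0 // ltW.
pose nxt n p := sval (cid (step n p)).
pose s := fix s n := if n is n'.+1 then nxt n' (s n') else (a, c).
have sP n := svalP (cid (step n (s n))).
have {sP} s_next n : [/\ (s n).1 <= (s n.+1).1 <= (s n).1 + l * w n / 2,
    (s n).2 <= (s n.+1).2 <= (s n).2 + m * w n / 2 &
    cabs (rect g (s n).1 ((s n).1 + l * w n) (s n).2 ((s n).2 + m * w n)) <=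
    4 * cabs (rect g (s n.+1).1 ((s n.+1).1 + l * w n.+1) (s n.+1).2 ((s n.+1).2 + m * w n.+1))].
  by rewrite wS !mulrA; exact: sP.
have [x0 Hx] : exists x, forall n, (s n).1 <= x <= (s n).1 + l * w n.
  apply: nested_intervals => n; have [/andP[H1 H2] _ _] := s_next n => //.
    rewrite wS; apply: le_trans (_ : _ <= (s n).1 + l * w n / 2 + l * (w n / 2)) _.
      by rewrite lerD2r.
    by rewrite mulrA -addrA -splitr.
  by rewrite lerDl mulr_ge0 // ltW.
have [y0 Hy] : exists x, forall n, (s n).2 <= x <= (s n).2 + m * w n.
  apply: nested_intervals => n; have [_ /andP[H1 H2] _] := s_next n => //.
    rewrite wS; apply: le_trans (_ : _ <= (s n).2 + m * w n / 2 + m * (w n / 2)) _.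
      by rewrite lerD2r.
    by rewrite mulrA -addrA -splitr.
  by rewrite lerDl mulr_ge0 // ltW.
set D := rect g a b c d.
have HD n : cabs D <= 4 ^+ n *
    cabs (rect g (s n).1 ((s n).1 + l * w n) (s n).2 ((s n).2 + m * w n)).
  elim: n => [|n IH]; first by rewrite /w expr0 !mul1r !mulr1 /= /l /m !subrKC.
  have [_ _ H] := s_next n; apply: le_trans IH _.
  by rewrite exprSr -mulrA ler_wpM2l ?exprn_ge0.
pose z0 := Complex x0 y0.
have /dg/differentiable_cabsP[L HL] : S1 < re z0 < S2.
  have := Hx 0%N; rewrite /w expr0 mulr1 /= /l subrKC => /andP[H1 H2].
  by rewrite (lt_le_trans Sa H1) (le_lt_trans H2 bS).
(* After [n] quarterings the perimeter is [2 (l + m) w n] and the integrand, up to an affine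
   function, is at most [e (l + m) w n]; the factor [4 ^ n] is [(w n) ^ - 2]. *)
suff H e : 0 < e -> cabs D <= e * (2 * (l + m) ^+ 2).
  apply/eqP; rewrite -cabs_eq0 eq_le cabs_ge0 andbT.
  have [lm0|lm0] := eqVneq (l + m) 0.
    by have := H 1 ltr01; rewrite lm0 expr0n /= !mulr0.
  apply/ler_addgt0Pr => e e0; rewrite add0r.
  have lm1 : 0 < 2 * (l + m) ^+ 2 by rewrite mulr_gt0 // exprn_even_gt0.
  by have := H _ (divr_gt0 e0 lm1); rewrite divfK // gt_eqF.
move=> e0; have [r r0 Hr] := HL e e0.
have [n Hn] : exists n, (l + m) * w n < r.
  have : (fun n => (l + m) * w n) @ \oo --> (l + m) * 0.
    by apply: cvgM; [exact: cvg_cst|apply: cvg_expr; rewrite ger0_norm ?invr_ge0 // invf_lt1 // ltr1n].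
  rewrite mulr0 => /cvgr_lt/(_ r r0)[n _ /(_ n (leqnn n)) Hn]; by exists n.
apply: le_trans (HD n) _.
set x := (s n).1 in HD *; set y := (s n).2 in HD *.
have lw : 0 <= l * w n by rewrite mulr_ge0 // ltW.
have mw : 0 <= m * w n by rewrite mulr_ge0 // ltW.
(* [E] is [g] minus its first-order Taylor polynomial at [z0], whose contour integral vanishes by
   [rect_affine]. *)
pose E z := g z + ((L * z0 - g z0) + (- L) * z).
have cA (A B : C) : continuous (fun z : C => A + B * z : C).
  apply: ccontinuousD; first exact: ccontinuous_cst.
  apply: ccontinuousM; first exact: ccontinuous_cst.
  by move=> z; exact: cvg_id.
have cE : continuous E := ccontinuousD cg (cA _ _).
have -> : rect g x (x + l * w n) y (y + m * w n) = rect E x (x + l * w n) y (y + m * w n).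
  rewrite (rectD _ _ _ _ cg (cA (L * z0 - g z0) (- L))).
  by rewrite (@rect_affine (L * z0 - g z0) (- L)) ?addr0 // lerDl.
have EM u v : x <= u <= x + l * w n -> y <= v <= y + m * w n ->
    cabs (E (Complex u v)) <= e * ((l + m) * w n).
  move=> ux vy; set z := Complex u v.
  have zz0 : cabs (z - z0) <= (l + m) * w n.
    apply: le_trans (cabs_ReIm _) _; rewrite mulrDl /z /z0 /=; apply: lerD.
      have := Hx n; move: ux; rewrite -/x => /andP[? ?] /andP[? ?].
      by rewrite ler_norml; apply/andP; split; lra.
    have := Hy n; move: vy; rewrite -/y => /andP[? ?] /andP[? ?].
    by rewrite ler_norml; apply/andP; split; lra.
  have [->|zneq] := eqVneq z z0.
    rewrite /E (_ : _ + _ = 0) ?cabs0; last by rewrite mulNr; ring.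
    by rewrite mulr_ge0 ?(ltW e0) // mulrDl addr_ge0.
  have h0 : z - z0 != 0 by rewrite subr_eq0.
  have := Hr (z - z0) h0 (le_lt_trans zz0 Hn); rewrite subrKC.
  have -> : (g z - g z0) / (z - z0) - L = E z / (z - z0).
    by rewrite /E; field.
  rewrite cabsM cabsV ltr_pdivrMr ?cabs_gt0 // => /ltW/le_trans; apply.
  by rewrite ler_wpM2l // ltW.
apply: le_trans (ler_wpM2l _ (cabs_rect_le cE _ _ EM)) _; rewrite ?exprn_ge0 ?lerDl //.
rewrite !(addrC _ (_ * w n)) !addrK -(mulrDl l).
have -> : 4 ^+ n = (w n)^-1 ^+ 2 :> R.
  by rewrite /w -exprVn invrK -exprM mulnC exprM; congr (_ ^+ _); rewrite -natrX.
have wn := w0 n; rewrite le_eqVlt; apply/orP; left; apply/eqP; field; exact: lt0r_neq0.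
Qed.

End Goursat.

(** * Means over circles *)

Section CircleMeans.
Variable R : realType.
Local Notation C := R[i].
Local Notation cabs := (@ComplexField.Normc.normc R).
Local Notation re := (@complex.Re R).
Local Notation im := (@complex.Im R).
Local Notation iu := (Complex 0 1 : C).
Local Notation twopi := (pi *+ 2 : R).
Implicit Types (f g : R -> R) (F G : R -> C).

Lemma twopi_gt0 : 0 < twopi. Proof. by rewrite mulrn_wgt0 // pi_gt0. Qed.

Definition rmean f : R := twopi^-1 * rint 0 twopi f.
Definition cmean F : C := Complex (rmean (re \o F)) (rmean (im \o F)).

Lemma cmeanE F : cmean F = (twopi^-1)%:C%C * cint 0 twopi F.
Proof. by rewrite mulcE !mul0r subr0 addr0. Qed.

Lemma rmeanD f g : continuous f -> continuous g ->
  rmean (fun t => f t + g t) = rmean f + rmean g.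
Proof. by move=> cf cg; rewrite /rmean (rintD _ _ cf cg) mulrDr. Qed.

Lemma rmeanZ k f : continuous f -> rmean (fun t => k * f t) = k * rmean f.
Proof. by move=> cf; rewrite /rmean (rintZ _ _ _ cf) mulrCA. Qed.

Lemma rmean_cst k : rmean (fun=> k) = k.
Proof.
by rewrite /rmean (rint_cst _ (ltW twopi_gt0)) subr0 mulrC mulfK ?gt_eqF ?twopi_gt0.
Qed.

Lemma le_rmean f g : continuous f -> continuous g -> (forall t, f t <= g t) ->
  rmean f <= rmean g.
Proof.
move=> cf cg fg; rewrite /rmean ler_pM2l ?invr_gt0 ?twopi_gt0 //.
by apply: le_rint.
Qed.

Lemma rmean_ge0 f : continuous f -> (forall t, 0 <= f t) -> 0 <= rmean f.
Proof.
move=> cf f0; rewrite -[leLHS](rmean_cst 0); apply: le_rmean => // x; exact: cvg_cst.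
Qed.

Lemma cmeanD F G : continuous F -> continuous G ->
  cmean (fun t => F t + G t) = cmean F + cmean G.
Proof. by move=> cF cG; rewrite !cmeanE (cintD _ _ cF cG) mulrDr. Qed.

Lemma cmeanB F G : continuous F -> continuous G ->
  cmean (fun t => F t - G t) = cmean F - cmean G.
Proof. by move=> cF cG; rewrite !cmeanE (cintB _ _ cF cG) mulrBr. Qed.

Lemma cmeanZ k F : continuous F -> cmean (fun t => k * F t) = k * cmean F.
Proof. by move=> cF; rewrite !cmeanE (cintZ _ _ _ cF) mulrCA. Qed.

Lemma cmean_cst k : cmean (fun=> k) = k.
Proof.
by case: k => x y; rewrite /cmean -[X in Complex (rmean X) _]/(fun=> x)
  -[X in Complex _ (rmean X)]/(fun=> y) !rmean_cst.
Qed.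

Lemma cabs_cmean F g : continuous F -> continuous g ->
  (forall t, cabs (F t) <= g t) -> cabs (cmean F) <= rmean g.
Proof.
move=> cF cg Fg; have p0 := twopi_gt0.
rewrite cmeanE cabsM cabs_real ger0_norm ?invr_ge0 ?(ltW p0) // /rmean.
apply: ler_wpM2l; first by rewrite invr_ge0 ltW.
by apply: cabs_cint => //; exact: ltW.
Qed.

Lemma cabs_cmean_le F M : continuous F -> (forall t, cabs (F t) <= M) ->
  cabs (cmean F) <= M.
Proof.
move=> cF FM; rewrite -(rmean_cst M); apply: cabs_cmean => // x; exact: cvg_cst.
Qed.

Lemma rmean_cvg (T : Type) (FT : set_system T) (FF : Filter FT)
    (G : T -> R -> R) (g : R -> R) :
  (\forall s \near FT, continuous (G s)) -> continuous g ->
  (forall t e : R, 0 < e -> \forall t' \near t & s \near FT, `|G s t' - g t'| < e) ->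
  (fun s => rmean (G s)) @ FT --> rmean g.
Proof.
move=> cG cg H; apply: cvgM; first exact: cvg_cst.
apply: rint_cvg => //; first by exact: ltW twopi_gt0.
by move=> t e _; exact: H.
Qed.

Lemma cmean_cvg (T : Type) (FT : set_system T) (FF : Filter FT)
    (G : T -> R -> C) (g : R -> C) :
  (\forall s \near FT, continuous (G s)) -> continuous g ->
  (forall t e : R, 0 < e -> \forall t' \near t & s \near FT, cabs (G s t' - g t') < e) ->
  (fun s => cmean (G s)) @ FT --> cmean g.
Proof.
move=> cG cg H; rewrite cmeanE.
have -> : (fun s => cmean (G s)) = (fun s => (twopi^-1)%:C%C * cint 0 twopi (G s)).
  by apply/funext => s; rewrite cmeanE.
apply: cvgM; first exact: cvg_cst.
apply: cint_cvg => //; first by exact: ltW twopi_gt0.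
by move=> t e _; exact: H.
Qed.

Lemma polar0 t : polar 0 t = 0 :> C.
Proof. by rewrite /polar !mul0r. Qed.

Lemma continuous_circle (F : C -> C) (r : R) :
  (forall w, cabs w = `|r| -> {for w, continuous F}) ->
  continuous (fun t => F (polar r t)).
Proof.
move=> cF t; apply: (@continuous_comp _ _ _ (fun t => polar r t) F).
  apply: continuous_Complex; apply: cvgM; try exact: cvg_cst.
    exact: continuous_cos.
  exact: continuous_sin.
by apply: cF; rewrite cabs_polar.
Qed.

Lemma cmean_circle_continuous (F : C -> C) (T r : R) :
  (forall w, cabs w < T -> {for w, continuous F}) -> `|r| < T ->
  {for r, continuous (fun r => cmean (fun t => F (polar r t)))}.
Proof.
move=> cF rT; apply: cmean_cvg.
- have : \forall s \near r, `|s| < T.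
    by have := @norm_continuous R R r; move/cvgr_lt; exact.
  apply: filterS => s sT; apply: continuous_circle => w ws; apply: cF.
  by rewrite ws.
- by apply: continuous_circle => w ws; apply: cF; rewrite ws.
move=> t e e0; have e2 : 0 < e / 2 by rewrite divr_gt0.
have cP : {for (r, t), continuous (fun a : R * R => F (polar a.1 a.2))}.
  apply: (@continuous_comp _ _ _ (fun a : R * R => polar a.1 a.2 : C) F).
    exact: continuous_polar.
  by apply: cF; rewrite cabs_polar.
move/cvg_cabsP: (cP) => /(_ _ e2) [[A B] /= [Ar Bt] AB].
exists (B, A) => // -[t' s] /= [Bt' As].
have /= H1 := AB (s, t') (conj As Bt').
have /= H2 := AB (r, t') (conj (nbhs_singleton Ar) Bt').
set u := F (polar s t') in H1 *; set v := F (polar r t') in H2 *.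
set w := F _ in H1 H2; rewrite -(subrKA w) [e]splitr.
by apply: le_lt_trans (cabsD _ _) _; rewrite ltrD // cabsBC.
Qed.

Lemma near_eq_differentiable (f g : C -> C) z :
  (\forall w \near z, f w = g w) -> differentiable f z -> differentiable g z.
Proof.
move=> /nbhs_cabsP[d d0 fg] /differentiable_cabsP[L HL].
apply/differentiable_cabsP; exists L => e e0; have [d' d'0 Hd'] := HL e e0.
exists (Num.min d d'); first by rewrite lt_min d0.
move=> h h0; rewrite lt_min => /andP[hd hd'].
rewrite -!fg; [exact: Hd'|by rewrite subrr cabs0|by rewrite addrAC subrr add0r].
Qed.

Lemma cmean_annulus (F : C -> C) (r1 r2 a b : R) :
  (forall w, r1 < cabs w < r2 -> differentiable F w) ->
  0 <= r1 -> r1 < a -> a <= b -> b < r2 ->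
  cmean (fun t => F (polar a t)) = cmean (fun t => F (polar b t)).
Proof.
move=> dF r10 r1a ab br2.
pose a' := (r1 + a) / 2; pose b' := (b + r2) / 2.
have [r1a' a'a] : r1 < a' /\ a' < a by rewrite /a'; split; lra.
have [bb' b'r2] : b < b' /\ b' < r2 by rewrite /b'; split; lra.
have a'0 : 0 < a' by exact: le_lt_trans r1a'.
have b'0 : 0 < b' by rewrite (lt_trans a'0) // (lt_trans a'a) // (le_lt_trans ab).
pose S1 := ln a'; pose S2 := ln b'.
(* Clamping the real part extends [F (exp z)] continuously to the whole plane, as [goursat]
   requires, and changes nothing on a strip around the rectangle. *)
pose clamp (x : R) : R := Num.max S1 (Num.min S2 x).
have S12 : S1 <= S2 by rewrite ler_ln ?posrE // ltW // (lt_trans a'a) // (le_lt_trans ab).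
have clampP x : S1 <= clamp x <= S2.
  by rewrite /clamp le_max lexx /= ge_max S12 ge_min lexx.
have clamp_id x : S1 <= x <= S2 -> clamp x = x.
  by move=> /andP[H1 H2]; rewrite /clamp (min_idPr H2) (max_idPr H1).
have cclamp : continuous clamp.
  move=> x; apply: (@continuous_max _ _ (fun=> S1) (fun x => Num.min S2 x)); first exact: cvg_cst.
  by apply: (@continuous_min _ _ (fun=> S2) id); [exact: cvg_cst|exact: cvg_id].
pose g z := F (polar (expR (clamp (re z))) (im z)).
have inA x t : r1 < cabs (polar (expR (clamp x)) t) < r2.
  have /andP[H1 H2] := clampP x; rewrite cabs_polar ger0_norm ?expR_ge0 //.
  rewrite (lt_le_trans r1a') /=; last by rewrite -[a'](@lnK R) ?posrE // ler_expR.
  by rewrite (le_lt_trans _ b'r2) // -[b'](@lnK R) ?posrE // ler_expR.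
have cg : continuous g.
  move=> z; apply: (@continuous_comp _ _ _
      (fun z => polar (expR (clamp (re z))) (im z) : C) F); last first.
    by apply: differentiable_continuous; exact: dF.
  have ce : continuous (fun z => expR (clamp (re z))).
    move=> w; apply: (@continuous_comp _ _ _ (fun z => clamp (re z)) (@expR R)); last exact: continuous_expR.
    by apply: (@continuous_comp _ _ _ re clamp); [exact: continuous_Re|exact: cclamp].
  apply: continuous_Complex; (apply: continuousM; first exact: ce).
    by apply: (@continuous_comp _ _ _ im cos); [exact: continuous_Im|exact: continuous_cos].
  by apply: (@continuous_comp _ _ _ im sin); [exact: continuous_Im|exact: continuous_sin].
have dg z : S1 < re z < S2 -> differentiable g z.
  move=> /andP[S1z zS2]; apply: (@near_eq_differentiable (F \o @cexp R)).
    have H1 : \forall w \near z, S1 < re w by have := @continuous_Re R z; move/cvgr_gt; exact.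
    have H2 : \forall w \near z, re w < S2 by have := @continuous_Re R z; move/cvgr_lt; exact.
    apply: filterS2 H1 H2 => w H1 H2.
    by rewrite /g clamp_id ?(ltW H1) ?(ltW H2).
  apply: differentiable_comp; first exact: differentiable_cexp.
  apply: dF; have := inA (re z) (im z).
  by rewrite clamp_id // !ltW.
have a0 : 0 < a by exact: lt_trans a'a.
have b0 : 0 < b by exact: lt_le_trans ab.
have H1 : S1 < ln a by rewrite ltr_ln ?posrE.
have H2 : ln a <= ln b by rewrite ler_ln ?posrE.
have H3 : ln b < S2 by rewrite ltr_ln ?posrE.
have := goursat cg dg H1 H2 H3 (ltW twopi_gt0); rewrite /rect.
(* Periodicity cancels the horizontal edges; the vertical ones are the two circle integrals. *)
have -> : (fun s => g (Complex s 0)) = (fun s => g (Complex s twopi)).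
  by apply/funext => s; rewrite /g /polar /= cos2pi sin2pi cos0 sin0.
rewrite subrr add0r => /eqP; rewrite mulf_eq0.
have -> : (iu == 0) = false by rewrite eq_complex /= oner_eq0 andbF.
rewrite subr_eq0 /= => /eqP; rewrite !cmeanE.
have E x : 0 < x -> S1 <= ln x <= S2 -> (fun t => g (Complex (ln x) t)) = (fun t => F (polar x t)).
  by move=> x0 Sx; apply/funext => t; rewrite /g /= clamp_id // lnK.
rewrite (E b b0) ?(E a a0) => [->//||]; apply/andP; split; try exact: ltW.
  exact: le_trans H2 (ltW H3).
exact: le_trans (ltW H1) H2.
Qed.

End CircleMeans.

(** * Cauchy's formula and Taylor expansion *)

Section Cauchy.
Variable R : realType.
Local Notation C := R[i].
Local Notation cabs := (@ComplexField.Normc.normc R).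

Lemma ccontinuousX (T : topologicalType) (F : T -> C) k :
  continuous F -> continuous (fun t => F t ^+ k).
Proof.
move=> cF; elim: k => [|k IH]; first exact: ccontinuous_cst.
have -> : (fun t => F t ^+ k.+1) = (fun t => F t * F t ^+ k).
  by apply/funext => t; rewrite exprS.
exact: ccontinuousM.
Qed.

Lemma cdiff_cst (k : C) z : differentiable (fun _ : C => k) z.
Proof. exact: differentiable_cst. Qed.

Lemma cdiff_id z : differentiable (fun w : C => w) z.
Proof. by apply/derivable1_diffP; exact: derivable_id. Qed.

Lemma cdiffD (f g : C -> C) z : differentiable f z -> differentiable g z ->
  differentiable (fun w => f w + g w) z.
Proof. exact: differentiableD. Qed.

Lemma cdiffB (f g : C -> C) z : differentiable f z -> differentiable g z ->
  differentiable (fun w => f w - g w) z.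
Proof. exact: differentiableB. Qed.

Lemma cdiffM (f g : C -> C) z : differentiable f z -> differentiable g z ->
  differentiable (fun w => f w * g w) z.
Proof. exact: differentiableM. Qed.

Lemma cdiffV (f : C -> C) z : differentiable f z -> f z != 0 ->
  differentiable (fun w => (f w)^-1) z.
Proof. exact: differentiableV. Qed.

Lemma cdiff_comp (f g : C -> C) z : differentiable f z -> differentiable g (f z) ->
  differentiable (fun w => g (f w)) z.
Proof. exact: differentiable_comp. Qed.

Lemma cdiff_cont (f : C -> C) z : differentiable f z -> {for z, continuous f}.
Proof. exact: differentiable_continuous. Qed.

Lemma eq_from_right (phi : R -> C) a b c : a < b -> {for a, continuous phi} ->
  (forall x, a < x < b -> phi x = c) -> phi a = c.
Proof.
move=> ab /cvg_cabsP cphi H; apply/eqP; rewrite -subr_eq0 -cabs_eq0 eq_le cabs_ge0 andbT.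
apply/ler_addgt0Pr => e e0; rewrite add0r.
have [r /= r0 Hr] := cphi e e0.
pose x := a + Num.min (r / 2) ((b - a) / 2).
have m0 : 0 < Num.min (r / 2) ((b - a) / 2) by rewrite lt_min !divr_gt0 ?subr_gt0.
have xab : a < x < b.
  rewrite /x ltrDl m0 -ltrBrDl gt_min; apply/orP; right; lra.
have /= := Hr x; rewrite H // cabsBC => /(_ _)/ltW; apply.
rewrite /x opprD addNKr normrN gtr0_norm // gt_min; apply/orP; left; lra.
Qed.

Lemma eq_from_left (phi : R -> C) a b c : a < b -> {for b, continuous phi} ->
  (forall x, a < x < b -> phi x = c) -> phi b = c.
Proof.
move=> ab /cvg_cabsP cphi H; apply/eqP; rewrite -subr_eq0 -cabs_eq0 eq_le cabs_ge0 andbT.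
apply/ler_addgt0Pr => e e0; rewrite add0r.
have [r /= r0 Hr] := cphi e e0.
pose x := b - Num.min (r / 2) ((b - a) / 2).
have m0 : 0 < Num.min (r / 2) ((b - a) / 2) by rewrite lt_min !divr_gt0 ?subr_gt0.
have xab : a < x < b.
  rewrite /x ltrBlDr ltrDl m0 andbT ltrBrDr -ltrBrDl gt_min.
  by apply/orP; right; lra.
have /= := Hr x; rewrite H // cabsBC => /(_ _)/ltW; apply.
rewrite /x subKr gtr0_norm // gt_min; apply/orP; left; lra.
Qed.

(** By [cmean_annulus] the mean is constant for radii on either side of [cabs z]; its continuity in
    the radius joins the two ranges and reaches the radius [0]. Allowing one point of mere
    continuity makes the difference quotient of [cauchy_circle] admissible. *)
Lemma cmean_circle_punctured (F : C -> C) T z r :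
  (forall w, cabs w < T -> {for w, continuous F}) ->
  (forall w, cabs w < T -> w != z -> differentiable F w) ->
  0 <= r < T -> cmean (fun t => F (polar r t)) = F 0.
Proof.
move=> cF dF /andP[r0 rT].
pose phi x := cmean (fun t => F (polar x t)).
have phi0 : phi 0 = F 0.
  rewrite /phi -[RHS]cmean_cst; congr cmean; apply/funext => t; by rewrite polar0.
have cphi x : 0 <= x -> x < T -> {for x, continuous phi}.
  by move=> x0 xT; apply: (cmean_circle_continuous cF); rewrite ger0_norm.
have cst a b : 0 < a -> a <= b -> b < T -> (b < cabs z) \/ (cabs z < a) -> phi a = phi b.
  move=> a0 ab bT [bz|za].
    apply: (@cmean_annulus R F 0 (Num.min (cabs z) T)) => //; last by rewrite lt_min bz.
    move=> w /andP[_]; rewrite lt_min => /andP[wz wT]; apply: dF => //.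
    by apply: contraTneq wz => ->; rewrite ltxx.
  apply: (@cmean_annulus R F (cabs z) T) => //; last exact: cabs_ge0.
  move=> w /andP[zw wT]; apply: dF => //.
  by apply: contraTneq zw => ->; rewrite ltxx.
rewrite -/(phi r) -phi0.
have T0 : 0 < T by exact: le_lt_trans rT.
have cst0 a b : 0 < a -> 0 < b -> a < T -> b < T ->
    (a < cabs z /\ b < cabs z) \/ (cabs z < a /\ cabs z < b) -> phi a = phi b.
  move=> a0 b0 aT bT H; have [ab|ba] := leP a b.
    by apply: cst => //; case: H => -[? ?]; [left|right].
  by symmetry; apply: cst => //; [exact: ltW|case: H => -[? ?]; [left|right]].
have small x : 0 <= x -> x < T -> x < cabs z -> phi x = phi 0.
  rewrite le_eqVlt => /predU1P[<-//|x0] xT xz; symmetry.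
  apply: (@eq_from_right _ 0 x) => //; first exact: cphi.
  move=> y /andP[y0 yx]; apply: cst0 => //; first exact: lt_trans xT.
  by left; split => //; exact: lt_trans xz.
have atz : cabs z < T -> phi (cabs z) = phi 0.
  have := cabs_ge0 z; rewrite le_eqVlt => /predU1P[<-//|z0] zT.
  apply: (@eq_from_left _ 0 (cabs z)) => //; first by apply: cphi => //; exact: ltW.
  by move=> y /andP[y0 yz]; apply: small => //; [exact: ltW|exact: lt_trans zT].
have [rz|zr|rz] := ltrgtP r (cabs z); first exact: small.
  have zT := lt_trans zr rT; rewrite -(atz zT); symmetry.
  apply: (@eq_from_right _ _ r) => //; first by apply: cphi => //; exact: cabs_ge0.
  move=> y /andP[zy yr]; have z0 := cabs_ge0 z; apply: cst0.
  - exact: le_lt_trans zy.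
  - exact: le_lt_trans zr.
  - exact: lt_trans rT.
  - by [].
  - by right.
by rewrite rz; apply: atz; rewrite -rz.
Qed.

Lemma mean_value (F : C -> C) T r : (forall w, cabs w < T -> differentiable F w) ->
  0 <= r < T -> cmean (fun t => F (polar r t)) = F 0.
Proof.
move=> dF; apply: (@cmean_circle_punctured F T 0) => w wT; last by move=> _; exact: dF.
by apply: cdiff_cont; exact: dF.
Qed.

Lemma polar_neq (r t : R) z : cabs z < r -> (polar r t - z == 0 :> C) = false.
Proof.
move=> zr; apply/negP => /eqP/subr0_eq H; move: zr; rewrite -H cabs_polar.
by rewrite ltNge ler_norm.
Qed.

Lemma polar_neq0 (r t : R) : 0 < r -> (polar r t : C) != 0.
Proof. by move=> r0; rewrite -cabs_eq0 cabs_polar gtr0_norm ?gt_eqF. Qed.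

Lemma cabs_polarB (r t : R) z : cabs z < r -> r - cabs z <= cabs (polar r t - z).
Proof.
move=> zr; have r0 : 0 <= r by rewrite (le_trans (cabs_ge0 z)) // ltW.
by rewrite -[leLHS](_ : cabs (polar r t) - cabs z = _) ?cabs_lbB // cabs_polar ger0_norm.
Qed.

Lemma continuous_on_circle (F : C -> C) T r :
  (forall w, cabs w < T -> differentiable F w) -> 0 <= r < T ->
  continuous (fun t => F (polar r t)).
Proof.
move=> dF /andP[r0 rT]; apply: continuous_circle => w wr; apply: cdiff_cont; apply: dF.
by rewrite wr ger0_norm.
Qed.

Lemma continuous_kernel (G : C -> C) z r : cabs z < r ->
  (forall w, w != z -> differentiable G w) -> continuous (fun t => G (polar r t)).
Proof.
move=> zr dG; apply: continuous_circle => w wr; apply: cdiff_cont; apply: dG.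
apply: contraTneq zr => <-; rewrite -leNgt wr; exact: ler_norm.
Qed.

(** The kernel is [1 + z / (w - z)]. The mean of the second term does not depend on the radius, and
    it tends to [0] as the radius grows. *)
Lemma cmean_kernel z r : cabs z < r ->
  cmean (fun t => polar r t / (polar r t - z)) = 1 :> C.
Proof.
move=> zr; pose W (w : C) := z / (w - z).
have dW w : w != z -> differentiable W w.
  move=> wz; apply: cdiffM; first exact: cdiff_cst.
  by apply: cdiffV; [apply: cdiffB; [exact: cdiff_id|exact: cdiff_cst]|rewrite subr_eq0].
have cW x : cabs z < x -> continuous (fun t => W (polar x t)).
  by move=> zx; exact: (continuous_kernel zx dW).
have W0 : cmean (fun t => W (polar r t)) = 0.
  have Wb x : r <= x -> cabs (cmean (fun t => W (polar r t))) <= cabs z / (x - cabs z).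
    move=> rx; have zx := lt_le_trans zr rx.
    have dWx w : cabs z < cabs w < x + 1 -> differentiable W w.
      by move=> /andP[zw _]; apply: dW; apply: contraTneq zw => ->; rewrite ltxx.
    have xx : x < x + 1 by rewrite ltrDl.
    rewrite (cmean_annulus dWx (cabs_ge0 z) zr rx xx).
    apply: (cabs_cmean_le (cW x zx)).
    move=> t; rewrite cabsM cabsV ler_wpM2l ?cabs_ge0 // lef_pV2 ?posrE ?subr_gt0 //.
      exact: cabs_polarB.
    by rewrite (lt_le_trans _ (cabs_polarB t zx)) // subr_gt0.
  apply/eqP; rewrite -cabs_eq0 eq_le cabs_ge0 andbT.
  apply/ler_addgt0Pr => e e0; rewrite add0r.
  apply: le_trans (Wb (r + cabs z / e) _) _; first by rewrite lerDl divr_ge0 ?cabs_ge0 // ltW.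
  rewrite ler_pdivrMr; last by rewrite subr_gt0 ltr_wpDr // divr_ge0 ?cabs_ge0 // ltW.
  rewrite mulrBr mulrDr mulrCA divff ?gt_eqF // mulr1.
  rewrite addrAC lerDr subr_ge0 ler_pM2l //; exact: ltW.
have -> : (fun t => polar r t / (polar r t - z)) = (fun t => 1 + W (polar r t)).
  apply/funext => t; rewrite /W; field; by rewrite polar_neq.
rewrite (cmeanD _ (cW r zr)) ?cmean_cst ?W0 ?addr0 //; exact: ccontinuous_cst.
Qed.

(** With [q] the difference quotient of [f] at [z], the function [w * q w] vanishes at [0], so its
    circle mean is [0]; adding [f z] times [cmean_kernel] gives the formula. *)
Lemma cauchy_circle (f : C -> C) T r z :
  (forall w, cabs w < T -> differentiable f w) -> cabs z < r -> r < T ->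
  cmean (fun t => f (polar r t) * (polar r t / (polar r t - z))) = f z.
Proof.
move=> df zr rT; have zT := lt_trans zr rT.
have r0 : 0 <= r by rewrite (le_trans (cabs_ge0 z)) // ltW.
have /differentiable_cabsP[L HL] := df z zT.
pose q w := if w == z then L else (f w - f z) / (w - z).
pose K w := w * q w.
have dq w : cabs w < T -> w != z -> differentiable q w.
  move=> wT wz; apply: (@near_eq_differentiable _ (fun w => (f w - f z) / (w - z))).
    have w0 : 0 < cabs (w - z) by rewrite cabs_gt0 subr_eq0.
    apply/nbhs_cabsP; exists (cabs (w - z)) => // w'; rewrite /q.
    by case: eqP => // -> ; rewrite cabsBC ltxx.
  apply: cdiffM; first by apply: cdiffB; [exact: df|exact: cdiff_cst].
  by apply: cdiffV; [apply: cdiffB; [exact: cdiff_id|exact: cdiff_cst]|rewrite subr_eq0].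
have cq w : cabs w < T -> {for w, continuous q}.
  move=> wT; have [->|wz] := eqVneq w z; last by apply: cdiff_cont; exact: dq.
  apply/(@cvg_cabsP _ _ (nbhs z) (nbhs_filter z)) => e e0; have [d d0 Hd] := HL e e0.
  apply/nbhs_cabsP; exists d => // v vz; rewrite /q eqxx.
  case: eqP => [_|/eqP vneq]; first by rewrite subrr cabs0.
  by have := Hd (v - z); rewrite subr_eq0 subrKC; apply.
have cK w : cabs w < T -> {for w, continuous K}.
  by move=> wT; apply: continuousM; [exact: cvg_id|exact: cq].
have dK w : cabs w < T -> w != z -> differentiable K w.
  by move=> wT wz; apply: cdiffM; [exact: cdiff_id|exact: dq].
have rr : 0 <= r < T by rewrite r0.
have K0 := cmean_circle_punctured cK dK rr; rewrite {2}/K mul0r in K0.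
have cKr : continuous (fun t => K (polar r t)).
  by apply: continuous_circle => w wr; apply: cK; rewrite wr ger0_norm.
pose W (w : C) := w / (w - z).
have dW w : w != z -> differentiable W w.
  move=> wz; apply: cdiffM; first exact: cdiff_id.
  by apply: cdiffV; [apply: cdiffB; [exact: cdiff_id|exact: cdiff_cst]|rewrite subr_eq0].
have cW : continuous (fun t => W (polar r t)) := continuous_kernel zr dW.
have cfW : continuous (fun t => f z * W (polar r t)).
  by apply: ccontinuousM; [exact: ccontinuous_cst|exact: cW].
have -> : (fun t => f (polar r t) * (polar r t / (polar r t - z))) =
    (fun t => K (polar r t) + f z * W (polar r t)).
  apply/funext => t; rewrite /K /q /W -subr_eq0 polar_neq //; field; by rewrite polar_neq.
by rewrite (cmeanD cKr cfW) K0 add0r (cmeanZ _ cW) cmean_kernel ?mulr1.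
Qed.

(** Expanding the Cauchy kernel geometrically leaves an exact remainder, [z ^ n] times a circle
    mean. The coefficients and [M] are fixed before [n] and [z], so the same bound serves to extract
    coefficients at small [z] and to approximate uniformly by polynomials. *)
Lemma taylor_disc (f : C -> C) T r : (forall w, cabs w < T -> differentiable f w) ->
  0 < r < T -> exists (a : nat -> C) (M : R), 0 <= M /\
  forall n z, cabs z < r ->
    cabs (f z - \sum_(k < n) a k * z ^+ k) <= M * (cabs z / r) ^+ n * (r / (r - cabs z)).
Proof.
move=> df /andP[r0 rT]; have rr : 0 <= r < T by rewrite ltW.
have cf := continuous_on_circle df rr.
exists (fun k => cmean (fun t => f (polar r t) * (polar r t)^-1 ^+ k)).
exists (rmean (fun t => cabs (f (polar r t)))).
have caf : continuous (fun t => cabs (f (polar r t))) by exact: continuousCabs cf.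
split; first by apply: rmean_ge0 => // t; exact: cabs_ge0.
move=> n z zr.
have cV : continuous (fun t => (polar r t)^-1 : C).
  apply: ccontinuousV; last by move=> t; exact: polar_neq0.
  by apply: (@continuous_circle R id) => w _; exact: cvg_id.
have cX k : continuous (fun t => (polar r t)^-1 ^+ k : C) := ccontinuousX (k := k) cV.
have dW w : w != z -> differentiable (fun w : C => w / (w - z)) w.
  move=> wz; apply: cdiffM; first exact: cdiff_id.
  by apply: cdiffV; [apply: cdiffB; [exact: cdiff_id|exact: cdiff_cst]|rewrite subr_eq0].
have cW : continuous (fun t => polar r t / (polar r t - z) : C) := continuous_kernel zr dW.
pose F k t := f (polar r t) * ((polar r t)^-1 ^+ k * (polar r t / (polar r t - z))).
have cF k : continuous (F k) := ccontinuousM cf (ccontinuousM (cX k) cW).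
have -> : f z - \sum_(k < n) cmean (fun t => f (polar r t) * (polar r t)^-1 ^+ k) * z ^+ k =
    z ^+ n * cmean (F n).
  elim: n => [|n IH].
    rewrite big_ord0 subr0 expr0 mul1r -(cauchy_circle df zr rT); congr cmean.
    by apply/funext => t; rewrite /F expr0 mul1r.
  rewrite big_ord_recr /= opprD addrA {}IH exprSr -mulrA -(cmeanZ z (cF n.+1)).
  rewrite mulrC -mulrBl mulrC; congr (_ * _).
  rewrite -(cmeanB (cF n) (ccontinuousM cf (cX n))).
  congr cmean; apply/funext => t; rewrite /F exprS; field.
  by rewrite polar_neq0 //= polar_neq.
set k := r^-1 ^+ n * (r / (r - cabs z)).
have H t : cabs (F n t) <= k * cabs (f (polar r t)).
  rewrite /F !cabsM cabsX !cabsV cabs_polar gtr0_norm // mulrC.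
  rewrite ler_wpM2r ?cabs_ge0 // ler_wpM2l ?exprn_ge0 ?invr_ge0 ?(ltW r0) //.
  rewrite ler_pM2l // lef_pV2 ?posrE ?subr_gt0 //; first exact: cabs_polarB.
  by rewrite (lt_le_trans _ (cabs_polarB t zr)) // subr_gt0.
have := cabs_cmean (cF n) (continuousMl (k := k) caf) H; rewrite (rmeanZ k caf) => Hm.
rewrite cabsM cabsX; apply: le_trans (ler_wpM2l _ Hm) _; first by rewrite exprn_ge0 ?cabs_ge0.
by rewrite /k exprMn le_eqVlt; apply/orP; left; apply/eqP; ring.
Qed.

End Cauchy.

(** * Identity theorem and Poisson formula *)

Section Harmonic.
Variable R : realType.
Local Notation C := R[i].
Local Notation cabs := (@ComplexField.Normc.normc R).
Local Notation re := (@complex.Re R).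

(** Once the coefficients below [k] vanish, the Taylor bound at a small real [x], where [f] is zero,
    reads [cabs (a k) * x ^ k <= K * x ^ k.+1]. Hence all coefficients vanish, and the remainder
    alone then forces [f z = 0]. *)
Lemma identity_disc (f : C -> C) T d : (forall w, cabs w < T -> differentiable f w) ->
  0 < d -> (forall w, cabs w < d -> f w = 0) -> forall w, cabs w < T -> f w = 0.
Proof.
move=> df d0 fd z zT.
pose r := (cabs z + T) / 2.
have [zr rT] : cabs z < r /\ r < T by rewrite /r; split; lra.
have r0 : 0 < r by exact: le_lt_trans (cabs_ge0 z) zr.
have [a [M [M0 HM]]] := taylor_disc df (introT andP (conj r0 rT)).
have az k : a k = 0.
  elim/ltn_ind: k => k IH.
  pose K := M * r^-1 ^+ k.+1 * 2.
  have K0 : 0 <= K by rewrite !mulr_ge0 // exprn_ge0 // invr_ge0 ltW.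
  have ak x : 0 < x -> x < d -> x < r / 2 -> cabs (a k) <= K * x.
    move=> x0 xd xr; have cx : cabs (x%:C)%C = x by rewrite cabs_real gtr0_norm.
    have xr' : x < r by apply: lt_trans xr _; lra.
    have := HM k.+1 (x%:C)%C; rewrite cx => /(_ xr').
    rewrite fd ?cx // big_ord_recr /= big1 ?add0r => [|i _]; last by rewrite IH // mul0r.
    rewrite cabsN cabsM cabsX cx => H.
    have xk : 0 < x ^+ k by rewrite exprn_gt0.
    rewrite -(ler_pM2r xk); apply: le_trans H _.
    have -> : K * x * x ^+ k = M * (x / r) ^+ k.+1 * 2.
      by rewrite /K exprMn [x ^+ k.+1]exprS; ring.
    apply: ler_wpM2l; first by rewrite mulr_ge0 // exprn_ge0 // divr_ge0 // ltW.
    rewrite ler_pdivrMr ?subr_gt0 //; lra.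
  apply/eqP; rewrite -cabs_eq0 eq_le cabs_ge0 andbT.
  apply/ler_addgt0Pr => e e0; rewrite add0r.
  pose x := Num.min (d / 2) (Num.min (r / 4) (e / (K + 1))).
  have K1 : 0 < K + 1 by rewrite ltr_wpDl.
  have x0 : 0 < x by rewrite !lt_min (divr_gt0 d0) ?(divr_gt0 r0) ?(divr_gt0 e0 K1).
  have xd : x < d by rewrite /x gt_min; apply/orP; left; lra.
  have xr : x < r / 2 by rewrite /x !gt_min; apply/orP; right; apply/orP; left; lra.
  have xe : x * (K + 1) <= e by rewrite -ler_pdivlMr // /x !ge_min lexx !orbT.
  by apply: le_trans (ak x x0 xd xr) _; nra.
apply/eqP; rewrite -cabs_eq0 eq_le cabs_ge0 andbT.
set B := M * (r / (r - cabs z)).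
have HB n : cabs (f z) <= B * (cabs z / r) ^+ n.
  have := HM n z zr; rewrite big1 => [|i _]; last by rewrite az mul0r.
  by rewrite subr0 /B mulrAC.
have cv : (fun n => B * (cabs z / r) ^+ n) @ \oo --> B * 0.
  apply: cvgM; first exact: cvg_cst.
  have zr0 : 0 <= cabs z / r by rewrite divr_ge0 ?cabs_ge0 ?(ltW r0).
  by apply: cvg_expr; rewrite (ger0_norm zr0) ltr_pdivrMr // mul1r.
rewrite mulr0 in cv; by apply: (cvgr_to_ge cv); exists 0%N => // n _ /=; exact: HB.
Qed.

Lemma identity_halfplane (h : C -> C) s l0 d l1 :
  (forall w, s < re w -> differentiable h w) -> s < re l0 -> 0 < d ->
  (forall w, cabs (w - l0) < d -> h w = 0) -> s < re l1 -> h l1 = 0.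
Proof.
move=> dh sl0 d0 hd sl1.
have reD (z w : C) : re (z + w) = re z + re w by case: z; case: w.
have reM (x : R) (w : C) : re ((x%:C)%C * w) = x * re w by case: w => ? ? /=; rewrite mul0r subr0.
(* Discs of radius [D] centred on the segment from [l0] to [l1] stay in the half-plane; vanishing is
   carried along a chain of points [mu j] less than [D] apart. *)
pose D := Num.min (re l0) (re l1) - s.
have D0 : 0 < D by rewrite subr_gt0 lt_min sl0.
have spread m : Num.min (re l0) (re l1) <= re m -> (exists2 e, 0 < e & forall w, cabs (w - m) < e -> h w = 0) ->
    forall w, cabs (w - m) < D -> h w = 0.
  move=> ml [e e0 He] w wm.
  have := @identity_disc (fun v => h (m + v)) D e _ e0 _ (w - m) wm; rewrite subrKC; apply.
    move=> v vD; apply: (@cdiff_comp _ (fun v => m + v) h).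
      by apply: cdiffD; [exact: cdiff_cst|exact: cdiff_id].
    apply: dh; rewrite reD; have := normRe_cabs v; rewrite ler_norml => /andP[H _].
    have : - D < re v by rewrite (lt_le_trans _ H) // ltrN2.
    rewrite /D; lra.
  by move=> v ve; apply: He; rewrite addrAC subrr add0r.
have [N HN] : exists N : nat, cabs (l1 - l0) / D < N.+1%:R.
  by exists (Num.truncn (cabs (l1 - l0) / D)); exact: truncnS_gt.
have N0 : 0 < N.+1%:R :> R by rewrite ltr0n.
pose mu (j : nat) := l0 + ((j%:R / N.+1%:R)%:C)%C * (l1 - l0).
have mu_in j : (j <= N.+1)%N -> Num.min (re l0) (re l1) <= re (mu j).
  move=> jN; rewrite /mu reD reM reD.
  have -> : re (- l0) = - re l0 by case: (l0).
  set x := _ / _; have x0 : 0 <= x by rewrite divr_ge0.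
  have x1 : x <= 1 by rewrite ler_pdivrMr // mul1r ler_nat.
  rewrite ge_min; have [ll|ll] := leP (re l0) (re l1); apply/orP; [left|right]; nra.
have mu_step j : cabs (mu j.+1 - mu j) < D.
  have -> : mu j.+1 - mu j = ((N.+1%:R^-1)%:C)%C * (l1 - l0).
    rewrite /mu opprD addrACA subrr add0r -mulrBl -rmorphB /= -mulrBl.
    by rewrite -[j.+1]addn1 natrD addrAC subrr add0r mul1r.
  rewrite cabsM cabs_real ger0_norm ?invr_ge0 // mulrC ltr_pdivrMr // mulrC.
  by rewrite -ltr_pdivrMr.
have H j : (j <= N.+1)%N -> exists2 e, 0 < e & forall w, cabs (w - mu j) < e -> h w = 0.
  elim: j => [_|j IH jN].
    by exists d => // w; rewrite /mu mul0r mul0r addr0; exact: hd.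
  have Hs := spread _ (mu_in j (ltnW jN)) (IH (ltnW jN)).
  exists (D - cabs (mu j.+1 - mu j)); first by rewrite subr_gt0.
  move=> w wm; apply: Hs; rewrite -(subrKA (mu j.+1)).
  by apply: le_lt_trans (cabsD _ _) _; rewrite -ltrBrDr.
have [e e0 He] := H N.+1 (leqnn _); apply: He.
by rewrite /mu divff ?gt_eqF // mul1r subrKC subrr cabs0.
Qed.

(** The Poisson kernel [(|w| ^ 2 - |z| ^ 2) / |w - z| ^ 2], written as the real part of a function
    holomorphic in [z]. *)
Definition pker (w z : C) : R := re ((w + z) / (w - z)).

Lemma pker_ge0 z r t : cabs z < r -> 0 <= pker (polar r t) z.
Proof.
move=> zr; set w := polar r t; have r0 : 0 <= r by rewrite (le_trans (cabs_ge0 z)) // ltW.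
have wz : w - z != 0 by rewrite /w polar_neq.
rewrite /pker; have -> : (w + z) / (w - z) = ((cabs (w - z) ^- 2)%:C)%C * ((w + z) * conjc (w - z)).
  have -> : ((cabs (w - z) ^- 2)%:C)%C = ((w - z) * conjc (w - z))^-1.
    by rewrite mulc_conj -fmorphV.
  have cwz : conjc (w - z) != 0 by rewrite conjc_eq0.
  by move: (conjc (w - z)) cwz => y y0; field; rewrite wz y0.
have -> : re (((cabs (w - z) ^- 2)%:C)%C * ((w + z) * conjc (w - z))) =
    cabs (w - z) ^- 2 * (cabs w ^+ 2 - cabs z ^+ 2).
  rewrite !cabs_sqr; case: (w) (z) => a b [c d] /=; ring.
rewrite mulr_ge0 ?invr_ge0 ?sqr_ge0 // subr_ge0 ler_sqr ?nnegrE ?cabs_ge0 //.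
by rewrite cabs_polar ger0_norm // ltW.
Qed.

Lemma pker_le z r t : cabs z < r -> pker (polar r t) z <= (r + cabs z) / (r - cabs z).
Proof.
move=> zr; have r0 : 0 <= r by rewrite (le_trans (cabs_ge0 z)) // ltW.
apply: le_trans (Re_cabs _) _; rewrite cabsM cabsV.
apply: ler_pM; rewrite ?invr_ge0 ?cabs_ge0 //.
  by apply: le_trans (cabsD _ _) _; rewrite cabs_polar ger0_norm.
rewrite lef_pV2 ?posrE ?subr_gt0 //; first exact: cabs_polarB.
by rewrite (lt_le_trans _ (cabs_polarB t zr)) // subr_gt0.
Qed.

Lemma dkernel (z w : C) : w != z -> differentiable (fun w => (w + z) / (w - z)) w.
Proof.
move=> wz; apply: cdiffM; first by apply: cdiffD; [exact: cdiff_id|exact: cdiff_cst].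
by apply: cdiffV; [apply: cdiffB; [exact: cdiff_id|exact: cdiff_cst]|rewrite subr_eq0].
Qed.

Lemma continuous_pkernel z r : cabs z < r ->
  continuous (fun t => (polar r t + z) / (polar r t - z)).
Proof. move=> zr; exact (continuous_kernel zr (@dkernel z)). Qed.

Lemma continuous_pker z r : cabs z < r -> continuous (fun t => pker (polar r t) z).
Proof. by move=> zr; exact: (continuousRe (continuous_pkernel zr)). Qed.

Lemma continuous_realC (T : topologicalType) (v : T -> R) : continuous v ->
  continuous (fun t => (v t)%:C%C : C).
Proof.
move=> cv t; apply: (@continuous_Complex R T v (fun=> 0) t (cv t)).
exact: cvg_cst.
Qed.

(* On [|w| = r], [re ((w + z) / (w - z)) = w / (w - z) + g w] with [g] holomorphic
   near the closed disc and [g 0 = 0]. *)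
Lemma poisson (f : C -> C) T r z : (forall w, cabs w < T -> differentiable f w) ->
  cabs z < r -> r < T ->
  cmean (fun t => f (polar r t) * ((pker (polar r t) z)%:C)%C) = f z.
Proof.
move=> df zr rT; have r0 : 0 < r by exact: le_lt_trans (cabs_ge0 z) zr.
have cz := cabs_ge0 z.
have rr : 0 <= r < T by rewrite ltW.
pose g (w : C) := conjc z * w / (((r ^+ 2)%:C)%C - conjc z * w).
(* Since [cabs z < r], this radius exceeds [r], while [cabs z * cabs w < r ^ 2] below it, so the
   denominator of [g] has no zero there. *)
pose T' := Num.min T (2 * r ^+ 2 / (r + cabs z)).
have rz0 : 0 < r + cabs z by rewrite ltr_wpDr.
have rT' : r < T' by rewrite lt_min rT ltr_pdivlMr //; nra.
have dg w : cabs w < T' -> differentiable g w.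
  rewrite lt_min => /andP[wT wr0].
  have wr : cabs w * (r + cabs z) < 2 * r ^+ 2 by rewrite -ltr_pdivlMr.
  have dzw : differentiable (fun w => conjc z * w) w.
    by apply: cdiffM; [exact: cdiff_cst|exact: cdiff_id].
  apply: (cdiffM dzw); apply: cdiffV; first by apply: cdiffB; [exact: cdiff_cst|].
  rewrite subr_eq0; apply/negP => /eqP /(congr1 cabs).
  rewrite cabs_real cabsM cabs_conj ger0_norm ?sqr_ge0 // => H.
  have w0 : 0 <= cabs w by exact: cabs_ge0.
  nra.
have dfg w : cabs w < T' -> differentiable (fun w => f w * g w) w.
  by move=> wT; apply: cdiffM; [apply: df; move: wT; rewrite lt_min => /andP[]|exact: dg].
have rr' : 0 <= r < T' by rewrite ltW.
have := mean_value dfg rr'; rewrite {2}/g mulr0 mul0r mulr0 => H0.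
have H1 := cauchy_circle df zr rT.
have cfg := continuous_on_circle dfg rr'.
have cW : continuous (fun t => f (polar r t) * (polar r t / (polar r t - z))).
  apply: ccontinuousM; first exact: continuous_on_circle df rr.
  apply: (@continuous_kernel _ (fun w => w / (w - z)) _ _ zr) => w wz.
  apply: cdiffM; first exact: cdiff_id.
  by apply: cdiffV; [apply: cdiffB; [exact: cdiff_id|exact: cdiff_cst]|rewrite subr_eq0].
rewrite -H1 -[RHS]addr0 -H0 -(cmeanD cW cfg); congr cmean; apply/funext => t.
rewrite -mulrDr; congr (_ * _); rewrite /g /pker.
set w := polar r t; have wz : w - z != 0 by rewrite /w polar_neq.
have ww : ((r ^+ 2)%:C)%C = w * conjc w.
  by rewrite mulc_conj cabs_polar gtr0_norm.
have w0 : w != 0 by exact: polar_neq0.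
have cwz : conjc w - conjc z != 0 by rewrite -rmorphB conjc_eq0.
have -> x : ((re x)%:C)%C = (x + conjc x) / 2 :> C by exact: ReJ_add.
clearbody w.
rewrite ww rmorphM fmorphV rmorphD rmorphB /=.
have -> : w * conjc w - conjc z * w = w * (conjc w - conjc z) by ring.
field; by rewrite wz w0 cwz.
Qed.

End Harmonic.

(** * Littlewood subordination *)

Section Littlewood.
Variable R : realType.
Local Notation C := R[i].
Local Notation cabs := (@ComplexField.Normc.normc R).
Local Notation re := (@complex.Re R).

Lemma reMr (z : C) (x : R) : re (z * (x%:C)%C) = re z * x.
Proof. by case: z => a b /=; rewrite mulr0 subr0. Qed.

(** Young's inequality for the product [y * 1] with exponents [p] and its conjugate. *)
Lemma bernoulli_powR (p y : R) : 1 <= p -> 0 <= y -> 1 + p * (y - 1) <= y `^ p.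
Proof.
rewrite le_eqVlt => /predU1P[<-|p1] y0; first by rewrite powRr1 // mul1r subrKC.
have p0 : 0 < p by rewrite (lt_trans _ p1).
have pp : 1 - p^-1 != 0 by rewrite subr_eq0 eq_sym invr_eq1 gt_eqF.
have q0 : 0 < (1 - p^-1)^-1 by rewrite invr_gt0 subr_gt0 invf_lt1.
have := @conjugate_powR R y 1 p (1 - p^-1)^-1 y0 ler01 p0 q0.
rewrite invrK subrKC mulr1 powR1 mul1r => /(_ erefl).
rewrite -(ler_pM2r p0) mulrDl divfK ?gt_eqF // mulrBl mulVf ?gt_eqF //; lra.
Qed.

(** The tangent of [t ^ p] at [m] lies below the graph; [p * (m ^ p / m)] is the slope. It is
    Bernoulli's inequality at [x / m], scaled by [m ^ p]. *)
Lemma powR_tangent (p m x : R) : 1 <= p -> 0 < m -> 0 <= x ->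
  m `^ p + p * (m `^ p / m) * (x - m) <= x `^ p.
Proof.
move=> p1 m0 x0; have := bernoulli_powR p1 (divr_ge0 x0 (ltW m0)).
have mp : 0 < m `^ p by exact: powR_gt0.
rewrite -(ler_pM2l mp) -powRM ?divr_ge0 ?(ltW m0) // mulrCA divff ?gt_eqF // mulr1.
apply: le_trans; rewrite le_eqVlt; apply/orP; left; apply/eqP; field.
exact: lt0r_neq0.
Qed.

Lemma rmean_pker z r : cabs z < r -> rmean (fun t => pker (polar r t) z) = 1 :> R.
Proof.
move=> zr; have := @poisson R (fun=> 1) (r + 1) r z (fun w _ => @cdiff_cst R 1 w) zr.
rewrite ltrDl ltr01 => /(_ isT) /(congr1 re) /= <-; congr rmean; apply/funext => t /=.
by rewrite mul1r mul0r subr0.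
Qed.

(** Jensen's inequality for the probability density [pker]: by Poisson's formula [cabs (f z)] is at
    most the weighted mean [m] of [cabs f], and averaging the tangent inequality at [m] bounds
    [m ^ p]. *)
Lemma subharmonic_powR (p : R) (f : C -> C) T r z : 1 <= p ->
  (forall w, cabs w < T -> differentiable f w) -> cabs z < r -> r < T ->
  cabs (f z) `^ p <= rmean (fun t => pker (polar r t) z * cabs (f (polar r t)) `^ p).
Proof.
move=> p1 df zr rT; have r0 : 0 < r by exact: le_lt_trans (cabs_ge0 z) zr.
have rr : 0 <= r < T by rewrite ltW.
have p0 : 0 < p by rewrite (lt_le_trans _ p1).
have cf := continuous_on_circle df rr; have cP := continuous_pker zr.
have P0 t := pker_ge0 t zr.
have cM (u v : R -> R) : continuous u -> continuous v -> continuous (fun t => u t * v t).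
  by move=> cu cv t; apply: cvgM; [exact: cu|exact: cv].
have cfa : continuous (fun t => cabs (f (polar r t))) := continuousCabs cf.
have cfp : continuous (fun t => cabs (f (polar r t)) `^ p).
  by move=> t; apply: (@continuous_comp _ _ _ (fun t => f (polar r t)) (fun z : C => cabs z `^ p));
    [exact: cf|exact: continuous_cabs_powR].
have cPf := cM _ _ cP cfa; have cPfp := cM _ _ cP cfp.
set m := rmean (fun t => pker (polar r t) z * cabs (f (polar r t))).
have fm : cabs (f z) <= m.
  rewrite -(poisson df zr rT).
  apply: (cabs_cmean (ccontinuousM cf (continuous_realC cP)) cPf).
  by move=> t; rewrite cabsM cabs_real ger0_norm // mulrC.
have m0 : 0 <= m by exact: le_trans (cabs_ge0 _) fm.
have fmp : cabs (f z) `^ p <= m `^ p.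
  by apply: ge0_ler_powR; rewrite ?nnegrE ?cabs_ge0 // ltW.
apply: le_trans fmp _; move: m0; rewrite le_eqVlt => /predU1P[<-|m0].
  rewrite powR0 ?gt_eqF //; apply: rmean_ge0 => // t.
  by rewrite mulr_ge0 ?powR_ge0.
set k := p * (m `^ p / m).
have -> : m `^ p = rmean (fun t => (m `^ p - k * m) * pker (polar r t) z +
    k * (pker (polar r t) z * cabs (f (polar r t)))).
  rewrite (rmeanD (continuousMl (k := m `^ p - k * m) cP) (continuousMl (k := k) cPf)).
  rewrite (rmeanZ _ cP) (rmeanZ _ cPf) rmean_pker // -/m; ring.
apply: le_rmean => // [|t].
  by move=> t; apply: cvgD; [exact: (continuousMl (k := m `^ p - k * m) cP)|exact: (continuousMl (k := k) cPf)].
have := powR_tangent p1 m0 (cabs_ge0 (f (polar r t))).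
move=> /(ler_wpM2l (P0 t)); apply: le_trans.
by rewrite le_eqVlt -/k; apply/orP; left; apply/eqP; ring.
Qed.

(** The Herglotz integral of [v]: a holomorphic function whose real part is the Poisson integral of
    [v]. *)
Definition herglotz (v : R -> R) (r : R) (z : C) : C :=
  cmean (fun t => (polar r t + z) / (polar r t - z) * (v t)%:C%C).

Lemma re_herglotz (v : R -> R) r z : cabs z < r ->
  re (herglotz v r z) = rmean (fun t => pker (polar r t) z * v t).
Proof.
move=> zr; rewrite /herglotz /cmean [LHS]/=; congr rmean; apply/funext => t.
by rewrite [LHS]reMr.
Qed.

Lemma herglotz_differentiable (v : R -> R) r z : continuous v -> (forall t, 0 <= v t) ->
  cabs z < r -> differentiable (herglotz v r) z.
Proof.
move=> cv v0 zr; have cvC := continuous_realC cv.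
have r0 : 0 < r by exact: le_lt_trans (cabs_ge0 z) zr.
set d := r - cabs z; have d0 : 0 < d by rewrite subr_gt0.
apply/differentiable_cabsP.
exists (cmean (fun t => 2 * polar r t / (polar r t - z) ^+ 2 * (v t)%:C%C)).
move=> e e0; set V := rmean v.
have V0 : 0 <= V by exact: rmean_ge0.
(* The error of the difference quotient is [h] times the mean of [2 w / ((w - z - h) (w - z) ^ 2)]
   against [v]; the two factors of the denominator are at least [d / 2] and [d ^ 2]. *)
pose K := 4 * r / d ^+ 3.
have K0 : 0 <= K * V by rewrite mulr_ge0 // divr_ge0 ?mulr_ge0 ?exprn_ge0 // ltW.
exists (Num.min (d / 2) (e / (K * V + 1))).
  by rewrite lt_min divr_gt0 // divr_gt0 // ltr_wpDl.
move=> h h0; rewrite lt_min => /andP[hd]; rewrite ltr_pdivlMr; last by rewrite ltr_wpDl.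
rewrite mulrDr mulr1 => he; have ch0 : 0 < cabs h by rewrite cabs_gt0.
have zhr : cabs (z + h) < r.
  by apply: le_lt_trans (cabsD _ _) _; rewrite /d in hd d0; lra.
pose A zeta t := (polar r t + zeta) / (polar r t - zeta) * (v t)%:C%C.
have cA zeta : cabs zeta < r -> continuous (A zeta).
  by move=> zetar; exact (ccontinuousM (continuous_pkernel zetar) cvC).
have cid : continuous (fun t => polar r t : C).
  by apply: (@continuous_circle R id) => w _; exact: cvg_id.
have cB : continuous (fun t => 2 * polar r t / (polar r t - z) ^+ 2 * (v t)%:C%C).
  apply: (ccontinuousM _ cvC).
  apply: (@continuous_kernel _ (fun w => 2 * w / (w - z) ^+ 2) _ _ zr) => w wz.
  apply: cdiffM; first by apply: cdiffM; [exact: cdiff_cst|exact: cdiff_id].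
  apply: cdiffV; last by rewrite expf_neq0 // subr_eq0.
  by apply: cdiffM; apply: cdiffB; by [exact: cdiff_id|exact: cdiff_cst].
set L := cmean _.
pose D t := (h ^+ 2)^-1 * ((A (z + h) t - A z t) - h * (2 * polar r t / (polar r t - z) ^+ 2 * (v t)%:C%C)).
have cAA : continuous (fun t => A (z + h) t - A z t).
  exact (ccontinuousD (cA _ zhr) (ccontinuousN (cA _ zr))).
have chB := ccontinuousM (@ccontinuous_cst R R h) cB.
have cDD := ccontinuousD cAA (ccontinuousN chB).
have cD : continuous D := ccontinuousM (@ccontinuous_cst R R (h ^+ 2)^-1) cDD.
have -> : (herglotz v r (z + h) - herglotz v r z) / h - L = h * cmean D.
  rewrite /D (cmeanZ _ cDD) (cmeanB cAA chB) (cmeanB (cA _ zhr) (cA _ zr)) (cmeanZ _ cB).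
  rewrite -/L /herglotz -/(A (z + h)) -/(A z).
  by clear -h0; clearbody L; move: (cmean _) (cmean _) => u1 u2; field.
rewrite cabsM; apply: le_lt_trans (_ : cabs h * (K * V) < e); last by lra.
rewrite ler_pM2l //.
have DK t : cabs (D t) <= K * v t.
  set w := polar r t.
  have wz : w - z != 0 by rewrite /w polar_neq.
  have wzh : w - (z + h) != 0 by rewrite /w polar_neq.
  have -> : D t = 2 * w / ((w - (z + h)) * (w - z) ^+ 2) * (v t)%:C%C.
    rewrite /D /A -/w; field; by rewrite wz wzh h0.
  rewrite cabsM cabs_real ger0_norm // ler_wpM2r //.
  rewrite !cabsM cabsV cabsM cabsX cabs_polar gtr0_norm //.
  have -> : cabs 2 = 2 by rewrite -(rmorph_nat (real_complex R) 2) cabs_real ger0_norm.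
  have H1 : d / 2 <= cabs (w - (z + h)).
    have Hd : d = r - cabs z by [].
    have Ha := cabs_polarB t zhr; have Hb := cabsD z h; rewrite -/w in Ha; lra.
  have H2 : d <= cabs (w - z) by exact: cabs_polarB.
  have -> : K = 2 * r * (d / 2 * d ^+ 2)^-1 by rewrite /K; field; exact: lt0r_neq0.
  have H3 : 0 < d / 2 * d ^+ 2 by rewrite mulr_gt0 ?divr_gt0 ?exprn_gt0.
  have H4 : d / 2 * d ^+ 2 <= cabs (w - (z + h)) * cabs (w - z) ^+ 2.
    apply: ler_pM => //; [by rewrite divr_ge0 // ltW|exact: sqr_ge0|].
    by rewrite ler_sqr ?nnegrE ?cabs_ge0 // ltW.
  rewrite ler_wpM2l ?mulr_ge0 ?(ltW r0) // lef_pV2 ?posrE //.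
  exact: lt_le_trans H4.
by have := cabs_cmean cD (continuousMl (k := K) cv) DK; rewrite (rmeanZ _ cv).
Qed.

Lemma continuous_powR_circle (p : R) (f : C -> C) r : 0 < p ->
  continuous (fun t => f (polar r t)) ->
  continuous (fun t => cabs (f (polar r t)) `^ p).
Proof.
move=> p0 cf t; apply: (@continuous_comp _ _ _ (fun t => f (polar r t)) (fun z : C => cabs z `^ p)).
  exact: cf.
exact: continuous_cabs_powR.
Qed.

(* The Poisson integral of [|f|^p] on the circle of radius [r] is the real part of a
   holomorphic function [H], and [H \o psi] has the mean value property. *)
Lemma littlewood_circle (p : R) (f psi : C -> C) T r s t : 1 <= p ->
  (forall w, cabs w < T -> differentiable f w) -> r < T ->
  (forall w, cabs w < s -> differentiable psi w /\ cabs (psi w) < r) -> 0 <= t < s ->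
  rmean (fun x => cabs (f (psi (polar t x))) `^ p) <=
  (r + cabs (psi 0)) / (r - cabs (psi 0)) * rmean (fun x => cabs (f (polar r x)) `^ p).
Proof.
move=> p1 df rT dpsi ts; have /andP[t0 ts'] := ts.
have p0 : 0 < p by rewrite (lt_le_trans _ p1).
have s0 : 0 < s by exact: le_lt_trans ts'.
have c0 : cabs (psi 0) < r by have [] := dpsi 0; rewrite ?cabs0.
have r0 : 0 < r by exact: le_lt_trans (cabs_ge0 _) c0.
have rr : 0 <= r < T by rewrite ltW.
pose v x := cabs (f (polar r x)) `^ p.
have cv : continuous v := continuous_powR_circle p0 (continuous_on_circle df rr).
have v0 x : 0 <= v x by exact: powR_ge0.
have dH w : cabs w < s -> differentiable (fun w => herglotz v r (psi w)) w.
  move=> /dpsi[d1 d2]; exact (cdiff_comp d1 (herglotz_differentiable cv v0 d2)).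
have psit x : cabs (psi (polar t x)) < r.
  by have [] := dpsi (polar t x); rewrite ?cabs_polar ?ger0_norm.
have cH := continuous_on_circle dH ts.
have dfpsi w : cabs w < s -> differentiable (fun w => f (psi w)) w.
  move=> /dpsi[d1 d2]; exact (cdiff_comp d1 (df _ (lt_trans d2 rT))).
have cfpsi := continuous_powR_circle p0 (continuous_on_circle dfpsi ts).
apply: le_trans (_ : _ <= rmean (fun x => re (herglotz v r (psi (polar t x))))) _.
  apply: (le_rmean cfpsi (continuousRe cH)) => x.
  rewrite -[leRHS]/(re (herglotz v r (psi (polar t x)))) (re_herglotz v (psit x)).
  exact (subharmonic_powR p1 df (psit x) rT).
have /(congr1 re) := mean_value dH ts; rewrite [re (cmean _)]/= /comp => ->.
rewrite (re_herglotz v c0) -(rmeanZ _ cv).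
have cP := continuous_pker c0.
have cPv : continuous (fun x => pker (polar r x) (psi 0) * v x).
  by move=> x; apply: cvgM; [exact: cP|exact: cv].
apply: (le_rmean cPv (continuousMl (k := _) cv)) => x.
by apply: ler_wpM2r; [exact: v0|exact: pker_le].
Qed.

End Littlewood.

(** * Hardy spaces *)

Section Hardy.
Variable R : realType.
Local Notation C := R[i].
Local Notation cabs := (@ComplexField.Normc.normc R).
Local Notation re := (@complex.Re R).
Local Notation im := (@complex.Im R).
Implicit Types (f g psi : C -> C) (p r s t : R).

(** Closed discs are images of compact rectangles under [polar], which is how the extreme value
    theorem is applied to them. *)
Lemma polar_arg (z : C) : exists2 th, - pi <= th <= pi & z = polar (cabs z) th.
Proof.
have [->|z0] := eqVneq z 0.
  exists 0; first by rewrite lerNl oppr0 pi_ge0.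
  by rewrite cabs0 polar0.
have c0 : 0 < cabs z by rewrite cabs_gt0.
set x := re z / cabs z.
have x1 : -1 <= x <= 1.
  rewrite -ler_norml normrM normfV (gtr0_norm c0) ler_pdivrMr // mul1r.
  exact: normRe_cabs.
have cx : cos (acos x) = x by rewrite acosK // in_itv.
have sx : sin (acos x) = `|im z| / cabs z.
  rewrite sin_acos // -[RHS]ger0_norm ?divr_ge0 ?(ltW c0) // -sqrtr_sqr; congr Num.sqrt.
  rewrite /x !exprMn !exprVn real_normK ?num_real //.
  rewrite -[1](@divff _ (cabs z ^+ 2)) ?expf_neq0 ?gt_eqF // -mulrBl.
  by rewrite cabs_sqr addrC addKr.
have a0 := acos_ge0 x1; have a1 := acos_lepi x1.
have E : z = Complex (cabs z * x) (cabs z * (im z / cabs z)).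
  rewrite /x !(mulrC (cabs z)) !divfK ?gt_eqF //; by case: (z).
have [i0|i0] := leP 0 (im z).
  exists (acos x); first by rewrite a1 (le_trans _ a0) // lerNl oppr0 pi_ge0.
  by rewrite /polar cx sx ger0_norm // -E.
exists (- acos x); first by rewrite lerN2 a1 (le_trans _ (pi_ge0 R)) // lerNl oppr0.
by rewrite /polar cosN sinN cx sx ltr0_norm // mulNr opprK -E.
Qed.

Definition pM p f r : R := rmean (fun x => cabs (f (polar r x)) `^ p).

Definition diff_disc f := forall w, cabs w < 1 -> differentiable f w.

Lemma holomorphic_discP f : holomorphic_on (@disc R) f <-> diff_disc f.
Proof. exact: (holomorphic_onP f (@disc_open R)). Qed.

Lemma continuous_pM p f r : 0 < p -> diff_disc f -> 0 <= r < 1 ->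
  continuous (fun x => cabs (f (polar r x)) `^ p).
Proof. move=> p0 df r1; exact (continuous_powR_circle p0 (continuous_on_circle df r1)). Qed.

Lemma pmeanE p f r : 0 < p -> diff_disc f -> 0 <= r < 1 -> pmean p f r = (pM p f r)%:E.
Proof.
move=> p0 df r1; have cf := continuous_pM p0 df r1.
rewrite /pmean /pM /rmean EFinM /rint /Rintegral fineK //.
apply: integrable_fin_num => //; exact: (continuous_integrable 0 (pi *+ 2) cf).
Qed.

Lemma pM_ge0 p f r : 0 < p -> diff_disc f -> 0 <= r < 1 -> 0 <= pM p f r.
Proof.
move=> p0 df r1; apply: (rmean_ge0 (continuous_pM p0 df r1)) => t; exact: powR_ge0.
Qed.

Lemma hardy_diff p f : hardy p f -> diff_disc f.
Proof. by case=> /holomorphic_discP. Qed.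

Lemma hardy_intro p f M : 0 < p -> diff_disc f ->
  (forall r, 0 <= r < 1 -> pM p f r <= M) -> hardy p f.
Proof.
move=> p0 df H; split; first exact/holomorphic_discP.
by exists M => r r1; rewrite pmeanE // lee_fin H.
Qed.

Local Notation psup p f := (ereal_sup [set pmean p f r | r in [set r : R | 0 <= r < 1]]).

Lemma zero_in01 : ((0 : R) <= (0 : R) < (1 : R))%R. Proof. by rewrite lexx ltr01. Qed.

(** Finiteness of the supremum makes the [fine] in [hnorm] faithful. *)
Lemma psup_fin p f : 0 < p -> hardy p f -> psup p f \is a fin_num.
Proof.
move=> p0 hf; have df := hardy_diff hf; case: hf => _ [M HM].
rewrite ge0_fin_numE.
  apply: le_lt_trans (ltry M); apply: ge_ereal_sup => _ [r r1 <-]; exact: HM.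
apply: le_trans (_ : (pmean p f 0 <= _)%E).
  by rewrite pmeanE ?zero_in01 // lee_fin pM_ge0 ?zero_in01.
by apply: ereal_sup_ubound; exists 0 => //=; exact: zero_in01.
Qed.

Lemma hnorm_ge0 p f : 0 <= hnorm p f.
Proof. exact: powR_ge0. Qed.

Lemma hnorm_powE p f : 0 < p -> hardy p f -> (hnorm p f `^ p)%:E = psup p f.
Proof.
move=> p0 hf; have fin := psup_fin p0 hf.
rewrite /hnorm -powRrM mulVf ?gt_eqF // powRr1 ?fineK //.
rewrite fine_ge0 //; apply: le_trans (_ : (pmean p f 0 <= _)%E).
  by rewrite pmeanE ?zero_in01 // ?lee_fin ?pM_ge0 ?zero_in01 //; exact: hardy_diff hf.
by apply: ereal_sup_ubound; exists 0 => //=; exact: zero_in01.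
Qed.

Lemma pM_le_hnorm p f r : 0 < p -> hardy p f -> 0 <= r < 1 -> pM p f r <= hnorm p f `^ p.
Proof.
move=> p0 hf r1; rewrite -lee_fin hnorm_powE // -pmeanE //; last exact: hardy_diff hf.
by apply: ereal_sup_ubound; exists r.
Qed.

Lemma hnorm_le p f K : 0 < p -> 0 <= K -> diff_disc f ->
  (forall r, 0 <= r < 1 -> pM p f r <= K `^ p) -> hardy p f /\ hnorm p f <= K.
Proof.
move=> p0 K0 df H; have hf := hardy_intro p0 df H; split => //.
have : hnorm p f `^ p <= K `^ p.
  rewrite -lee_fin hnorm_powE //; apply: ge_ereal_sup => _ [r r1 <-].
  by rewrite pmeanE // lee_fin H.
move=> H1; have pi0 : 0 <= p^-1 by rewrite invr_ge0 ltW.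
have := hnorm_ge0 p f; move: (hnorm p f) H1 => N H1 N0.
have := @ge0_ler_powR R _ pi0 (N `^ p) (K `^ p).
rewrite !nnegrE !powR_ge0 => /(_ isT isT H1).
by rewrite -!powRrM mulfV ?gt_eqF // !powRr1.
Qed.

Lemma hnorm_approx p f e : 0 < p -> hardy p f -> 0 < e ->
  exists2 r, 0 <= r < 1 & hnorm p f `^ p - e < pM p f r.
Proof.
move=> p0 hf e0; have df := hardy_diff hf.
have [_ [r r1 <-]] := @ub_ereal_sup_adherent R _ e e0 (psup_fin p0 hf).
rewrite -hnorm_powE // pmeanE // -EFinB lte_fin => H; by exists r.
Qed.

(** Littlewood's inequality for the identity map, whose value [0] at the origin makes the constant
    [1]. *)
Lemma pM_mono p f r s : 1 <= p -> diff_disc f -> 0 <= r -> r <= s -> s < 1 ->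
  pM p f r <= pM p f s.
Proof.
move=> p1 df r0; rewrite le_eqVlt => /predU1P[->//|rs] s1.
have s0 : 0 < s by exact: le_lt_trans rs.
have H : forall w : C, cabs w < s -> differentiable (fun w : C => w) w /\ cabs w < s.
  by move=> w ws; split => //; exact: cdiff_id.
have E : (s + cabs ((fun w : C => w) 0)) / (s - cabs ((fun w : C => w) 0)) = 1.
  by rewrite cabs0 addr0 subr0 divff ?gt_eqF.
by have := littlewood_circle p1 df s1 H (introT andP (conj r0 rs)); rewrite E mul1r.
Qed.

Lemma pM_ext p f g r : (forall w, cabs w < 1 -> f w = g w) -> 0 <= r < 1 ->
  pM p f r = pM p g r.
Proof.
move=> fg /andP[r0 r1]; congr rmean; apply/funext => t.
by rewrite fg // cabs_polar ger0_norm.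
Qed.

Lemma diff_disc_ext f g : (forall w, cabs w < 1 -> f w = g w) -> diff_disc f -> diff_disc g.
Proof.
move=> fg df w w1; apply: (@near_eq_differentiable _ f); last exact: df.
exact: filterS (near_disc w1).
Qed.

Lemma hardy_ext p f g : 0 < p -> (forall w, cabs w < 1 -> f w = g w) -> hardy p f -> hardy p g.
Proof.
move=> p0 fg hf; apply: (@hardy_intro p g (hnorm p f `^ p)) => //.
  exact: diff_disc_ext fg (hardy_diff hf).
by move=> r r1; rewrite -(pM_ext p fg r1) pM_le_hnorm.
Qed.

Lemma hnorm_eq0 p f : 0 < p -> (forall w, cabs w < 1 -> f w = 0) ->
  hardy p f /\ hnorm p f = 0.
Proof.
move=> p0 f0; have [] := @hnorm_le p f 0 p0 (lexx _).
- by apply: (@diff_disc_ext (fun=> 0)) => [w /f0 //|w _]; exact: cdiff_cst.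
- move=> r r1; rewrite (@pM_ext p f (fun=> 0)) //.
  by rewrite /pM cabs0 powR0 ?gt_eqF // rmean_cst.
by move=> hf H; split => //; apply/eqP; rewrite eq_le H hnorm_ge0.
Qed.

(** The sum is at most twice the larger term; the factor [2 ^ p] is harmless in [hardyD], which
    asserts membership only. *)
Lemma powR_add_le p (x y : R) : 0 < p -> 0 <= x -> 0 <= y ->
  (x + y) `^ p <= 2 `^ p * (x `^ p + y `^ p).
Proof.
move=> p0 x0 y0; wlog xy : x y x0 y0 / x <= y.
  by move=> H; have [/H|/ltW/H] := leP x y; [exact|rewrite addrC (addrC (x `^ p)); exact].
apply: le_trans (_ : (2 * y) `^ p <= _).
  by apply: ge0_ler_powR; rewrite ?nnegrE ?addr_ge0 ?mulr_ge0 ?(ltW p0) //; lra.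
by rewrite powRM // ler_wpM2l ?powR_ge0 // lerDr powR_ge0.
Qed.

Lemma diff_discD f g : diff_disc f -> diff_disc g -> diff_disc (fun w => f w + g w).
Proof. by move=> df dg w w1; apply: cdiffD; [exact: df|exact: dg]. Qed.

Lemma diff_discZ k f : diff_disc f -> diff_disc (fun w => k * f w).
Proof. by move=> df w w1; apply: cdiffM; [exact: cdiff_cst|exact: df]. Qed.

Lemma diff_discM f g : diff_disc f -> diff_disc g -> diff_disc (fun w => f w * g w).
Proof. by move=> df dg w w1; apply: cdiffM; [exact: df|exact: dg]. Qed.

Lemma diff_disc_cst (k : C) : diff_disc (fun=> k).
Proof. by move=> w _; exact: cdiff_cst. Qed.

Lemma diff_discX f n : diff_disc f -> diff_disc (fun w => f w ^+ n).
Proof.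
move=> df; elim: n => [|n IH]; first exact: diff_disc_cst.
have -> : (fun w => f w ^+ n.+1) = (fun w => f w * f w ^+ n).
  by apply/funext => w; rewrite exprS.
exact: diff_discM.
Qed.

Lemma pMZ p k f r : 0 < p -> diff_disc f -> 0 <= r < 1 ->
  pM p (fun w => k * f w) r = cabs k `^ p * pM p f r.
Proof.
move=> p0 df r1; rewrite /pM -(rmeanZ _ (continuous_pM p0 df r1)); congr rmean.
by apply/funext => t; rewrite cabsM powRM ?cabs_ge0.
Qed.

Lemma hardyD p f g : 0 < p -> hardy p f -> hardy p g -> hardy p (fun w => f w + g w).
Proof.
move=> p0 hf hg; have df := hardy_diff hf; have dg := hardy_diff hg.
apply: (@hardy_intro p _ (2 `^ p * (hnorm p f `^ p + hnorm p g `^ p)) p0 (diff_discD df dg)) => r r1.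
apply: le_trans (_ : _ <= 2 `^ p * (pM p f r + pM p g r)) _; last first.
  by rewrite ler_wpM2l ?powR_ge0 // lerD // pM_le_hnorm.
have cf := continuous_pM p0 df r1; have cg := continuous_pM p0 dg r1.
have cfg : continuous (fun x => cabs (f (polar r x)) `^ p + cabs (g (polar r x)) `^ p).
  by move=> x; apply: cvgD; [exact: cf|exact: cg].
rewrite /pM -(rmeanD cf cg) -(rmeanZ _ cfg).
apply: (le_rmean (continuous_pM p0 (diff_discD df dg) r1) (continuousMl (k := _) cfg)) => t.
apply: le_trans (powR_add_le p0 (cabs_ge0 _) (cabs_ge0 _)).
by apply: ge0_ler_powR; rewrite ?nnegrE ?addr_ge0 ?cabs_ge0 ?(ltW p0) // cabsD.
Qed.

Lemma hardyZ p k f : 0 < p -> hardy p f ->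
  hardy p (fun w => k * f w) /\ hnorm p (fun w => k * f w) <= cabs k * hnorm p f.
Proof.
move=> p0 hf; have df := hardy_diff hf.
apply: hnorm_le => //; first by rewrite mulr_ge0 ?cabs_ge0 ?hnorm_ge0.
  exact: diff_discZ.
move=> r r1; rewrite pMZ // powRM ?cabs_ge0 ?hnorm_ge0 //.
by rewrite ler_wpM2l ?powR_ge0 // pM_le_hnorm.
Qed.

Lemma hnorm_bounded p f K : 0 < p -> 0 <= K -> diff_disc f ->
  (forall w, cabs w < 1 -> cabs (f w) <= K) -> hardy p f /\ hnorm p f <= K.
Proof.
move=> p0 K0 df fK; apply: hnorm_le => // r r1; rewrite -[leRHS]rmean_cst.
apply: (le_rmean (continuous_pM p0 df r1)) => [x|x]; first exact: cvg_cst.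
apply: ge0_ler_powR; rewrite ?nnegrE ?cabs_ge0 ?(ltW p0) //; apply: fK.
by move: r1 => /andP[r0 r1]; rewrite cabs_polar ger0_norm.
Qed.

Lemma self_map_bound psi t : diff_disc psi ->
  (forall w, cabs w < 1 -> cabs (psi w) < 1) -> 0 <= t < 1 ->
  exists2 r, r < 1 & forall w, cabs w <= t -> cabs (psi w) <= r.
Proof.
move=> dpsi psi1 /andP[t0 t1].
pose F (a : R * R) := cabs (psi (polar a.1 a.2)).
have cK : compact (`[0, t] `*` `[- pi, pi] : set (R * R)).
  by apply: compact_setX; exact: segment_compact.
have inK a : (`[0, t] `*` `[- pi, pi] : set (R * R)) a -> cabs (polar a.1 a.2) < 1.
  move=> [a1 _]; have /andP[a0 at_] : 0 <= a.1 <= t by move: a1; rewrite /= in_itv.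
  by rewrite cabs_polar ger0_norm // (le_lt_trans at_).
have [||c cin Hc] := compact_EVT_max _ cK (f := F).
- by exists (0, 0); split; rewrite /= in_itv /= ?lexx // lerNl oppr0 pi_ge0.
- apply: continuous_in_subspaceT => a /set_mem /inK a1.
  apply: (@continuous_comp _ _ _ (fun a => psi (polar a.1 a.2)) cabs); last exact: continuous_cabs.
  apply: (@continuous_comp _ _ _ (fun a => polar a.1 a.2) psi); first exact: continuous_polar.
  by apply: cdiff_cont; exact: dpsi.
exists (F c); first by apply: psi1; apply: inK; exact: set_mem.
move=> w wt; have [th thpi ->] := polar_arg w.
apply: (Hc (cabs w, th)); rewrite inE; split; rewrite /= in_itv //=.
by rewrite cabs_ge0.
Qed.

Lemma littlewood p f psi : 1 <= p -> hardy p f -> diff_disc psi ->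
  (forall w, cabs w < 1 -> cabs (psi w) < 1) ->
  hardy p (fun w => f (psi w)) /\
  hnorm p (fun w => f (psi w)) <= (4 / (1 - cabs (psi 0))) `^ p^-1 * hnorm p f.
Proof.
move=> p1 hf dpsi psi1; have p0 : 0 < p by rewrite (lt_le_trans _ p1).
have df := hardy_diff hf; set c := cabs (psi 0).
have c1 : c < 1 by apply: psi1; rewrite cabs0.
have c0 : 0 <= c by exact: cabs_ge0.
have k0 : 0 <= 4 / (1 - c) by rewrite divr_ge0 // subr_ge0 ltW.
have dfpsi : diff_disc (fun w => f (psi w)).
  by move=> w w1; exact (cdiff_comp (dpsi w w1) (df _ (psi1 w w1))).
apply: (hnorm_le p0 _ dfpsi); first by rewrite mulr_ge0 ?powR_ge0 ?hnorm_ge0.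
move=> t /andP[t0 t1]; rewrite powRM ?powR_ge0 ?hnorm_ge0 // -powRrM mulVf ?gt_eqF //.
rewrite powRr1 //.
pose s := (1 + t) / 2; have [ts s1] : t < s /\ s < 1 by rewrite /s; split; lra.
have s01 : 0 <= s < 1 by rewrite s1 andbT (le_trans t0) // ltW.
have [rho rho1 Hrho] := self_map_bound dpsi psi1 s01.
(* The first bound puts the image of the disc of radius [s] inside radius [r]. The second gives
   [r - c >= (1 - c) / 2], and with [r + c <= 2] the constant [4 / (1 - c)]. *)
pose r := Num.max ((1 + rho) / 2) ((1 + c) / 2).
have r1 : r < 1 by rewrite gt_max; apply/andP; split; lra.
have rr : rho < r by rewrite lt_max; apply/orP; left; lra.
have rc : (1 + c) / 2 <= r by rewrite le_max lexx orbT.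
have Hpsi w : cabs w < s -> differentiable psi w /\ cabs (psi w) < r.
  move=> ws; split; first by apply: dpsi; exact: lt_trans s1.
  by apply: le_lt_trans rr; apply: Hrho; exact: ltW.
have := littlewood_circle p1 df r1 Hpsi (introT andP (conj t0 ts)).
rewrite -/(pM p (fun w => f (psi w)) t) -/(pM p f r) -/c => /le_trans; apply.
have r0 : 0 <= r by rewrite (le_trans _ rc) //; lra.
apply: ler_pM.
- by apply: divr_ge0; lra.
- by apply: pM_ge0 => //; rewrite r0.
- rewrite ler_pdivrMr; last by lra.
  by rewrite mulrAC ler_pdivlMr; [nra|lra].
- by apply: pM_le_hnorm => //; rewrite r0.
Qed.

End Hardy.

(** * Uniform convexity and density of polynomials *)

Section UniformConvexity.
Variable R : realType.
Local Notation C := R[i].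
Local Notation cabs := (@ComplexField.Normc.normc R).
Implicit Types (f g psi : C -> C) (p r s t : R).

(** Write [y ^ p = y * y ^ (p - 1)]; then [y ^ (p - 1) > 1 + (p - 1) * ln y], strictly because
    [ln y] is nonzero, and [y * ln y >= y - 1]. *)
Lemma bernoulli_powR_lt (p y : R) : 1 < p -> 0 < y -> y != 1 -> 1 + p * (y - 1) < y `^ p.
Proof.
move=> p1 y0 y1; have ly : ln y != 0 by rewrite ln_eq0.
have p10 : 0 < p - 1 by rewrite subr_gt0.
have H1 : 1 + (p - 1) * ln y < y `^ (p - 1).
  by rewrite /powR gt_eqF //; apply: expR_gt1Dx; rewrite mulf_neq0 // gt_eqF.
have H2 : - ln y <= y^-1 - 1.
  rewrite -lnV ?posrE // -{1}(subrKC 1 y^-1); apply: le_ln1Dx.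
  by rewrite ltrBrDl subrr invr_gt0.
rewrite -(mulr_powRB1 (ltW y0) (lt_trans ltr01 p1)).
apply: le_lt_trans (_ : _ <= y * (1 + (p - 1) * ln y)) _; last by rewrite ltr_pM2l.
have H3 : (y - 1) <= y * ln y.
  have : y * (- ln y) <= y * (y^-1 - 1) by rewrite ler_pM2l.
  by rewrite mulrBr mulfV ?gt_eqF // mulr1 mulrN; lra.
nra.
Qed.

(** The defect in the midpoint convexity of [cabs ^ p]. *)
Local Notation gap p a b :=
  ((cabs a `^ p + cabs b `^ p) / 2 - cabs ((a + b) / 2) `^ p).

Lemma cabs2 : cabs 2 = 2.
Proof. by rewrite -(rmorph_nat (real_complex R) 2) cabs_real ger0_norm. Qed.

Lemma gap_ge0 p (a b : C) : 1 <= p -> 0 <= gap p a b.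
Proof.
move=> p1; set m := cabs ((a + b) / 2).
have mab : m <= (cabs a + cabs b) / 2.
  by rewrite /m cabsM cabsV cabs2 ler_pM2r ?invr_gt0 // cabsD.
have : 0 <= m by exact: cabs_ge0.
rewrite le_eqVlt => /predU1P[<-|m0].
  by rewrite powR0 ?subr0 ?divr_ge0 ?addr_ge0 ?powR_ge0 // gt_eqF // (lt_le_trans ltr01).
have := powR_tangent p1 m0 (cabs_ge0 a); have := powR_tangent p1 m0 (cabs_ge0 b).
have k0 : 0 <= p * (m `^ p / m).
  by rewrite mulr_ge0 ?divr_ge0 ?powR_ge0 ?(ltW m0) // (le_trans ler01).
set k := p * _ in k0 *; nra.
Qed.

(** The midpoint modulus [m] is below [1], so the tangent of [t ^ p] at [m] lies strictly below the
    graph at [1]. When [m = 0] there is no tangent argument and the gap is the mean itself. *)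
Lemma gap1_gt0 p (b : C) : 1 < p -> cabs b <= 1 -> b != 1 -> 0 < gap p 1 b.
Proof.
move=> p1 b1 bn1; set m := cabs ((1 + b) / 2).
have mb : m <= (1 + cabs b) / 2.
  by rewrite /m cabsM cabsV cabs2 ler_pM2r ?invr_gt0 //; have := cabsD 1 b; rewrite cabs1.
(* [cabs (1 + b) = 2] with [cabs b <= 1] forces [b = 1]. *)
have m1 : m < 1.
  have : m <= 1 by apply: le_trans mb _; lra.
  rewrite le_eqVlt => /predU1P[m1|//]; exfalso; move/negP: bn1; apply.
  have H : cabs (1 + b) ^+ 2 = 4.
    have : cabs (1 + b) = 2 * m by rewrite /m cabsM cabsV cabs2 mulrCA mulfV ?mulr1.
    by rewrite m1 mulr1 => ->; rewrite expr2; ring.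
  have H' : cabs b ^+ 2 <= 1 by rewrite expr_le1 ?cabs_ge0.
  rewrite !cabs_sqr in H H'; move: H H'; case: (b) => x y /=; rewrite add0r => H H'.
  have y2 : 0 <= y ^+ 2 by exact: sqr_ge0.
  have x1 : x = 1.
    have := sqr_ge0 (x - 1); have : x ^+ 2 <= 1 by lra.
    by nra.
  have y0 : y ^+ 2 = 0 by move: H'; rewrite x1 expr1n; lra.
  by rewrite eq_complex /= x1 eqxx -sqrf_eq0 y0 eqxx.
rewrite cabs1 powR1.
have : 0 <= m by exact: cabs_ge0.
rewrite le_eqVlt => /predU1P[<-|m0].
  have p0 : 0 < p := lt_trans ltr01 p1.
  by rewrite (powR0 (lt0r_neq0 p0)) subr0 divr_gt0 // ltr_wpDr ?powR_ge0.
have mp : 0 < m `^ p by exact: powR_gt0.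
have B1 := powR_tangent (ltW p1) m0 (cabs_ge0 b).
have B2 : m `^ p + p * (m `^ p / m) * (1 - m) < 1.
  have m1' : m^-1 != 1 by rewrite invr_eq1 lt_eqF.
  have := bernoulli_powR_lt p1 (eq_ind_r is_true m0 (invr_gt0 m)) m1'.
  rewrite -(ltr_pM2l mp) -powRM ?invr_ge0 ?(ltW m0) // mulfV ?gt_eqF // powR1.
  apply: le_lt_trans; rewrite le_eqVlt; apply/orP; left; apply/eqP; field.
  exact: lt0r_neq0.
have k0 : 0 <= p * (m `^ p / m).
  by rewrite mulr_ge0 ?divr_ge0 ?powR_ge0 ?(ltW m0) // (le_trans ler01) // ltW.
set k := p * _ in k0 B1 B2; nra.
Qed.

Lemma uniform_gap1 p e : 1 < p -> 0 < e -> exists2 K, 0 <= K &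
  forall b : C, cabs b <= 1 -> cabs (1 - b) `^ p <= e + K * gap p 1 b.
Proof.
move=> p1 e0; have p0 : 0 < p by exact: lt_trans p1.
(* [Phi] is positive on the closed disc: the gap is positive off [b = 1], and at [b = 1] the second
   term equals [e]. Where [cabs (1 - b) ^ p > e] the second term is zero, so the minimum [d] of
   [Phi] bounds the gap from below. *)
pose Phi (b : C) := gap p 1 b + Num.max 0 (e - cabs (1 - b) `^ p).
have cpow (f : C -> C) : continuous f -> continuous (fun b => cabs (f b) `^ p).
  move=> cf b; apply: (@continuous_comp _ _ _ f (fun z : C => cabs z `^ p)); first exact: cf.
  exact: continuous_cabs_powR.
have cP : continuous Phi.
  move=> b; apply: (@continuousD _ _ _ (fun b => gap p 1 b)).
    apply: (@continuousB _ _ _ (fun b => (cabs 1 `^ p + cabs b `^ p) / 2)); last first.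
      apply: (cpow (fun b => (1 + b) / 2)).
      apply: ccontinuousM; last exact: ccontinuous_cst.
      by apply: ccontinuousD; [exact: ccontinuous_cst|move=> z; exact: cvg_id].
    apply: (@continuousM _ _ (fun b => cabs 1 `^ p + cabs b `^ p)); last exact: cst_continuous.
    apply: (@continuousD _ _ _ (fun=> cabs 1 `^ p)); first exact: cst_continuous.
    by apply: (cpow id) => z; exact: cvg_id.
  apply: (@continuous_max _ _ (fun=> 0)); first exact: cst_continuous.
  apply: (@continuousB _ _ _ (fun=> e)); first exact: cst_continuous.
  apply: (cpow (fun b => 1 - b)).
  apply: ccontinuousD; first exact: ccontinuous_cst.
  by apply: ccontinuousN => z; exact: cvg_id.
have cK : compact (`[0, 1] `*` `[- pi, pi] : set (R * R)).
  by apply: compact_setX; exact: segment_compact.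
have [||c cin Hc] := compact_EVT_min _ cK (f := fun a : R * R => Phi (polar a.1 a.2)).
- by exists (0, 0); split; rewrite /= in_itv /= ?lexx ?ler01 // lerNl oppr0 pi_ge0.
- apply: continuous_subspaceT => a.
  apply: (@continuous_comp _ _ _ (fun a => polar a.1 a.2) Phi); first exact: continuous_polar.
  exact: cP.
have Pge0 b : 0 <= Num.max 0 (e - cabs (1 - b) `^ p) by rewrite le_max lexx.
set d := Phi (polar c.1 c.2) in Hc.
have d0 : 0 < d.
  have c1 : cabs (polar c.1 c.2 : C) <= 1.
    move/set_mem: cin => [H _]; move: H; rewrite cabs_polar /= in_itv /= => /andP[H1 H2].
    by rewrite ger0_norm.
  rewrite /d /Phi; have [->|cn1] := eqVneq (polar c.1 c.2 : C) 1.
    apply: ltr_wpDl; first by apply: gap_ge0; exact: ltW.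
    by rewrite subrr cabs0 powR0 ?gt_eqF // subr0 lt_max e0 orbT.
  by apply: ltr_pwDl => //; exact: gap1_gt0.
exists (2 `^ p / d); first by rewrite divr_ge0 ?powR_ge0 // ltW.
move=> b b1; have g0 : 0 <= gap p 1 b by apply: gap_ge0; exact: ltW.
have K0 : 0 <= 2 `^ p / d by rewrite divr_ge0 ?powR_ge0 // ltW.
have [H|H] := leP (cabs (1 - b) `^ p) e; first by rewrite (le_trans H) // lerDl mulr_ge0.
have : d <= Phi b.
  have [th thpi Eb] := polar_arg b.
  have := Hc (cabs b, th); rewrite /= -Eb; apply; rewrite inE; split; rewrite /= in_itv //=.
  by rewrite cabs_ge0.
have -> : Phi b = gap p 1 b.
  by rewrite /Phi (max_idPl _) ?addr0 // subr_le0 ltW.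
move=> dg; apply: le_trans (_ : 2 `^ p <= _).
  apply: ge0_ler_powR; rewrite ?nnegrE ?cabs_ge0 ?(ltW p0) //.
  by apply: le_trans (cabsB _ _) _; rewrite cabs1; lra.
apply: le_trans (_ : 2 `^ p / d * d <= _); first by rewrite divfK ?gt_eqF.
by apply: le_trans (ler_wpM2l K0 dg) _; rewrite lerDr ltW.
Qed.

(** Both sides are symmetric and homogeneous of degree [p], so dividing by the number of larger
    modulus reduces to [uniform_gap1]. *)
Lemma uniform_convexity p e : 1 < p -> 0 < e -> exists2 K, 0 <= K &
  forall a b : C, cabs (a - b) `^ p <= e * (cabs a `^ p + cabs b `^ p) + K * gap p a b.
Proof.
move=> p1 e0; have p0 : 0 < p by exact: lt_trans p1.
have [K K0 HK] := uniform_gap1 p1 e0; exists K => // a b.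
wlog ba : a b / cabs b <= cabs a.
  move=> H; have [/H//|/ltW/H] := leP (cabs b) (cabs a).
  by rewrite cabsBC (addrC (cabs b `^ p)) (addrC b).
have [a0|a0] := eqVneq a 0.
  have -> : b = 0 by apply/eqP; rewrite -cabs_eq0 eq_le cabs_ge0 andbT (le_trans ba) // a0 cabs0.
  by rewrite a0 subrr addr0 mul0r !cabs0 powR0 ?gt_eqF // !addr0 mulr0 mul0r subrr mulr0 addr0.
have ca0 : 0 < cabs a by rewrite cabs_gt0.
have b1 : cabs (b / a) <= 1 by rewrite cabsM cabsV ler_pdivrMr // mul1r.
have := HK _ b1; have ap : 0 < cabs a `^ p by exact: powR_gt0.
move=> /(ler_wpM2l (ltW ap)); rewrite -powRM ?cabs_ge0 // -cabsM.
have -> : a * (1 - b / a) = a - b by field.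
move/le_trans; apply; rewrite mulrDr cabs1 powR1.
have E1 : cabs a `^ p * cabs (b / a) `^ p = cabs b `^ p.
  rewrite -powRM ?cabs_ge0 // -cabsM; congr (cabs _ `^ p); by field.
have E2 : cabs a `^ p * cabs ((1 + b / a) / 2) `^ p = cabs ((a + b) / 2) `^ p.
  rewrite -powRM ?cabs_ge0 // -cabsM; congr (cabs _ `^ p); by field.
have E3 : cabs a `^ p * (K * ((1 + cabs (b / a) `^ p) / 2 - cabs ((1 + b / a) / 2) `^ p)) =
    K * ((cabs a `^ p + cabs b `^ p) / 2 - cabs ((a + b) / 2) `^ p).
  by rewrite -E1 -E2; ring.
rewrite E3 lerD2r mulrC ler_pM2l // lerDl; exact: powR_ge0.
Qed.

End UniformConvexity.

(** * Convergence of dilates, and functionals vanishing on polynomials *)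

Section Density.
Variable R : realType.
Local Notation C := R[i].
Local Notation cabs := (@ComplexField.Normc.normc R).
Implicit Types (f g psi : C -> C) (p r s t : R) (L : (C -> C) -> C).

Lemma rmean_continuous_param (G : R -> R -> R) s0 :
  (\forall s \near s0, continuous (G s)) ->
  (forall t, {for (s0, t), continuous (fun a : R * R => G a.1 a.2)}) ->
  (fun s => rmean (G s)) @ s0 --> rmean (G s0).
Proof.
move=> cG jG; apply: rmean_cvg => // [|t e e0]; first exact: nbhs_singleton cG.
have e2 : 0 < e / 2 by rewrite divr_gt0.
have /cvgrPdist_lt/(_ _ e2)[[A B] /= [As Bt] AB] := jG t.
exists (B, A) => // -[t' s] /= [Bt' As'].
have /= H1 := AB (s, t') (conj As' Bt').
have /= H2 := AB (s0, t') (conj (nbhs_singleton As) Bt').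
set u := G s t' in H1 *; set v := G s0 t' in H2 *; set w := G s0 t in H1 H2.
rewrite -(subrKA w) [e]splitr; apply: le_lt_trans (ler_normD _ _) _.
by rewrite ltrD // distrC.
Qed.

Lemma half_above t : t < 1 -> t < (1 + t) / 2 /\ (1 + t) / 2 < 1.
Proof. by move=> t1; split; lra. Qed.

(** The numerical end of [dilate_cvg]: [x], [y] and [d] stand for the means of the dilate, of [f]
    and of their midpoint. *)
Lemma dilate_arith (e' K N eta x y d E : R) : 0 < e' -> 0 <= K -> 0 <= N -> 0 < eta ->
  x <= N -> y <= N -> N - 2 * eta <= d ->
  e' * (4 * (N + 1)) = E -> eta * (4 * (K + 1)) = E ->
  (e' + K / 2) * (x + y) + (- K) * d <= E.
Proof.
move=> e0 K0 N0 eta0 xN yN dN E1 E2.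
have F1 : (e' + K / 2) * (x + y) <= (e' + K / 2) * (2 * N).
  by apply: ler_wpM2l; lra.
have F2 : K * (N - 2 * eta) <= K * d by rewrite ler_wpM2l.
have F3 : 0 <= e' * N by rewrite mulr_ge0 // ltW.
have F4 : 0 <= K * eta by rewrite mulr_ge0 // ltW.
lra.
Qed.

Lemma cvg_from_left (phi : R -> R) eta : {for 1, continuous phi} -> 0 < eta ->
  exists t, [/\ 0 <= t, t < 1 & phi 1 - eta < phi t].
Proof.
move=> /cvgrPdist_lt cphi e0; have [d /= d0 Hd] := cphi _ e0.
pose x := Num.min (1 / 2) (d / 2) : R.
have x0 : 0 < x by rewrite lt_min !divr_gt0.
have x1 : x <= 1 / 2 by rewrite ge_min lexx.
have xd : x <= d / 2 by rewrite ge_min lexx orbT.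
exists (1 - x); split; [lra|lra|].
have xd' : x < d by lra.
have := Hd (1 - x); rewrite /= subKr gtr0_norm // => /(_ xd').
by rewrite ltr_norml => /andP[_]; lra.
Qed.

Lemma dilate_polar t r x : ((t%:C)%C * polar r x = polar (t * r) x :> C).
Proof. by rewrite /polar mulcE !mul0r subr0 addr0 !mulrA. Qed.

(** The norm of [f] is almost attained on one circle of radius [r0], and by continuity in [t] the
    midpoint of [f] and its dilate has almost the same mean there. Means grow with the radius, so
    the lower bound persists on larger circles, and uniform convexity then forces the dilate close
    to [f]. *)
Lemma dilate_cvg p f e : 1 < p -> hardy p f -> 0 < e ->
  exists t, [/\ 0 <= t < 1, hardy p (fun w => f ((t%:C)%C * w) - f w) &
    hnorm p (fun w => f ((t%:C)%C * w) - f w) <= e].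
Proof.
move=> p1 hf e0; have df := hardy_diff hf; have p0 : 0 < p by exact: lt_trans p1.
have ep : 0 < e `^ p by exact: powR_gt0.
set N := hnorm p f `^ p; have N0 : 0 <= N by exact: powR_ge0.
have N1 : 0 < 4 * (N + 1) by rewrite mulr_gt0 // ltr_wpDl.
have [K K0 HK] := uniform_convexity p1 (divr_gt0 ep N1).
have K1 : 0 < 4 * (K + 1) by rewrite mulr_gt0 // ltr_wpDl.
(* The terms coming from [eta] and from the constant given to [uniform_convexity] each take half of
   [e ^ p]. *)
set eta := e `^ p / (4 * (K + 1)); have eta0 : 0 < eta by rewrite divr_gt0.
have [r0 r01 Hr0] := hnorm_approx p0 hf eta0; rewrite -/N in Hr0.
have /andP[r00 r0lt] := r01.
pose D t w := (f ((t%:C)%C * w) + f w) / 2.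
have dil t w : 0 <= t <= 1 -> cabs w < 1 -> cabs ((t%:C)%C * w) < 1.
  move=> /andP[t0 t1] w1; rewrite cabsM cabs_real ger0_norm //.
  by apply: le_lt_trans w1; rewrite ler_piMl ?cabs_ge0.
have dft t : 0 <= t <= 1 -> diff_disc (fun w => f ((t%:C)%C * w)).
  move=> t01 w w1; apply: (@cdiff_comp _ (fun w => (t%:C)%C * w) f).
    by apply: cdiffM; [exact: cdiff_cst|exact: cdiff_id].
  by apply: df; exact: dil.
have dD t : 0 <= t <= 1 -> diff_disc (D t).
  move=> t01 w w1; apply: cdiffM; last exact: cdiff_cst.
  exact: (diff_discD (dft t t01) df).
pose G t x := cabs ((f (polar (t * r0) x) + f (polar r0 x)) / 2) `^ p.
have GE t : rmean (G t) = pM p (D t) r0.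
  by congr rmean; apply/funext => x; rewrite /G /D dilate_polar.
have near_small : \forall t \near (1 : R), `|t * r0| < 1.
  have : {for 1, continuous (fun t : R => `|t * r0|)}.
    apply: (@continuous_comp _ _ _ (fun t : R => t * r0) Num.norm); last exact: norm_continuous.
    by apply: cvgM; [exact: cvg_id|exact: cvg_cst].
  move/cvgr_lt; apply; by rewrite mul1r ger0_norm.
have cfr t : `|t * r0| < 1 -> continuous (fun x => f (polar (t * r0) x)).
  move=> H; apply: continuous_circle => w wt; apply: cdiff_cont; apply: df.
  by rewrite wt.
have cfr0 := continuous_on_circle df r01.
have cvgG : (fun t => rmean (G t)) @ (1 : R) --> rmean (G 1).
  apply: rmean_continuous_param.
    apply: filterS near_small => t Ht.
    have c1 := ccontinuousM (ccontinuousD (cfr t Ht) cfr0) (@ccontinuous_cst R R (2^-1)).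
    move=> x; apply: (@continuous_comp _ _ _
      (fun x => (f (polar (t * r0) x) + f (polar r0 x)) / 2) (fun z : C => cabs z `^ p)).
      exact: c1.
    exact: continuous_cabs_powR.
  move=> x; apply: (@continuous_comp _ _ _
      (fun a : R * R => (f (polar (a.1 * r0) a.2) + f (polar r0 a.2)) / 2) (fun z : C => cabs z `^ p));
    last exact: continuous_cabs_powR.
  have cf0 : {for polar r0 x, continuous f}.
    by apply: cdiff_cont; apply: df; rewrite cabs_polar ger0_norm.
  have c2 : {for (1, x), continuous (fun a : R * R => f (polar (a.1 * r0) a.2))}.
    apply: (@continuous_comp _ _ _ (fun a : R * R => polar (a.1 * r0) a.2 : C) f); last first.
      by rewrite /= mul1r.
    rewrite (_ : (fun a : R * R => polar (a.1 * r0) a.2 : C) =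
      (fun a : R * R => (r0%:C)%C * polar a.1 a.2)); last first.
      by apply/funext => a; rewrite dilate_polar mulrC.
    by apply: cvgM; [exact: cvg_cst|exact: continuous_polar].
  have c3 : {for (1, x), continuous (fun a : R * R => f (polar r0 a.2))}.
    apply: (@continuous_comp _ _ _ snd (fun y => f (polar r0 y))); first exact: cvg_snd.
    exact: cfr0.
  by apply: cvgM; [apply: cvgD; [exact: c2|exact: c3]|exact: cvg_cst].
have G1 : rmean (G 1) = pM p f r0.
  congr rmean; apply/funext => x; rewrite /G mul1r; congr (cabs _ `^ p).
  by field.
have [t [t0 t1 Ht]] : exists t, [/\ 0 <= t, t < 1 & pM p f r0 - eta < pM p (D t) r0].
  have [t [t0 t1]] := cvg_from_left cvgG eta0; rewrite G1 GE => Ht; by exists t.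
have t01 : 0 <= t <= 1 by rewrite t0 ltW.
have dBt : diff_disc (fun w => f ((t%:C)%C * w) - f w).
  by move=> w w1; apply: cdiffB; [exact: dft|exact: df].
suff [H1 H2] : hardy p (fun w => f ((t%:C)%C * w) - f w) /\
    hnorm p (fun w => f ((t%:C)%C * w) - f w) <= e.
  by exists t; split; [apply/andP|exact: H1|exact: H2].
apply: (hnorm_le p0 (ltW e0) dBt) => r r1.
wlog rr0 : r r1 / r0 <= r.
  move=> H; have [H1|H1] := leP r0 r; first exact: H.
  have /andP[rr _] := r1.
  by apply: le_trans (pM_mono (ltW p1) dBt rr (ltW H1) r0lt) _; exact: H.
have /andP[rge0 rlt1] := r1.
have B1 : pM p f r <= N by exact: pM_le_hnorm.
have trt : 0 <= t * r < 1.
  apply/andP; split; first exact: mulr_ge0.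
  exact: le_lt_trans (ler_piMl rge0 (ltW t1)) rlt1.
have B2 : pM p (fun w => f ((t%:C)%C * w)) r <= N.
  have <- : pM p f (t * r) = pM p (fun w => f ((t%:C)%C * w)) r.
    by congr rmean; apply/funext => x; rewrite dilate_polar.
  exact: pM_le_hnorm.
have B3 : N - 2 * eta <= pM p (D t) r.
  apply: le_trans _ (pM_mono (ltW p1) (dD t t01) r00 rr0 rlt1).
  rewrite mulr_natl mulr2n opprD addrA; apply: ltW; apply: lt_trans Ht.
  by rewrite ltrD2r.
have cA := continuous_pM p0 (dft t t01) r1.
have cB := continuous_pM p0 df r1.
have cD := continuous_pM p0 (dD t t01) r1.
have cAB : continuous (fun x => cabs (f ((t%:C)%C * polar r x)) `^ p + cabs (f (polar r x)) `^ p).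
  by move=> x; apply: cvgD; [exact: cA|exact: cB].
set e' := e `^ p / _ in HK.
have cS : continuous (fun x => (e' + K / 2) * (cabs (f ((t%:C)%C * polar r x)) `^ p + cabs (f (polar r x)) `^ p)
    + (- K) * cabs (D t (polar r x)) `^ p).
  by move=> x; apply: cvgD; [exact: (continuousMl (k := e' + K / 2) cAB)|exact: (continuousMl (k := - K) cD)].
apply: le_trans (le_rmean (continuous_pM p0 dBt r1) cS _) _ => [x|].
  apply: le_trans (HK _ _) _; rewrite /D le_eqVlt; apply/orP; left; apply/eqP; ring.
rewrite (rmeanD (continuousMl (k := e' + K / 2) cAB) (continuousMl (k := - K) cD)).
rewrite (rmeanZ _ cAB) (rmeanZ _ cD) (rmeanD cA cB).
rewrite -/(pM p (fun w => f ((t%:C)%C * w)) r) -/(pM p f r) -/(pM p (D t) r).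
have e'0 : 0 < e' by rewrite divr_gt0.
have E1 : e' * (4 * (N + 1)) = e `^ p by rewrite /e' divfK // gt_eqF.
have E2 : eta * (4 * (K + 1)) = e `^ p by rewrite /eta divfK // gt_eqF.
exact (dilate_arith e'0 K0 N0 eta0 B2 B1 B3 E1 E2).
Qed.

Lemma hdual_hnorm0 p L f : hdual p L -> hardy p f -> hnorm p f = 0 -> L f = 0.
Proof.
move=> [_ [_ [K HK]]] hf f0; have := HK f hf; rewrite f0 mulr0 => H.
by apply/eqP; rewrite -cabs_eq0 eq_le H cabs_ge0.
Qed.

Lemma hdualB p L f g : 0 < p -> hdual p L -> hardy p f -> hardy p g ->
  L (fun w => f w - g w) = L f - L g.
Proof.
move=> p0 [LD [LZ _]] hf hg; have [hNg _] := hardyZ (-1) p0 hg.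
have -> : (fun w => f w - g w) = (fun w => f w + (-1) * g w).
  by apply/funext => w; rewrite mulN1r.
by rewrite LD // LZ // mulN1r.
Qed.

Lemma hardyB p f g : 0 < p -> hardy p f -> hardy p g -> hardy p (fun w => f w - g w).
Proof.
move=> p0 hf hg; have [hNg _] := hardyZ (-1) p0 hg.
have -> : (fun w => f w - g w) = (fun w => f w + (-1) * g w).
  by apply/funext => w; rewrite mulN1r.
exact: hardyD.
Qed.

(** A functional sees functions on all of [R[i]], yet their values off the disc do not affect the
    norm, hence not [L]. *)
Lemma hdual_ext p L f g : 0 < p -> hdual p L -> hardy p f ->
  (forall w, cabs w < 1 -> f w = g w) -> L f = L g.
Proof.
move=> p0 hL hf fg; have hg := hardy_ext p0 fg hf.
apply/eqP; rewrite -subr_eq0 -(hdualB p0 hL hf hg); apply/eqP.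
have [h0 n0] := @hnorm_eq0 R p (fun w => f w - g w) p0 (fun w w1 => eq_ind_r (fun x => x - g w = 0) (subrr _) (fg w w1)).
exact: hdual_hnorm0 hL h0 n0.
Qed.

Section DualZero.
Variables (p : R) (L : (C -> C) -> C) (sigma sigmai : C -> C).
Hypotheses (p1 : 1 < p) (hL : hdual p L).
Hypotheses (dsigma : diff_disc sigma) (sigma1 : forall w, cabs w < 1 -> cabs (sigma w) < 1).
Hypotheses (dsigmai : diff_disc sigmai) (sigmai1 : forall w, cabs w < 1 -> cabs (sigmai w) < 1).
Hypothesis sigmaK : forall w, cabs w < 1 -> sigmai (sigma w) = w.

Let p0 : 0 < p. Proof. exact: lt_trans p1. Qed.

Lemma hardy_sigma_pow n m : hardy p (fun w => sigma w ^+ n * (1 - sigma w) ^+ m).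
Proof.
have d1 : diff_disc (fun w => 1 - sigma w).
  by move=> w w1; apply: cdiffB; [exact: cdiff_cst|exact: dsigma].
have dd := diff_discM (diff_discX n dsigma) (diff_discX m d1).
suff H w : cabs w < 1 -> cabs (sigma w ^+ n * (1 - sigma w) ^+ m) <= 2 ^+ m.
  by have [] := hnorm_bounded p0 (exprn_ge0 m (ler0n R 2)) dd H.
move=> w1; rewrite cabsM !cabsX -[leRHS]mul1r; have s1 := ltW (sigma1 w1).
apply: ler_pM; rewrite ?exprn_ge0 ?cabs_ge0 //; first by rewrite exprn_ile1 ?cabs_ge0.
apply: lerXn2r; rewrite ?nnegrE ?cabs_ge0 //.
by apply: le_trans (cabsB _ _) _; rewrite cabs1; lra.
Qed.

(** The factor [sigma = 1 - (1 - sigma)] trades a power of [sigma] for two terms with one power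
    less, so induction on [n] avoids a binomial expansion. *)
Lemma dual_sigma_pow : (forall n, L (fun w => (1 - sigma w) ^+ n) = 0) ->
  forall n m, L (fun w => sigma w ^+ n * (1 - sigma w) ^+ m) = 0.
Proof.
move=> L0; elim=> [|n IH] m.
  rewrite -[RHS](L0 m); congr L; apply/funext => w; by rewrite expr0 mul1r.
have -> : (fun w => sigma w ^+ n.+1 * (1 - sigma w) ^+ m) =
    (fun w => sigma w ^+ n * (1 - sigma w) ^+ m - sigma w ^+ n * (1 - sigma w) ^+ m.+1).
  by apply/funext => w; rewrite !exprS; ring.
by rewrite (hdualB p0 hL (hardy_sigma_pow n m) (hardy_sigma_pow n m.+1)) !IH subrr.
Qed.

Lemma dual_sigma_poly (a : nat -> C) : (forall n, L (fun w => (1 - sigma w) ^+ n) = 0) ->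
  forall n, hardy p (fun w => \sum_(k < n) a k * sigma w ^+ k) /\
            L (fun w => \sum_(k < n) a k * sigma w ^+ k) = 0.
Proof.
move=> L0; have Lp n : L (fun w => sigma w ^+ n) = 0.
  rewrite -[RHS](dual_sigma_pow L0 n 0); congr L; apply/funext => w; by rewrite mulr1.
have hp n : hardy p (fun w => sigma w ^+ n).
  have := hardy_sigma_pow n 0; congr hardy; apply/funext => w; by rewrite mulr1.
elim=> [|n [hI LI]].
  have E : (fun w => \sum_(k < 0) a k * sigma w ^+ k) = (fun=> 0).
    by apply/funext => w; rewrite big_ord0.
  rewrite E; have [h0 n0] := @hnorm_eq0 R p (fun=> 0) p0 (fun _ _ => erefl).
  by split => //; exact: hdual_hnorm0 hL h0 n0.
have -> : (fun w => \sum_(k < n.+1) a k * sigma w ^+ k) =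
   (fun w => \sum_(k < n) a k * sigma w ^+ k + a n * sigma w ^+ n).
  by apply/funext => w; rewrite big_ord_recr.
have [hZ _] := hardyZ (a n) p0 (hp n); split; first exact: hardyD.
case: (hL) => LD [LZ _]; rewrite (LD _ _ hI hZ) LI (LZ _ _ (hp n)) Lp mulr0 addr0 //.
Qed.

(** Put [g = f o sigmai]. A dilate of [g] is close to [g] in norm, and, being holomorphic on a
    larger disc, uniformly close to a Taylor polynomial. Composition with [sigma] returns to [f] at
    the cost of Littlewood's constant [A], and [L] kills polynomials in [sigma]. *)
Lemma dual_zero : (forall n, L (fun w => (1 - sigma w) ^+ n) = 0) ->
  forall f, hardy p f -> L f = 0.
Proof.
move=> L0 f hf; have p1' := ltW p1.
have [hg _] := littlewood p1' hf dsigmai sigmai1; set g := fun w => _ in hg.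
set A := (4 / (1 - cabs (sigma 0))) `^ p^-1.
have A0 : 0 <= A by exact: powR_ge0.
have [_ [_ [K0 HK0]]] := hL; pose K := Num.max K0 0.
have K0' : 0 <= K by rewrite le_max lexx orbT.
have HK h : hardy p h -> cabs (L h) <= K * hnorm p h.
  by move=> hh; apply: le_trans (HK0 h hh) _; rewrite ler_wpM2r ?hnorm_ge0 // le_max lexx.
suff H e : 0 < e -> cabs (L f) <= (K * (A + 1)) * e.
  have KA : 0 < K * (A + 1) + 1 by rewrite ltr_wpDl ?mulr_ge0 ?addr_ge0.
  apply/eqP; rewrite -cabs_eq0 eq_le cabs_ge0 andbT.
  apply/ler_addgt0Pr => e e0; rewrite add0r.
  apply: le_trans (H _ (divr_gt0 e0 KA)) _.
  rewrite mulrCA ger_pMr // ler_pdivrMr // mul1r lerDl ler01 //.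
move=> e0; have [t [/andP[t0 t1] hd Hd]] := dilate_cvg p1 hg e0.
have [hd2 Hd2] := littlewood p1' hd dsigma sigma1.
(* Taylor expansion on a circle of radius above [t] makes the remainder ratio [t / r] less than [1]
   on the whole dilated disc. *)
pose r := (1 + t) / 2; have [tr r1] : t < r /\ r < 1 := half_above t1.
have r0 : 0 < r by exact: le_lt_trans tr.
have [a [M [M0 HM]]] := taylor_disc (hardy_diff hg) (introT andP (conj r0 r1)).
pose B := M * (r / (r - t)).
have B0 : 0 <= B by rewrite mulr_ge0 // divr_ge0 ?(ltW r0) // subr_ge0 ltW.
have [n Hn] : exists n, B * (t / r) ^+ n < e.
  have cv : (fun n => B * (t / r) ^+ n) @ \oo --> B * 0.
    apply: cvgM; first exact: cvg_cst.
    have tr0 : 0 <= t / r by rewrite divr_ge0 ?(ltW r0).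
    by apply: cvg_expr; rewrite (ger0_norm tr0) ltr_pdivrMr // mul1r.
  move: cv; rewrite mulr0 => /cvgr_lt/(_ e e0)[n _ /(_ n (leqnn n)) Hn]; by exists n.
(* The powers of [t] turn the Taylor polynomial at [t * sigma w] into a polynomial in [sigma w]. *)
have [hQ LQ] := dual_sigma_poly (fun k => a k * (t%:C)%C ^+ k) L0 n.
set Q := (fun w => \sum_(k < n) _) in hQ LQ.
pose gt w := g ((t%:C)%C * sigma w).
have hgt : hardy p gt.
  have := hardyD p0 hd2 hf; apply: hardy_ext => // w w1.
  by rewrite /gt /g sigmaK // subrK.
have bQ w : cabs w < 1 -> cabs (gt w - Q w) <= e.
  move=> w1; set z := (t%:C)%C * sigma w.
  have zt : cabs z <= t.
    by rewrite cabsM cabs_real ger0_norm // ler_piMr // ltW // sigma1.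
  have zr := le_lt_trans zt tr.
  have -> : Q w = \sum_(k < n) a k * z ^+ k.
    by apply: eq_bigr => k _; rewrite /z exprMn mulrA.
  apply: le_trans (HM n z zr) _; apply: le_trans (ltW Hn).
  have z0 : 0 <= cabs z / r by rewrite divr_ge0 ?cabs_ge0 ?(ltW r0).
  have zr0 : 0 < r - cabs z by rewrite subr_gt0.
  rewrite /B [leRHS]mulrAC; apply: ler_pM.
  - by rewrite mulr_ge0 // exprn_ge0.
  - by rewrite divr_ge0 // ltW.
  - rewrite ler_wpM2l //; apply: lerXn2r; rewrite ?nnegrE //; first by rewrite divr_ge0 ?(ltW r0).
    by rewrite ler_pM2r ?invr_gt0.
  - by rewrite ler_pM2l // lef_pV2 ?posrE ?subr_gt0 //; exact: lerB.
have [hgQ HgQ] := hnorm_bounded p0 (ltW e0) (hardy_diff (hardyB p0 hgt hQ)) bQ.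
have E1 : L gt - L f = L (fun w => g ((t%:C)%C * sigma w) - g (sigma w)).
  rewrite -(hdualB p0 hL hgt hf); symmetry; apply: (hdual_ext p0 hL hd2) => w w1.
  by rewrite /gt /g sigmaK.
have E2 : L gt = L (fun w => gt w - Q w).
  by rewrite (hdualB p0 hL hgt hQ) LQ subr0.
have -> : L f = L (fun w => gt w - Q w) - L (fun w => g ((t%:C)%C * sigma w) - g (sigma w)).
  by rewrite -E1 -E2; ring.
apply: le_trans (cabsB _ _) _.
have H1 := le_trans (HK _ hgQ) (ler_wpM2l K0' HgQ).
have H2 := le_trans (HK _ hd2) (ler_wpM2l K0' (le_trans Hd2 (ler_wpM2l A0 Hd))).
rewrite mulrDr mulrDl mulr1 addrC -[K * A * e]mulrA; exact: lerD.
Qed.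

End DualZero.
End Density.

(** * Eigenfunctions *)

Section ComplexLogarithm.
Variable R : realType.
Local Notation C := R[i].
Local Notation cabs := (@ComplexField.Normc.normc R).
Local Notation re := (@complex.Re R).
Local Notation im := (@complex.Im R).

(** The principal logarithm on the right half-plane, where the argument is the arctangent of the
    slope. *)
Definition clog (u : C) : C := Complex (ln (cabs u)) (atan (im u / re u)).

Lemma clogK (u : C) : 0 < re u -> cexp (clog u) = u.
Proof.
case: u => x y /= x0; set u := Complex x y.
have u0 : 0 < cabs u.
  by rewrite cabs_gt0 eq_complex /= negb_and gt_eqF.
change (polar (expR (ln (cabs u))) (atan (y / x)) = u).
rewrite lnK ?posrE // /polar.
have s0 : 0 < 1 + (y / x) ^+ 2 by rewrite ltr_pwDl // sqr_ge0.
have ss : 0 < Num.sqrt (1 + (y / x) ^+ 2) by rewrite sqrtr_gt0.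
have E2 : cabs u ^+ 2 = x ^+ 2 + y ^+ 2 by rewrite cabs_sqr.
have E : cabs u = x * Num.sqrt (1 + (y / x) ^+ 2).
  apply/eqP; rewrite -(@eqrXn2 _ 2) ?mulr_ge0 ?cabs_ge0 ?(ltW x0) ?(ltW ss) //.
  rewrite E2 exprMn sqr_sqrtr ?(ltW s0) //; apply/eqP; field.
  exact: lt0r_neq0.
have cn0 : cos (atan (y / x)) != 0 by rewrite cos_atan invr_eq0 gt_eqF.
have Es : sin (atan (y / x)) = y / x * cos (atan (y / x)).
  by rewrite -{2}(atanK (y / x)) /tan divfK.
rewrite Es cos_atan E; congr Complex.
  by rewrite mulfK // gt_eqF.
rewrite mulrCA mulfK ?gt_eqF // divfK // gt_eqF //.
Qed.

Lemma im_clog_le (u : C) : `|im (clog u)| <= pi / 2.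
Proof.
rewrite /= ler_norml; have := atan_gtNpi2 (im u / re u); have := atan_ltpi2 (im u / re u).
by move=> H1 H2; rewrite !ltW.
Qed.

Lemma clogM_real (r : R) (u : C) : 0 < r -> 0 < re u ->
  clog ((r%:C)%C * u) = ((ln r)%:C)%C + clog u.
Proof.
move=> r0 u0; have c0 : 0 < cabs u by rewrite cabs_gt0; apply: contraTneq u0 => ->; rewrite ltxx.
rewrite /clog cabsM cabs_real gtr0_norm // lnM ?posrE // addcE; congr Complex.
rewrite add0r; congr atan; move: u0; case: (u) => x y /= x0.
rewrite !mul0r subr0 addr0; field; by rewrite !gt_eqF.
Qed.

Lemma clog_continuous (u : C) : 0 < re u -> {for u, continuous clog}.
Proof.
move=> u0; have c0 : 0 < cabs u by rewrite cabs_gt0; apply: contraTneq u0 => ->; rewrite ltxx.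
apply: continuous_Complex.
  apply: (@continuous_comp _ _ _ cabs (@ln R)); first exact: continuous_cabs.
  exact: continuous_ln.
apply: (@continuous_comp _ _ _ (fun u => im u / re u) (@atan R)); last exact: continuous_atan.
apply: continuousM; first exact: continuous_Im.
by apply: continuousV; [rewrite gt_eqF|exact: continuous_Re].
Qed.

(** The inverse function argument: the increment [D] of the logarithm satisfies
    [h = u * (cexp D - 1) = u * (D + Q)] with [Q] quadratic in [D], so the error is
    [- Q / (D + Q) / u]. *)
Lemma clog_differentiable (u : C) : 0 < re u -> differentiable clog u.
Proof.
move=> u0; have un0 : u != 0 by apply: contraTneq u0 => ->; rewrite ltxx.
have cu0 : 0 < cabs u by rewrite cabs_gt0.
apply/differentiable_cabsP; exists u^-1 => e e0.
pose k := 3 * expR 1 : R; have k0 : 0 < k by rewrite mulr_gt0 // expR_gt0.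
(* In turn: [cabs D < 1] bounds the exponential in the Taylor error, the second bound gives
   [cabs Q <= cabs D / 2], and the third makes the final error less than [e]. *)
pose m := Num.min 1 (Num.min ((2 * k)^-1) (e * cabs u / (4 * k))).
have m0 : 0 < m by rewrite !lt_min ltr01 invr_gt0 mulr_gt0 //= divr_gt0 // mulr_gt0.
have /cvg_cabsP/(_ m m0)/nbhs_cabsP[d d0 Hd] := clog_continuous u0.
exists (Num.min d (re u)); first by rewrite lt_min d0.
move=> h h0; rewrite lt_min => /andP[hd hu].
have uh0 : 0 < re (u + h).
  have := normRe_cabs h; rewrite ler_norml => /andP[H _].
  have -> : re (u + h) = re u + re h by case: (u) (h) => ? ? [].
  by rewrite -ltrBlDl sub0r (lt_le_trans _ H) // ltrN2.
have := Hd (u + h); rewrite addrAC subrr add0r => /(_ hd).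
set D := clog (u + h) - clog u => Dm.
have hE : h = u * (cexp D - 1).
  by rewrite /D cexpB !clogK //; field.
have D0 : D != 0.
  by apply: contra_neq h0 => D0; rewrite hE D0 cexp0 subrr mulr0.
have cD0 : 0 < cabs D by rewrite cabs_gt0.
have [D1 [D2 D3]] : cabs D < 1 /\ cabs D < (2 * k)^-1 /\ cabs D < e * cabs u / (4 * k).
  by move: Dm; rewrite !lt_min => /andP[? /andP[? ?]].
pose Q := cexp D - 1 - D.
have HQ : cabs Q <= k * cabs D * cabs D.
  apply: le_trans (cexp_taylor1 D) _.
  have -> : k * cabs D * cabs D = 3 * cabs D ^+ 2 * expR 1 by rewrite /k expr2; ring.
  apply: ler_wpM2l; first by rewrite mulr_ge0 // sqr_ge0.
  by rewrite ler_expR; exact: ltW.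
have kD : k * cabs D < 1 / 2.
  have := D2; rewrite -(ltr_pM2l k0) invfM mulrCA mulrV ?unitfE ?gt_eqF // mulr1 mul1r //.
have DQ : cabs D / 2 <= cabs (D + Q).
  apply: le_trans (cabs_lbD _ _).
  have : k * cabs D * cabs D <= 1 / 2 * cabs D by rewrite ler_pM2r // ltW.
  by move: HQ; clear; lra.
have DQ0 : 0 < cabs (D + Q) by rewrite (lt_le_trans _ DQ) // divr_gt0.
have DQn0 : D + Q != 0 by rewrite -cabs_gt0.
have -> : D / h - u^-1 = - (Q / (D + Q)) / u.
  have -> : h = u * (D + Q) by rewrite hE /Q; congr (_ * _); ring.
  by clearbody Q D; field; rewrite un0 DQn0.
rewrite cabsM cabsN cabsM !cabsV ltr_pdivrMr // ltr_pdivrMr //.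
apply: le_lt_trans HQ _; apply: lt_le_trans (ler_wpM2l _ DQ); last by rewrite mulr_ge0 // ltW.
have k4 : 0 < 4 * k by rewrite mulr_gt0.
have H0 : 0 < k * cabs D * cabs D by rewrite !mulr_gt0.
move: D3; rewrite ltr_pdivlMr // => D3.
have H1 : cabs D * (4 * k) * cabs D < e * cabs u * cabs D by rewrite ltr_pM2r.
by move: H1 H0; clear; lra.
Qed.

End ComplexLogarithm.

(** * Complex powers of a function with positive real part *)

Section Eigenfunctions.
Variable R : realType.
Local Notation C := R[i].
Local Notation cabs := (@ComplexField.Normc.normc R).
Local Notation re := (@complex.Re R).
Local Notation im := (@complex.Im R).
Variable u : C -> C.
Hypothesis du : diff_disc u.
Hypothesis u0 : forall w, cabs w < 1 -> 0 < re (u w).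
Hypothesis u2 : forall w, cabs w < 1 -> cabs (u w) <= 2.
Implicit Types (l d : C) (p r e : R).

Definition ulog (w : C) : C := clog (u w).
Definition upow (l : C) (w : C) : C := cexp (l * ulog w).

Lemma diff_ulog : diff_disc ulog.
Proof.
move=> w w1; exact (cdiff_comp (du w1) (clog_differentiable (u0 w1))).
Qed.

Lemma diff_upow l : diff_disc (upow l).
Proof.
move=> w w1; apply: (@cdiff_comp _ (fun w => l * ulog w) (@cexp R)).
  by apply: cdiffM; [exact: cdiff_cst|exact: diff_ulog].
exact: differentiable_cexp.
Qed.

Lemma upowD l d w : upow (l + d) w = upow l w * cexp (d * ulog w).
Proof. by rewrite /upow mulrDl cexpD. Qed.

Lemma upow_nat n w : cabs w < 1 -> upow n%:R w = u w ^+ n.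
Proof.
move=> w1; elim: n => [|n IH]; first by rewrite /upow mul0r cexp0 expr0.
by rewrite -addn1 natrD upowD IH mul1r clogK ?u0 // addn1 exprSr.
Qed.

Lemma cabs_upow l w : cabs (upow l w) = expR (re l * ln (cabs (u w)) - im l * im (ulog w)).
Proof. by rewrite /upow cabs_cexp; case: l => x y. Qed.

Lemma ln_u_le w : cabs w < 1 -> ln (cabs (u w)) <= ln 2.
Proof.
move=> w1; have un0 : 0 < cabs (u w) by rewrite cabs_gt0; apply: contraTneq (u0 w1) => ->; rewrite ltxx.
by rewrite ler_ln ?posrE // u2.
Qed.

Lemma powR_root p (k x : R) : 0 < p -> 0 <= k -> 0 <= x ->
  (k * x `^ p^-1) `^ p = k `^ p * x.
Proof.
by move=> p0 k0 x0; rewrite powRM ?powR_ge0 // -powRrM mulVf ?gt_eqF // powRr1.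
Qed.

(* For [0 <= al < 1] the argument of [u ^ -al] stays away from [+-pi/2], so [|u| ^ -al] is
   dominated by the real part of a holomorphic function. *)
Lemma weighted_hnorm p al : 0 < p -> 0 <= al < 1 -> exists2 C0, 0 <= C0 &
  forall (g : C -> C) k, 0 <= k -> diff_disc g ->
    (forall w, cabs w < 1 -> cabs (g w) <= k * expR (- (al / p) * ln (cabs (u w)))) ->
    hardy p g /\ hnorm p g <= k * C0.
Proof.
move=> p0 /andP[al0 al1].
pose c : R := cos (al * (pi / 2)).
have pi20 : 0 < pi / 2 :> R by rewrite divr_gt0 ?pi_gt0.
have alpi : al * (pi / 2) < pi / 2 by rewrite gtr_pMl.
have alpi0 : 0 <= al * (pi / 2) by rewrite mulr_ge0 // ltW.
have c0 : 0 < c.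
  by apply: cos_gt0_pihalf; rewrite alpi andbT (lt_le_trans _ alpi0) // oppr_lt0.
pose q := upow ((- al)%:C)%C.
have q_lb w : cabs w < 1 -> c * expR (- al * ln (cabs (u w))) <= re (q w).
  move=> w1; have -> : re (q w) = expR (- al * ln (cabs (u w))) * cos (al * im (ulog w)).
    rewrite /q /upow.
    have -> : ((- al)%:C)%C * ulog w = Complex (- al * ln (cabs (u w))) (- (al * im (ulog w))).
      by rewrite /ulog /clog mulcE !mul0r subr0 addr0; congr Complex; rewrite mulNr.
    by rewrite /cexp /polar [LHS]/= cosN.
  rewrite mulrC ler_pM2l ?expR_gt0 //.
  have := im_clog_le (u w); rewrite -/(ulog w) => Hth.
  rewrite -[leRHS](_ : cos `|al * im (ulog w)| = _); last first.
    by case: (ger0P (al * im (ulog w))) => // _; rewrite cosN.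
  rewrite normrM (ger0_norm al0).
  have H1 : al * `|im (ulog w)| <= al * (pi / 2) by rewrite ler_wpM2l.
  have pip : pi / 2 <= pi :> R by rewrite ler_pdivrMr // mulr_natr mulr2n lerDl pi_ge0.
  have ge0 : 0 <= al * `|im (ulog w)| by rewrite mulr_ge0.
  have lepi : al * (pi / 2) <= pi := le_trans (ltW alpi) pip.
  move: H1; rewrite le_eqVlt => /predU1P[->//|H1]; apply: ltW.
  rewrite ltr_cos ?in_itv /= ?alpi0 ?lepi ?ge0 //.
  exact: le_trans (ltW H1) lepi.
have dq : diff_disc q := diff_upow _.
have q00 : 0 <= re (q 0).
  by apply: le_trans (q_lb 0 _); rewrite ?cabs0 // mulr_ge0 ?expR_ge0 // ltW.
exists ((re (q 0) / c) `^ p^-1); first exact: powR_ge0.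
move=> g k k0 dg Hg; apply: (hnorm_le p0 _ dg); first by rewrite mulr_ge0 ?powR_ge0.
move=> r r1; have /andP[r0 r1'] := r1.
have -> : (k * (re (q 0) / c) `^ p^-1) `^ p = k `^ p * (re (q 0) / c).
  by apply: powR_root => //; rewrite divr_ge0 // ltW.
have cq := continuousRe (continuous_on_circle dq r1).
(* The majorant is harmonic, so its mean is the same on every circle and the bound does not depend
   on [r]. *)
have Eq : re (q 0) = rmean (fun t => re (q (polar r t))).
  by rewrite -(mean_value dq r1).
rewrite Eq mulrCA mulrC -(rmeanZ _ cq).
apply: (le_rmean (continuous_pM p0 dg r1) (continuousMl (k := _) cq)) => t.
have w1 : cabs (polar r t) < 1 by rewrite cabs_polar ger0_norm.
rewrite mulrAC ler_pdivlMr //.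
apply: le_trans (_ : (k * expR (- (al / p) * ln (cabs (u (polar r t))))) `^ p * c <= _).
  rewrite ler_pM2r //; apply: ge0_ler_powR; rewrite ?nnegrE ?cabs_ge0 ?(ltW p0) //.
    by rewrite mulr_ge0 ?expR_ge0.
  exact: Hg.
rewrite powRM ?expR_ge0 // -expRM -mulrA ler_wpM2l ?powR_ge0 //.
have -> : - (al / p) * ln (cabs (u (polar r t))) * p = - al * ln (cabs (u (polar r t))).
  by field; exact: lt0r_neq0.
by rewrite mulrC; exact: q_lb.
Qed.

(** Here [X] is [ln |u|] and [th] the argument of [u]. Since [X <= ln 2], [|X|] is at most
    [- X + 2 * ln 2], so a small multiple of [|log u|] in the exponent costs only a constant and a
    slightly more negative power of [|u|]. *)
Lemma upow_exponent_le (rl il b e X th : R) (L : C) : 0 <= e -> 0 <= b -> 0 <= rl + b -> X <= ln 2 ->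
  `|th| <= 2 -> cabs L <= `|X| + `|th| ->
  rl * X - il * th + 2 * e * cabs L <=
  ((rl + b) * ln 2 + 2 * `|il| + 2 * e * (2 * ln 2 + 2)) + - (b + 2 * e) * X.
Proof.
move=> e0 b0 rb X2 th2 HL.
have l2 : 0 <= ln 2 :> R by rewrite ln_ge0 // ler1n.
have H1 : `|X| <= - X + 2 * ln 2.
  by rewrite ler_norml; apply/andP; split; lra.
have H2 : (rl + b) * X <= (rl + b) * ln 2 by rewrite ler_wpM2l.
have H3 : - (il * th) <= 2 * `|il|.
  apply: le_trans (ler_norm _) _; rewrite normrN normrM mulrC; exact: ler_wpM2r.
have H4 : e * cabs L <= e * (- X + 2 * ln 2 + 2).
  by rewrite ler_wpM2l // (le_trans HL) // lerD.
by move: H2 H3 H4; clear; lra.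
Qed.

(** The factor [expR (2 * e * cabs (ulog w))] absorbs the logarithms that appear when [u ^ l] is
    differentiated in [l]; the strict inequality [- p^-1 < re l] leaves room for it. *)
Lemma dominated_hnorm p l : 0 < p -> - p^-1 < re l -> exists e C0, [/\ 0 < e, 0 <= C0 &
  forall (g : C -> C) k, 0 <= k -> diff_disc g ->
    (forall w, cabs w < 1 -> cabs (g w) <= k * (cabs (upow l w) * expR (2 * e * cabs (ulog w)))) ->
    hardy p g /\ hnorm p g <= k * C0].
Proof.
move=> p0 lp; pose b := Num.max 0 (- re l).
have b0 : 0 <= b by rewrite le_max lexx.
have rb : 0 <= re l + b by rewrite -lerBlDl sub0r le_max lexx orbT.
have bp : b < p^-1 by rewrite gt_max invr_gt0 p0 ltrNl.
(* Then [b + 2 * e] is the midpoint of [b] and [p^-1], so [al < 1]. *)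
pose e := (p^-1 - b) / 4.
have e0 : 0 < e by rewrite divr_gt0 // subr_gt0.
pose al := p * (b + 2 * e).
have al01 : 0 <= al < 1.
  apply/andP; split; first by rewrite /al mulr_ge0 ?(ltW p0) // addr_ge0 // mulr_ge0 // ltW.
  by rewrite /al -ltr_pdivlMl // mulr1 /e; move: bp; clear; lra.
have [C0 C00 HC0] := weighted_hnorm p0 al01.
pose A := (re l + b) * ln 2 + 2 * `|im l| + 2 * e * (2 * ln 2 + 2).
exists e, (expR A * C0); split => //; first by rewrite mulr_ge0 ?expR_ge0.
move=> g k k0 dg Hg; rewrite mulrA; apply: HC0 => //; first by rewrite mulr_ge0 ?expR_ge0.
move=> w w1; apply: le_trans (Hg w w1) _; rewrite -[leRHS]mulrA ler_wpM2l //.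
rewrite cabs_upow -!expRD ler_expR.
have -> : al / p = b + 2 * e by rewrite /al mulrAC mulfV ?mul1r // gt_eqF.
apply: upow_exponent_le => //; [exact: ltW|exact: ln_u_le| |exact: cabs_ReIm].
by apply: le_trans (im_clog_le _) _; apply: ltW; exact: pihalf_lt2.
Qed.

(** One dominating function for [u ^ l], its derivative in [l] and its first-order Taylor remainder,
    in the form required by [dominated_hnorm]. *)
Lemma upow_bounds l e w : 0 < e ->
  [/\ cabs (upow l w) <= cabs (upow l w) * expR (2 * e * cabs (ulog w)),
    cabs (upow l w * ulog w) <= e^-1 * (cabs (upow l w) * expR (2 * e * cabs (ulog w))) &
    forall d, cabs d <= e ->
      cabs (upow (l + d) w - upow l w - d * (upow l w * ulog w)) <=
      6 / e ^+ 2 * cabs d ^+ 2 * (cabs (upow l w) * expR (2 * e * cabs (ulog w)))].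
Proof.
move=> e0; set X := cabs (upow l w); set Y := cabs (ulog w).
have X0 : 0 <= X by exact: cabs_ge0.
have Y0 : 0 <= Y by exact: cabs_ge0.
have eY : 0 <= e * Y by rewrite mulr_ge0 // ltW.
have e2 : expR (2 * e * Y) = expR (e * Y) * expR (e * Y).
  by rewrite -expRD; congr expR; ring.
have ge1 : 1 <= expR (e * Y) by rewrite -expR0 ler_expR.
have Ye : e * Y <= expR (e * Y).
  by apply: le_trans (expR_ge1Dx _); rewrite lerDr.
(* One factor [expR (e * Y)] absorbs [Y ^ 2], the other the exponential in the Taylor error; [6] is
   the [3] of [cexp_taylor1] times this [2]. *)
have Y2e : (e * Y) ^+ 2 <= 2 * expR (e * Y).
  have := @expR_ge1Dxn R (e * Y) 1 eY.
  rewrite (_ : (2`!)%:R = 2 :> R) // => H.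
  have : (e * Y) ^+ 2 / 2 <= expR (e * Y) by apply: le_trans H; rewrite lerDr.
  by rewrite ler_pdivrMr // (mulrC _ 2).
split.
- by apply: ler_peMr => //; rewrite e2; exact: mulr_ege1.
- rewrite cabsM -/X -/Y mulrCA; apply: ler_wpM2l => //.
  rewrite -(ler_pM2l e0) mulrA mulfV ?gt_eqF // mul1r e2.
  by apply: le_trans Ye _; apply: ler_peMr => //; exact: expR_ge0.
move=> d de; have -> : upow (l + d) w - upow l w - d * (upow l w * ulog w) =
    upow l w * (cexp (d * ulog w) - 1 - d * ulog w) by rewrite upowD; ring.
rewrite cabsM -/X mulrCA; apply: ler_wpM2l => //.
apply: le_trans (cexp_taylor1 _) _; rewrite cabsM -/Y.
have H1 : expR (cabs d * Y) <= expR (e * Y) by rewrite ler_expR ler_wpM2r.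
have H2 : 3 * (cabs d * Y) ^+ 2 <= 6 / e ^+ 2 * cabs d ^+ 2 * expR (e * Y).
  have -> : 3 * (cabs d * Y) ^+ 2 = 3 / e ^+ 2 * cabs d ^+ 2 * (e * Y) ^+ 2.
    by field; exact: lt0r_neq0.
  have -> : 6 / e ^+ 2 * cabs d ^+ 2 * expR (e * Y) = 3 / e ^+ 2 * cabs d ^+ 2 * (2 * expR (e * Y)).
    by ring.
  by rewrite ler_wpM2l // mulr_ge0 ?sqr_ge0 // divr_ge0 // sqr_ge0.
rewrite e2 [leRHS]mulrA; apply: ler_pM => //.
by apply: mulr_ge0 => //; exact: sqr_ge0.
Qed.

Lemma hardy_upow p l : 0 < p -> - p^-1 < re l ->
  hardy p (upow l) /\ hardy p (fun w => upow l w * ulog w).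
Proof.
move=> p0 lp; have [e [C0 [e0 C00 H]]] := dominated_hnorm p0 lp.
have dl : diff_disc (fun w => upow l w * ulog w) := diff_discM (diff_upow l) diff_ulog.
split; [have [] := H (upow l) 1 ler01 (diff_upow l)|
        have [] := H _ e^-1 _ dl] => //; try by rewrite invr_ge0 ltW.
  by move=> w w1; rewrite mul1r; have [] := upow_bounds l w e0.
by move=> w w1; have [] := upow_bounds l w e0.
Qed.

Lemma dual_upow_differentiable p L l : 0 < p -> hdual p L -> - p^-1 < re l ->
  differentiable (fun l => L (upow l)) l.
Proof.
move=> p0 hL lp; have [e [C0 [e0 C00 H]]] := dominated_hnorm p0 lp.
have [_ [LZ [K0 HK0]]] := hL.
pose K := Num.max K0 0 * (6 / e ^+ 2 * C0).
have K1 : 0 <= Num.max K0 0 by rewrite le_max lexx orbT.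
have e20 : 0 <= 6 / e ^+ 2 by rewrite divr_ge0 // sqr_ge0.
have K2 : 0 <= K by apply: mulr_ge0 => //; exact: mulr_ge0.
have [hl hll] := hardy_upow p0 lp.
have reD (z w : C) : re (z + w) = re z + re w by case: z; case: w.
apply/differentiable_cabsP; exists (L (fun w => upow l w * ulog w)) => e' e'0.
exists (Num.min e (Num.min (re l + p^-1) (e' / (K + 1)))).
  have K3 : 0 < K + 1 by rewrite ltr_wpDl.
  have l3 : 0 < re l + p^-1 by rewrite -ltrBlDr sub0r.
  by rewrite !lt_min e0 l3 (divr_gt0 e'0 K3).
move=> d d0; rewrite !lt_min => /andP[de /andP[dr dK]].
have ldp : - p^-1 < re (l + d).
  rewrite reD; have := normRe_cabs d; rewrite ler_norml => /andP[H1 _].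
  by clear -H1 dr; lra.
have [hld _] := hardy_upow p0 ldp.
have [hd _] := hardyZ d p0 hll.
have h1 := hardyB p0 hld hl; have h2 := hardyB p0 h1 hd.
have cd0 : 0 < cabs d by rewrite cabs_gt0.
have -> : (L (upow (l + d)) - L (upow l)) / d - L (fun w => upow l w * ulog w) =
    L (fun w => upow (l + d) w - upow l w - d * (upow l w * ulog w)) / d.
  rewrite (hdualB p0 hL h1 hd) (hdualB p0 hL hld hl) (LZ _ _ hll).
  by move: (L _) (L _) (L _) => A B D; field.
have k0 : 0 <= 6 / e ^+ 2 * cabs d ^+ 2 by rewrite mulr_ge0 // sqr_ge0.
have [_ Hn] := H _ _ k0 (hardy_diff h2) (fun w _ => let: And3 _ _ G := upow_bounds l w e0 in G d (ltW de)).
rewrite cabsM cabsV ltr_pdivrMr //.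
apply: le_lt_trans (_ : K * cabs d * cabs d < _); last first.
  rewrite ltr_pM2r //; move: dK; rewrite ltr_pdivlMr; last by rewrite ltr_wpDl.
  by move: cd0 K2; clear; nra.
apply: le_trans (HK0 _ h2) _.
apply: le_trans (_ : Num.max K0 0 * hnorm p (fun w => upow (l + d) w - upow l w - d * (upow l w * ulog w)) <= _).
  by rewrite ler_wpM2r ?hnorm_ge0 // le_max lexx.
apply: le_trans (ler_wpM2l K1 Hn) _.
by rewrite /K le_eqVlt; apply/orP; left; apply/eqP; rewrite expr2; ring.
Qed.

(** * Failure of the single-valued extension property *)

Section NotSVEP.
Variables (phi : C -> C) (rho : R).
Hypothesis rho01 : 0 < rho < 1.
Hypothesis u_phi : forall w, cabs w < 1 -> u (phi w) = (rho%:C)%C * u w.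

Lemma upow_phi l w : cabs w < 1 -> upow l (phi w) = cexp (l * ((ln rho)%:C)%C) * upow l w.
Proof.
move=> w1; have /andP[r0 _] := rho01.
by rewrite /upow /ulog u_phi // clogM_real ?u0 // mulrDr cexpD.
Qed.

Lemma not_svep p : 0 < p -> ~ svep_comp p phi.
Proof.
move=> p0; have /andP[r0 r1] := rho01.
pose lr : C := ((ln rho)%:C)%C.
have lnr0 : ln rho < 0 by rewrite ln_lt0 // r0.
have lr0 : lr != 0 by rewrite /lr eq_complex /= lt_eqF.
pose half : C := ((2^-1)%:C)%C.
(* This disc lies in the right half-plane, where [clog] is holomorphic, and in the unit disc, so
   [lam z] has positive real part. *)
pose U : set C := [set z | cabs (z - half) < 4^-1].
have oU : c_open U.
  move=> z zU; exists (4^-1 - cabs (z - half)); first by rewrite subr_gt0.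
  move=> w wz; change (cabs (w - half) < 4^-1); rewrite -(subrKA z).
  by apply: le_lt_trans (cabsD _ _) _; rewrite -ltrBrDr.
have Uhalf : U half.
  by change (cabs (half - half) < 4^-1); rewrite subrr cabs0 invr_gt0.
have U1 z : U z -> 0 < re z /\ cabs z < 1.
  move=> zU0; have zU : cabs (z - ((2^-1)%:C)%C) < 4^-1 := zU0; split.
    have := normRe_cabs (z - ((2^-1)%:C)%C); rewrite ler_norml => /andP[H _].
    have : re (z - ((2^-1)%:C)%C) = re z - 2^-1 by case: (z).
    by lra.
  rewrite -(subrK ((2^-1)%:C)%C z); apply: le_lt_trans (cabsD _ _) _.
  rewrite cabs_real gtr0_norm //; lra.
pose lam z := clog z / lr.
have dlam z : U z -> differentiable lam z.
  move=> /U1[z0 _]; apply: cdiffM; [exact: clog_differentiable|exact: cdiff_cst].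
have lam_gt z : U z -> - p^-1 < re (lam z).
  move=> /U1[z0 z1]; apply: (@lt_trans _ _ 0); first by rewrite oppr_lt0 invr_gt0.
  have -> : re (lam z) = ln (cabs z) / ln rho.
    by rewrite /lam /lr -fmorphV reMr.
  rewrite -mulrNN mulr_gt0 // ?oppr_gt0 ?invr_lt0 //.
  by rewrite ln_lt0 // z1 cabs_gt0 andbT; apply: contraTneq z0 => ->; rewrite ltxx.
move=> /(_ U (fun z => upow (lam z)) oU) H.
have hA : hardy_analytic p U (fun z => upow (lam z)).
  split=> [z zU|z zU]; first by have [] := hardy_upow p0 (lam_gt z zU).
  set l := lam z; have lp : - p^-1 < re l := lam_gt z zU.
  have [e [C0 [e0 C00 HC]]] := dominated_hnorm p0 lp.
  have [hl hll] := hardy_upow p0 lp.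
  have /differentiable_cabsP[Lm HL] := dlam z zU.
  exists (fun w => Lm * (upow l w * ulog w)); first by have [] := hardyZ Lm p0 hll.
  move=> eps eps0; pose D := cabs Lm + 1.
  have D0 : 0 < D by rewrite ltr_wpDl ?cabs_ge0.
  pose e1 := Num.min 1 (e * eps / (4 * (C0 + 1))).
  have C1 : 0 < 4 * (C0 + 1) by rewrite mulr_gt0 // ltr_wpDl.
  have e10 : 0 < e1 by rewrite lt_min ltr01 divr_gt0 // mulr_gt0.
  have [dd dd0 Hdd] := HL e1 e10.
  pose B := 6 / e ^+ 2 * D ^+ 2.
  have B0 : 0 < B by rewrite mulr_gt0 ?exprn_gt0 // divr_gt0 // exprn_gt0.
  exists (Num.min dd (Num.min (e / D) (eps / (B * (4 * (C0 + 1)))))).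
    by rewrite !lt_min dd0 !divr_gt0 // mulr_gt0.
  move=> h h0; rewrite !lt_min => /andP[hdd /andP[he hB]] Uzh.
  have ch0 : 0 < cabs h by rewrite cabs_gt0.
  pose dl := lam (z + h) - lam z.
  have Hq : cabs (dl / h - Lm) < e1 := Hdd h h0 hdd.
  have Hq1 : cabs (dl / h - Lm) <= 1 by rewrite ltW // (lt_le_trans Hq) // ge_min lexx.
  have Hq2 : cabs (dl / h - Lm) <= e * eps / (4 * (C0 + 1)).
    by rewrite ltW // (lt_le_trans Hq) // ge_min lexx orbT.
  have Hdl : cabs dl <= D * cabs h.
    have -> : dl = (Lm + (dl / h - Lm)) * h by rewrite subrKC divfK.
    rewrite cabsM ler_pM2r //; by apply: le_trans (cabsD _ _) _; rewrite /D lerD2l.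
  have Hdle : cabs dl <= e.
    by apply: le_trans Hdl _; move: he; rewrite ltr_pdivlMr // mulrC => /ltW.
  have ldl : lam (z + h) = l + dl by rewrite /dl -/l subrKC.
  (* The quadratic remainder in [l] divided by [h], plus the error of the difference quotient of
     [lam]; the radii above make each at most [eps / (4 * (C0 + 1))]. *)
  pose k := 6 / e ^+ 2 * cabs dl ^+ 2 / cabs h + cabs (dl / h - Lm) / e.
  have k0 : 0 <= k.
    by rewrite addr_ge0 // divr_ge0 ?cabs_ge0 ?(ltW e0) // mulr_ge0 ?sqr_ge0 // divr_ge0 // sqr_ge0.
  pose g w := (upow (lam (z + h)) w - upow (lam z) w) / h - Lm * (upow l w * ulog w).
  have dg : diff_disc g.
    move=> w w1; apply: cdiffB.
      apply: cdiffM; last exact: cdiff_cst.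
      by apply: cdiffB; exact: diff_upow.
    apply: cdiffM; first exact: cdiff_cst.
    by apply: cdiffM; [exact: diff_upow|exact: diff_ulog].
  have gk w : cabs w < 1 -> cabs (g w) <= k * (cabs (upow l w) * expR (2 * e * cabs (ulog w))).
    move=> w1; have [_ G2 /(_ dl Hdle) G3] := upow_bounds l w e0.
    have -> : g w = (upow (l + dl) w - upow l w - dl * (upow l w * ulog w)) / h +
        (dl / h - Lm) * (upow l w * ulog w).
      by rewrite /g ldl -/l; move: (upow (l + dl) w) (upow l w) (ulog w) => A1 A2 A3; field.
    apply: le_trans (cabsD _ _) _; rewrite /k [leRHS]mulrDl; apply: lerD.
      rewrite cabsM cabsV [leRHS]mulrAC ler_pM2r ?invr_gt0 //; exact: G3.
    by rewrite cabsM -[leRHS]mulrA ler_wpM2l ?cabs_ge0.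
  have [_ Hg] := HC g k k0 dg gk.
  apply: le_lt_trans Hg _.
  have E1 : 6 / e ^+ 2 * cabs dl ^+ 2 / cabs h <= B * cabs h.
    have -> : B * cabs h = 6 / e ^+ 2 * (D * cabs h) ^+ 2 / cabs h.
      by rewrite /B; field; rewrite !gt_eqF.
    rewrite ler_pM2r ?invr_gt0 //; apply: ler_wpM2l; first by rewrite divr_ge0 // sqr_ge0.
    apply: lerXn2r => //; rewrite nnegrE ?cabs_ge0 //.
    by rewrite mulr_ge0 ?cabs_ge0 // ltW.
  have E2 : B * cabs h <= eps / (4 * (C0 + 1)).
    move: hB; rewrite invfM mulrA ltr_pdivlMr // ltr_pdivlMr // => hB.
    by rewrite ler_pdivlMr //; move: hB; clear; lra.
  have E3 : cabs (dl / h - Lm) / e <= eps / (4 * (C0 + 1)).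
    by rewrite ler_pdivrMr // mulrAC (mulrC eps).
  have E4 : k <= eps / (4 * (C0 + 1)) * 2.
    by rewrite mulr_natr mulr2n; apply: lerD => //; exact: le_trans E1 E2.
  apply: le_lt_trans (ler_wpM2r C00 E4) _.
  have -> : eps / (4 * (C0 + 1)) * 2 * C0 = eps * (C0 / (2 * (C0 + 1))).
    field; by rewrite gt_eqF // ltr_wpDl.
  rewrite gtr_pMr // ltr_pdivrMr; last by rewrite mulr_gt0 // ltr_wpDl.
  by lra.
have eig z : U z -> hnorm p (fun w => comp_op phi (upow (lam z)) w - z * upow (lam z) w) = 0.
  move=> zU; have [z0 _] := U1 z zU.
  have [] // := @hnorm_eq0 R p (fun w => comp_op phi (upow (lam z)) w - z * upow (lam z) w) p0 _.
  move=> w w1; rewrite /comp_op upow_phi // -/lr /lam divfK // clogK // subrr //.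
have := H hA eig half Uhalf.
have [hl _] := hardy_upow p0 (lam_gt half Uhalf).
(* The circle of radius [0] already detects that the eigenfunction is nonzero: its mean is a power
   of the nonzero modulus at the origin. *)
have := pM_le_hnorm p0 hl (zero_in01 R).
move=> H1 H2; move: H1; rewrite H2 powR0 ?gt_eqF // leNgt => /negP; apply.
rewrite /pM (_ : (fun x => _) = fun=> cabs (upow (lam half) 0) `^ p); last first.
  by apply/funext => x; rewrite polar0.
by rewrite rmean_cst powR_gt0 // cabs_upow expR_gt0.
Qed.

End NotSVEP.
End Eigenfunctions.

(** * The resolvent of the adjoint *)

Section ComplexSeries.
Variable R : realType.
Local Notation C := R[i].
Local Notation cabs := (@ComplexField.Normc.normc R).
Local Notation re := (@complex.Re R).
Local Notation im := (@complex.Im R).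
Implicit Types (a b : nat -> C) (M q : R).

Definition cseries a : C :=
  Complex (limn (series (re \o a))) (limn (series (im \o a))).

Definition geometric_bound a M q := [/\ 0 <= M, 0 <= q < 1 & forall n, cabs (a n) <= M * q ^+ n].

Lemma real_series_cvg (a : nat -> R) M q : 0 <= M -> 0 <= q < 1 ->
  (forall n, `|a n| <= M * q ^+ n) -> series a @ \oo --> limn (series a).
Proof.
move=> M0 /andP[q0 q1] aM; apply: normed_cvg.
apply: (@series_le_cvg _ _ (geometric M q)) => //.
- by move=> n; exact: normr_ge0.
- by move=> n; apply: mulr_ge0 => //; exact: exprn_ge0.
- by apply: is_cvg_geometric_series; rewrite ger0_norm.
Qed.

Lemma csum_cvg a M q : geometric_bound a M q ->
  (fun n => \sum_(k < n) a k) @ \oo --> cseries a.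
Proof.
move=> [M0 q01 aM].
have E n : \sum_(k < n) a k = Complex (series (re \o a) n) (series (im \o a) n).
  elim: n => [|n IH]; first by rewrite big_ord0 !seriesEord /= !big_ord0.
  rewrite big_ord_recr /= IH; rewrite !seriesEord /= !big_ord_recr /=.
  by case: (a n).
have -> : (fun n => \sum_(k < n) a k) = (fun n => Complex (series (re \o a) n) (series (im \o a) n)).
  exact/funext.
apply: cvg_Complex; apply: (@real_series_cvg _ M q) => // n.
  exact: le_trans (normRe_cabs _) (aM n).
exact: le_trans (normIm_cabs _) (aM n).
Qed.

Lemma ccvg_unique (x : nat -> C) (y z : C) : x @ \oo --> y -> x @ \oo --> z -> y = z.
Proof.
move=> /cvg_cabsP xy /cvg_cabsP xz; apply/eqP.
rewrite -subr_eq0 -cabs_eq0 eq_le cabs_ge0 andbT.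
apply/ler_addgt0Pr => e e0; rewrite add0r; have e2 : 0 < e / 2 by rewrite divr_gt0.
have [n _ Hn] := xy _ e2; have [m _ Hm] := xz _ e2.
have := Hn _ (leq_maxl n m); have := Hm _ (leq_maxr n m).
rewrite /= cabsBC => H1; rewrite cabsBC => H2; rewrite -(subrKA (x (maxn n m))) [e]splitr.
apply: le_trans (cabsD _ _) _; rewrite (cabsBC _ z).
by apply: lerD; apply: ltW; rewrite // cabsBC.
Qed.

Lemma cseriesS a M q : geometric_bound a M q -> cseries a = a 0%N + cseries (fun n => a n.+1).
Proof.
move=> H; have [M0 q01 aM] := H; have /andP[q0 q1] := q01.
have HS : geometric_bound (fun n => a n.+1) (M * q) q.
  by split => // [|n]; [exact: mulr_ge0|apply: le_trans (aM _) _; rewrite exprS mulrA].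
have H1 : (fun n => \sum_(k < n.+1) a k) @ \oo --> cseries a.
  by have := csum_cvg H; rewrite -cvg_shiftS.
apply: (ccvg_unique H1).
have -> : (fun n => \sum_(k < n.+1) a k) = (fun n => a 0%N + \sum_(k < n) a k.+1).
  by apply/funext => n; rewrite big_ord_recl.
apply: cvgD; first exact: cvg_cst.
exact: (csum_cvg HS).
Qed.

Lemma cseriesD a b M N q : geometric_bound a M q -> geometric_bound b N q ->
  cseries (fun n => a n + b n) = cseries a + cseries b.
Proof.
move=> Ha Hb; have [M0 q01 aM] := Ha; have [N0 _ bN] := Hb.
have H : geometric_bound (fun n => a n + b n) (M + N) q.
  split => // [|n]; first exact: addr_ge0.
  by rewrite mulrDl; apply: le_trans (cabsD _ _) _; exact: lerD.
apply: (ccvg_unique (csum_cvg H)).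
have -> : (fun n => \sum_(k < n) (a k + b k)) = (fun n => \sum_(k < n) a k + \sum_(k < n) b k).
  by apply/funext => n; rewrite big_split.
by apply: cvgD; [exact: csum_cvg Ha|exact: csum_cvg Hb].
Qed.

Lemma cseriesZ k a M q : geometric_bound a M q -> cseries (fun n => k * a n) = k * cseries a.
Proof.
move=> Ha; have [M0 q01 aM] := Ha.
have H : geometric_bound (fun n => k * a n) (cabs k * M) q.
  split => // [|n]; first by rewrite mulr_ge0 ?cabs_ge0.
  by rewrite cabsM -mulrA ler_wpM2l ?cabs_ge0.
apply: (ccvg_unique (csum_cvg H)).
have -> : (fun n => \sum_(j < n) (k * a j)) = (fun n => k * \sum_(j < n) a j).
  by apply/funext => n; rewrite mulr_sumr.
by apply: cvgM; [exact: cvg_cst|exact: csum_cvg Ha].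
Qed.

Lemma cabs_cseries a M q : geometric_bound a M q -> cabs (cseries a) <= M / (1 - q).
Proof.
move=> Ha; have [M0 /andP[q0 q1] aM] := Ha.
have H : (fun n => cabs (\sum_(k < n) a k)) @ \oo --> cabs (cseries a).
  by apply: (cvg_comp _ _ (csum_cvg Ha)); exact: continuous_cabs.
apply: (cvgr_to_le H); exists 0%N => // n _ /=.
have q10 : 0 < 1 - q by rewrite subr_gt0.
rewrite ler_pdivlMr //.
suff : cabs (\sum_(k < n) a k) * (1 - q) <= M * (1 - q ^+ n).
  by move/le_trans; apply; rewrite ler_piMr // gerBl exprn_ge0.
elim: n => [|n IH]; first by rewrite big_ord0 cabs0 mul0r expr0 subrr mulr0.
rewrite big_ord_recr /=; apply: le_trans (ler_wpM2r (ltW q10) (cabsD _ _)) _.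
rewrite mulrDl; apply: le_trans (lerD IH (ler_wpM2r (ltW q10) (aM n))) _.
by rewrite exprS le_eqVlt; apply/orP; left; apply/eqP; ring.
Qed.

End ComplexSeries.

(** * The dual space and its norm *)

Section DualSpace.
Variable R : realType.
Local Notation C := R[i].
Local Notation cabs := (@ComplexField.Normc.normc R).
Variable p : R.
Hypothesis p0 : 0 < p.
Implicit Types (L : (C -> C) -> C).

Lemma hdualE L : hdual p L -> exists2 K, 0 <= K & forall f, hardy p f -> cabs (L f) <= K * hnorm p f.
Proof.
move=> [_ [_ [K HK]]]; exists (Num.max K 0); first by rewrite le_max lexx orbT.
move=> f hf; apply: le_trans (HK f hf) _.
by rewrite ler_wpM2r ?hnorm_ge0 // le_max lexx.
Qed.

Lemma hdual_add L L' : hdual p L -> hdual p L' -> hdual p (fun f => L f + L' f).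
Proof.
move=> hL hL'; have [K K0 HK] := hdualE hL; have [K' K0' HK'] := hdualE hL'.
case: hL hL' => LD [LZ _] [LD' [LZ' _]]; split; last split.
- by move=> f g hf hg; rewrite LD // LD' // addrACA.
- by move=> k f hf; rewrite LZ // LZ' // mulrDr.
exists (K + K') => f hf; apply: le_trans (cabsD _ _) _.
by rewrite mulrDl lerD ?HK ?HK'.
Qed.

Lemma hdual_scale L k : hdual p L -> hdual p (fun f => k * L f).
Proof.
move=> hL; have [K K0 HK] := hdualE hL.
case: hL => LD [LZ _]; split; last split.
- by move=> f g hf hg; rewrite LD // mulrDr.
- by move=> c f hf; rewrite LZ // mulrCA.
exists (cabs k * K) => f hf; rewrite cabsM -mulrA ler_wpM2l ?cabs_ge0 //; exact: HK.
Qed.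

Lemma hdual_sub L L' : hdual p L -> hdual p L' -> hdual p (fun f => L f - L' f).
Proof.
move=> hL hL'; have := hdual_add hL (hdual_scale (-1) hL'); congr hdual.
by apply/funext => f; rewrite mulN1r.
Qed.

Lemma hardy0 : hardy p (fun=> 0 : C) /\ hnorm p (fun=> 0 : C) = 0.
Proof. exact: (@hnorm_eq0 R p (fun=> 0) p0 (fun _ _ => erefl)). Qed.

Lemma dnorm_le L K : 0 <= K -> (forall f, hardy p f -> cabs (L f) <= K * hnorm p f) ->
  dnorm p L <= K.
Proof.
move=> K0 HK; have [h0 n0] := hardy0; apply: ge_sup.
  by exists (cabs (L (fun=> 0))), (fun=> 0) => //; split => //; rewrite n0 ler01.
move=> _ [f [hf f1] <-]; apply: le_trans (HK f hf) _.
by rewrite ler_piMr.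
Qed.

Lemma dnorm_ge L f : hdual p L -> hardy p f -> hnorm p f <= 1 -> cabs (L f) <= dnorm p L.
Proof.
move=> hL hf f1; have [K K0 HK] := hdualE hL.
apply: ub_le_sup; last by exists f.
exists K => _ [g [hg g1] <-]; apply: le_trans (HK g hg) _; by rewrite ler_piMr.
Qed.

Lemma dnorm_bound L f : hdual p L -> hardy p f -> cabs (L f) <= dnorm p L * hnorm p f.
Proof.
move=> hL hf; have [f0|f0] := eqVneq (hnorm p f) 0.
  by rewrite (hdual_hnorm0 hL hf f0) cabs0 f0 mulr0.
have fpos : 0 < hnorm p f by rewrite lt_neqAle eq_sym f0 hnorm_ge0.
pose k : C := (((hnorm p f)^-1)%:C)%C.
have ck : cabs k = (hnorm p f)^-1 by rewrite cabs_real ger0_norm // invr_ge0 ltW.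
have [hk nk] := hardyZ k p0 hf; rewrite ck mulVf // in nk.
have := dnorm_ge hL hk nk; case: (hL) => _ [LZ _].
by rewrite LZ // cabsM ck mulrC ler_pdivrMr.
Qed.

Lemma dnorm0 L : (forall f, hardy p f -> L f = 0) -> dnorm p L = 0.
Proof.
move=> L0; apply/eqP; rewrite eq_le dnorm_le //=; last first.
  by move=> f hf; rewrite L0 // cabs0 mul0r.
have [h0 n0] := hardy0; apply: ub_le_sup.
  by exists 0 => _ [f [hf _] <-]; rewrite L0 // cabs0.
by exists (fun=> 0); [split => //; rewrite n0 ler01|rewrite L0 // cabs0].
Qed.

Lemma dnorm_eq0 L f : hdual p L -> dnorm p L = 0 -> hardy p f -> L f = 0.
Proof.
move=> hL L0 hf; have := dnorm_bound hL hf; rewrite L0 mul0r => H.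
by apply/eqP; rewrite -cabs_eq0 eq_le H cabs_ge0.
Qed.

End DualSpace.

(** * The Neumann series and analyticity of the resolvent *)

Section Resolvent.
Variable R : realType.
Local Notation C := R[i].
Local Notation cabs := (@ComplexField.Normc.normc R).
Variables (p : R) (phi : C -> C) (K1 rho : R).
Hypotheses (p0 : 0 < p) (K10 : 0 <= K1) (rho0 : 0 < rho).
Hypothesis bound_iter : forall n f, hardy p f ->
  hardy p (fun w => f (iter n phi w)) /\
  hnorm p (fun w => f (iter n phi w)) <= K1 * rho ^+ n * hnorm p f.
Implicit Types (y : (C -> C) -> C) (z : C) (f : C -> C).

(** The Neumann series of the inverse of [T - z] for the adjoint [T], summed at each [f] separately:
    [T ^ n y] takes at [f] the value of [y] at [f o phi ^ n]. *)
Definition resolvent z y f : C :=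
  - cseries (fun n => z^-1 ^+ n.+1 * y (fun w => f (iter n phi w))).

Lemma resolvent_geometric z y f K : rho < cabs z -> 0 <= K ->
  (forall f, hardy p f -> cabs (y f) <= K * hnorm p f) -> hardy p f ->
  geometric_bound (fun n => z^-1 ^+ n.+1 * y (fun w => f (iter n phi w)))
    (K * K1 * hnorm p f / cabs z) (rho / cabs z).
Proof.
move=> rz K0 HK hf; have z0 : 0 < cabs z by exact: lt_trans rz.
split; first by rewrite divr_ge0 ?(ltW z0) // !mulr_ge0 ?hnorm_ge0.
  by rewrite divr_ge0 ?(ltW rho0) ?(ltW z0) //= ltr_pdivrMr // mul1r.
move=> n; have [hn Hn] := bound_iter n hf.
rewrite cabsM cabsX cabsV.
apply: le_trans (ler_wpM2l _ (le_trans (HK _ hn) (ler_wpM2l K0 Hn))) _.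
  by rewrite exprn_ge0 // invr_ge0 ltW.
by rewrite le_eqVlt; apply/orP; left; apply/eqP; rewrite exprMn exprS; ring.
Qed.

Lemma resolvent_bound z y f K : rho < cabs z -> 0 <= K ->
  (forall f, hardy p f -> cabs (y f) <= K * hnorm p f) -> hardy p f ->
  cabs (resolvent z y f) <= K * (K1 / (cabs z - rho)) * hnorm p f.
Proof.
move=> rz K0 HK hf; have z0 : 0 < cabs z by exact: lt_trans rz.
rewrite cabsN; apply: le_trans (cabs_cseries (resolvent_geometric rz K0 HK hf)) _.
rewrite le_eqVlt; apply/orP; left; apply/eqP; field.
by rewrite subr_eq0 !gt_eqF.
Qed.

Lemma hdual_resolvent z y : rho < cabs z -> hdual p y -> hdual p (resolvent z y).
Proof.
move=> rz hy; have [K K0 HK] := hdualE hy; case: (hy) => yD [yZ _].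
split; last split.
- move=> f g hf hg; rewrite /resolvent -opprD; congr (- _).
  rewrite -(cseriesD (resolvent_geometric rz K0 HK hf) (resolvent_geometric rz K0 HK hg)).
  congr cseries; apply/funext => n; rewrite -mulrDr; congr (_ * _).
  by apply: yD; [case: (bound_iter n hf)|case: (bound_iter n hg)].
- move=> k f hf; rewrite /resolvent mulrN; congr (- _).
  rewrite -(cseriesZ k (resolvent_geometric rz K0 HK hf)).
  congr cseries; apply/funext => n; rewrite mulrCA; congr (_ * _).
  by apply: yZ; case: (bound_iter n hf).
by exists (K * (K1 / (cabs z - rho))) => f hf; exact: resolvent_bound.
Qed.

Lemma resolvent_eq z y f : rho < cabs z -> hdual p y -> hardy p f ->
  resolvent z y (fun w => f (phi w)) - z * resolvent z y f = y f.
Proof.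
move=> rz hy hf; have [K K0 HK] := hdualE hy.
have z0 : 0 < cabs z by exact: lt_trans rz.
have zn0 : z != 0 by rewrite -cabs_gt0.
have G := resolvent_geometric rz K0 HK hf.
have [hf1 _] := bound_iter 1 hf.
have G1 := resolvent_geometric rz K0 HK hf1.
rewrite /resolvent mulrN opprK (cseriesS G) expr1 mulrDr mulrA divff // mul1r.
have -> : z * cseries (fun n => z^-1 ^+ n.+2 * y (fun w => f (iter n.+1 phi w))) =
    cseries (fun n => z^-1 ^+ n.+1 * y (fun w => f (phi (iter n phi w)))).
  have := cseriesZ z^-1 G1; rewrite /= => E.
  apply: (mulfI (invr_neq0 zn0)); rewrite mulrA mulVf // mul1r -E.
  by congr cseries; apply/funext => n; rewrite mulrA -exprS.
by rewrite addrCA addNr addr0.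
Qed.

(** Iterating [T y = z y] gives [cabs z ^ n * cabs (y f) <= const * rho ^ n], impossible for large
    [n] unless [y f = 0]. This uniqueness yields the resolvent identity without manipulating double
    series. *)
Lemma adj_injective z y : rho < cabs z -> hdual p y ->
  (forall f, hardy p f -> y (fun w => f (phi w)) = z * y f) ->
  forall f, hardy p f -> y f = 0.
Proof.
move=> rz hy H f hf; have [K K0 HK] := hdualE hy.
have z0 : 0 < cabs z by exact: lt_trans rz.
have Hn n : y (fun w => f (iter n phi w)) = z ^+ n * y f.
  elim: n => [|n IH]; first by rewrite expr0 mul1r.
  have [hn _] := bound_iter n hf.
  rewrite exprS -mulrA -IH -(H _ hn); congr y; apply/funext => w; by rewrite iterSr.
have B n : cabs (y f) <= K * K1 * hnorm p f * (rho / cabs z) ^+ n.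
  have [hn Hn'] := bound_iter n hf.
  have := le_trans (HK _ hn) (ler_wpM2l K0 Hn').
  rewrite Hn cabsM cabsX => B; have zn : 0 < cabs z ^+ n by rewrite exprn_gt0.
  rewrite -(ler_pM2l zn); apply: le_trans B _.
  rewrite le_eqVlt; apply/orP; left; apply/eqP; rewrite expr_div_n; field.
  by rewrite gt_eqF.
have cv : (fun n => K * K1 * hnorm p f * (rho / cabs z) ^+ n) @ \oo --> K * K1 * hnorm p f * 0.
  have q0 : 0 <= rho / cabs z by rewrite divr_ge0 // ltW.
  apply: cvgM; first exact: cvg_cst.
  by apply: cvg_expr; rewrite (ger0_norm q0) ltr_pdivrMr // mul1r.
rewrite mulr0 in cv; apply/eqP; rewrite -cabs_eq0 eq_le cabs_ge0 andbT.
by apply: (cvgr_to_ge cv); exists 0%N => // n _; exact: B.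
Qed.

(** [T - z'] sends both sides to the same functional by [resolvent_eq], and it is injective. *)
Lemma resolvent_identity z z' y f : rho < cabs z -> rho < cabs z' -> hdual p y -> hardy p f ->
  resolvent z' y f - resolvent z y f = (z' - z) * resolvent z' (resolvent z y) f.
Proof.
move=> rz rz' hy hf.
have h1 := hdual_resolvent rz' hy; have h2 := hdual_resolvent rz hy.
have h3 := hdual_resolvent rz' h2.
have hD := hdual_sub (hdual_sub h1 h2) (hdual_scale (z' - z) h3).
apply/eqP; rewrite -subr_eq0; apply/eqP; apply: (adj_injective rz' hD) => // g hg.
have E1 := resolvent_eq rz' hy hg; have E2 := resolvent_eq rz hy hg.
have E3 := resolvent_eq rz' h2 hg.
move: E1 E2 E3.
move: (resolvent z' y (fun w => g (phi w))) (resolvent z' y g).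
move: (resolvent z' (resolvent z y) (fun w => g (phi w))) (resolvent z' (resolvent z y) g).
move: (resolvent z y (fun w => g (phi w))) (resolvent z y g) (y g) => a b c d e k l.
move=> /eqP; rewrite subr_eq => /eqP -> /eqP; rewrite subr_eq => /eqP -> /eqP.
by rewrite subr_eq => /eqP ->; ring.
Qed.

(** The derivative of the resolvent is its square applied to [y]. Two uses of the resolvent identity
    express the error of the difference quotient as [h] times a triple resolvent. *)
Lemma outer_local_resolvent y l : hdual p y -> rho < cabs l ->
  adj_local_resolvent p phi y l.
Proof.
move=> hy rl; exists [set z | rho < cabs z]; split => //.
  move=> z rz; exists (cabs z - rho); first by rewrite subr_gt0.
  move=> w wz; have := cabs_lbB z w; rewrite cabsBC => H.
  change (rho < cabs w).
  by rewrite -(ltrD2r (cabs z - rho)) addrC subrK -ltrBlDl (le_lt_trans H).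
exists (fun z => resolvent z y); last first.
  move=> z rz; apply: dnorm0 => // f hf.
  by rewrite [comp_adj _ _ _](_ : _ = resolvent z y (fun w => f (phi w))) // resolvent_eq // subrr.
split=> [z rz|z rz]; first exact: hdual_resolvent.
have hF := hdual_resolvent rz hy; have hG := hdual_resolvent rz hF.
exists (resolvent z (resolvent z y)) => // e e0.
have [K K0 HK] := hdualE hG.
(* Increments below [d / 2] keep [z + h] at distance [d / 2] from the critical circle, so the outer
   resolvent is bounded uniformly in [h]. *)
pose d := cabs z - rho; have d0 : 0 < d by rewrite subr_gt0.
pose B := K * (K1 / (d / 2)); have B0 : 0 <= B.
  by rewrite mulr_ge0 // divr_ge0 // divr_ge0 // ltW.
have B1 : 0 < B + 1 by rewrite ltr_wpDl.
exists (Num.min (d / 2) (e / (B + 1))); first by rewrite lt_min !divr_gt0.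
move=> h h0; rewrite lt_min => /andP[hd he] rzh.
have rzh' : rho + d / 2 <= cabs (z + h).
  apply: le_trans (cabs_lbD z h); rewrite /d in hd *; lra.
have ch0 : 0 < cabs h by rewrite cabs_gt0.
apply: le_lt_trans (_ : cabs h * B < e); last first.
  move: he; rewrite ltr_pdivlMr // mulrDr mulr1; apply: lt_trans; by rewrite ltrDl.
apply: dnorm_le => //; first by rewrite mulr_ge0 ?cabs_ge0.
move=> f hf.
have -> : (resolvent (z + h) y f - resolvent z y f) / h - resolvent z (resolvent z y) f =
    h * resolvent (z + h) (resolvent z (resolvent z y)) f.
  rewrite (resolvent_identity rz rzh hy hf) addrAC subrr add0r mulrAC divff // mul1r.
  by rewrite (resolvent_identity rz rzh hF hf) addrAC subrr add0r.
rewrite cabsM -mulrA; apply: ler_wpM2l; first exact: cabs_ge0.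
apply: le_trans (resolvent_bound rzh K0 HK hf) _.
apply: ler_wpM2r; first exact: hnorm_ge0.
rewrite /B; apply: ler_wpM2l => //; apply: ler_wpM2l => //.
by rewrite lef_pV2 ?posrE ?subr_gt0 ?divr_gt0 // lerBrDl.
Qed.

End Resolvent.

(** * Local spectra *)

Lemma gt_of_close (R : realType) (a b c d : R) : d < b + a -> - d <= c - b -> - a < c.
Proof. lra. Qed.

Section LocalSpectrum.
Variable R : realType.
Local Notation C := R[i].
Local Notation cabs := (@ComplexField.Normc.normc R).
Local Notation re := (@complex.Re R).
Variables (p : R) (phi sigma sigmai : C -> C) (r K1 : R).
Local Notation u := (fun w => 1 - sigma w).
Local Notation rho := (r^-1 `^ p^-1).
Hypotheses (p1 : 1 < p) (r01 : 0 < r < 1) (K10 : 0 <= K1).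
Hypotheses (dsigma : diff_disc sigma) (sigma1 : forall w, cabs w < 1 -> cabs (sigma w) < 1).
Hypotheses (dsigmai : diff_disc sigmai) (sigmai1 : forall w, cabs w < 1 -> cabs (sigmai w) < 1).
Hypothesis sigmaK : forall w, cabs w < 1 -> sigmai (sigma w) = w.
Hypothesis u_phi : forall w, cabs w < 1 -> u (phi w) = (r%:C)%C * u w.
Hypothesis bound_iter : forall n f, hardy p f ->
  hardy p (fun w => f (iter n phi w)) /\
  hnorm p (fun w => f (iter n phi w)) <= K1 * rho ^+ n * hnorm p f.
Implicit Types (x y : (C -> C) -> C).

Let p0 : 0 < p. Proof. exact: lt_trans p1. Qed.
Let r0 : 0 < r. Proof. by case/andP: r01. Qed.
Let rho0 : 0 < rho. Proof. by rewrite powR_gt0 // invr_gt0. Qed.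

Lemma diff_one_minus : diff_disc u.
Proof. by move=> w w1; apply: cdiffB; [exact: cdiff_cst|exact: dsigma]. Qed.

Lemma re_one_minus w : cabs w < 1 -> 0 < re (u w).
Proof.
move=> w1; have -> : re (u w) = 1 - re (sigma w) by case: (sigma w).
by rewrite subr_gt0; exact: le_lt_trans (Re_cabs _) (sigma1 w1).
Qed.

Lemma cabs_one_minus w : cabs w < 1 -> cabs (u w) <= 2.
Proof.
move=> w1; apply: le_trans (cabsB _ _) _; rewrite cabs1.
by have := sigma1 w1; lra.
Qed.

Lemma hdual_comp_adj y : hdual p y -> hdual p (comp_adj phi y).
Proof.
move=> hy; have [K K0 HK] := hdualE hy; case: hy => yD [yZ _]; split; last split.
- move=> f g hf hg; rewrite /comp_adj /comp_op.
  by apply: yD; [case: (bound_iter 1 hf)|case: (bound_iter 1 hg)].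
- by move=> k f hf; rewrite /comp_adj /comp_op; apply: yZ; case: (bound_iter 1 hf).
exists (K * (K1 * rho ^+ 1)) => f hf; have [h1 H1] := bound_iter 1 hf.
by rewrite -mulrA; exact: le_trans (HK _ h1) (ler_wpM2l K0 H1).
Qed.

Lemma local_eqn (U : set C) (F : C -> (C -> C) -> C) x z f :
  dual_analytic p U F -> hdual p x -> U z -> hardy p f ->
  dnorm p (fun f => comp_adj phi (F z) f - z * F z f - x f) = 0 ->
  F z (fun w => f (phi w)) = z * F z f + x f.
Proof.
move=> [hF _] hx Uz hf H; have hz := hF z Uz.
have hD := hdual_sub (hdual_sub (hdual_comp_adj hz) (hdual_scale z hz)) hx.
have := dnorm_eq0 p0 hD H hf; rewrite /comp_adj /comp_op => /eqP.
by rewrite subr_eq0 => /eqP E; rewrite -E addrCA subrr addr0.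
Qed.

Lemma inner_local_resolvent_pow x l : hdual p x -> cabs l < rho ->
  adj_local_resolvent p phi x l -> forall n, x (fun w => u w ^+ n) = 0.
Proof.
move=> hx lrho [U [oU Ul [F hF HF]]] n.
have lnr : ln r < 0 by rewrite ln_lt0.
pose lr : C := ((ln r)%:C)%C.
have lr0 : lr != 0 by rewrite /lr eq_complex /= lt_eqF.
(* [0] is not of the form [r ^ l], so when [l = 0] a nearby nonzero point of [U] replaces it. *)
have [z1 [Uz1 z10 z1rho]] : exists z1, [/\ U z1, 0 < cabs z1 & cabs z1 < rho].
  have [l0|l0] := eqVneq l 0; last by exists l; split => //; rewrite cabs_gt0.
  have [e e0 He] := oU l Ul; pose s := Num.min e rho / 2.
  have m0 : 0 < Num.min e rho by rewrite lt_min e0 rho0.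
  have s0 : 0 < s by rewrite divr_gt0.
  have sm : s < Num.min e rho by rewrite ltr_pdivrMr // ltr_pMr // ltr1n.
  have cs : cabs ((s%:C)%C : C) = s by rewrite cabs_real gtr0_norm.
  exists (s%:C)%C; split; rewrite ?cs //.
    by apply: He; rewrite l0 subr0 cs (lt_le_trans sm) // ge_min lexx.
  by rewrite (lt_le_trans sm) // ge_min lexx orbT.
have [th _ Ez1] := polar_arg z1.
(* Any logarithm of [z1] serves; [clog] would demand a positive real part. *)
pose c1 : C := Complex (ln (cabs z1)) th; pose l1 := c1 / lr.
have cexp1 : cexp (l1 * lr) = z1.
  by rewrite /l1 divfK // [RHS]Ez1 /cexp /= lnK.
(* Because [ln r < 0], this is the condition [cabs z1 < rho]. *)
have l1p : - p^-1 < re l1.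
  have -> : re l1 = ln (cabs z1) / ln r by rewrite /l1 /lr -fmorphV reMr.
  rewrite ltr_ndivlMr // mulNr -mulrN -lnV ?posrE // -ln_powR.
  by rewrite ltr_ln ?posrE.
have dexp (m : C) : differentiable (fun l : C => cexp (l * lr)) m.
  apply: (@cdiff_comp _ (fun l : C => l * lr) (@cexp R)); last exact: differentiable_cexp.
  by apply: cdiffM; [exact: cdiff_id|exact: cdiff_cst].
have nU : nbhs (cexp (l1 * lr)) U.
  by rewrite cexp1; apply/nbhs_cabsP; have [e e0 He] := oU z1 Uz1; exists e.
have /nbhs_cabsP[d d0 Hd] := cdiff_cont (dexp l1) nU.
have reD (z w : C) : re (z + w) = re z + re w by case: z; case: w.
have reN (z : C) : re (- z) = - re z by case: z.
have e1 : 0 < Num.min d (re l1 + p^-1).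
  by rewrite lt_min d0 -ltrBlDr sub0r.
(* With [z = r ^ m] in [U], composition with [phi] multiplies [u ^ m] by [z]; the two terms with
   [F z] cancel in the local equation and leave [x (u ^ m) = 0]. *)
have zero m : cabs (m - l1) < Num.min d (re l1 + p^-1) -> x (upow u m) = 0.
  rewrite lt_min => /andP[ld lp].
  have {}lp : - p^-1 < re m.
    have := normRe_cabs (m - l1); rewrite reD reN ler_norml => /andP[H _].
    exact: gt_of_close lp H.
  have Uz := Hd m ld; set z := cexp (m * lr) in Uz.
  have [hl _] := hardy_upow diff_one_minus re_one_minus cabs_one_minus p0 lp.
  have E := local_eqn hF hx Uz hl (HF z Uz).
  have hz : hdual p (F z) by case: hF => H _; exact: H.
  have [hl1 _] := bound_iter 1 hl.
  have E2 : F z (fun w => upow u m (phi w)) = F z (fun w => z * upow u m w).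
    apply: (hdual_ext p0 hz hl1) => w w1.
    exact: (upow_phi re_one_minus r01 u_phi).
  case: (hz) => _ [FZ _]; move: E; rewrite E2 FZ // => /eqP.
  by rewrite -{1}[z * _]addr0 (inj_eq (addrI _)) => /eqP <-.
have hol w : - p^-1 < re w -> differentiable (fun l => x (upow u l)) w.
  exact: (dual_upow_differentiable diff_one_minus re_one_minus cabs_one_minus p0 hx).
have np : - p^-1 < re (n%:R : C).
  have -> : re (n%:R : C) = n%:R by rewrite -(rmorph_nat (real_complex R) n).
  by rewrite (lt_le_trans _ (ler0n R n)) // oppr_lt0 invr_gt0.
rewrite -[RHS](identity_halfplane hol l1p e1 zero np).
have [hn _] := hardy_upow diff_one_minus re_one_minus cabs_one_minus p0 np.
symmetry; apply: (hdual_ext p0 hx hn) => w w1.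
by rewrite (upow_nat re_one_minus).
Qed.

Lemma inner_local_resolvent x l : hdual p x -> cabs l < rho ->
  adj_local_resolvent p phi x l -> forall f, hardy p f -> x f = 0.
Proof.
move=> hx lrho H; apply: (dual_zero p1 hx dsigma sigma1 dsigmai sigmai1 sigmaK).
exact: inner_local_resolvent_pow hx lrho H.
Qed.

(** The zero function solves the local equation on the whole plane, so the local spectrum is
    empty. *)
Lemma zero_local_spectrum x l : (forall f, hardy p f -> x f = 0) ->
  adj_local_resolvent p phi x l.
Proof.
move=> x0.
have h0 : hdual p (fun=> 0 : C).
  split; first by move=> *; rewrite addr0.
  by split=> [*|]; [rewrite mulr0|exists 0 => f hf; rewrite cabs0 mul0r].
exists setT; split => //; first by move=> z _; exists 1.
exists (fun _ _ => 0); last first.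
  by move=> z _; apply: dnorm0 => // f hf; rewrite /comp_adj mulr0 x0 // !subr0.
split=> [z _|z _]; first exact: h0.
exists (fun=> 0) => // e e0; exists 1 => // h _ _ _.
by rewrite dnorm0 // => f hf; rewrite subrr mul0r subrr.
Qed.

Lemma property_C : adj_property_C p phi.
Proof.
move=> F cF x hx Hx; split => //.
have [x0|] := pselect (forall f, hardy p f -> x f = 0).
  by move=> l /= nl; exfalso; apply: nl; exact: zero_local_spectrum.
move=> /existsNP[f0 /not_implyP[hf0 xf0]].
(* The tolerance is so small that an approximant vanishing at [f0] would give
   [cabs (x f0) < cabs (x f0)]. *)
have [y [hy ysp] [f1 hf1 yf1]] : exists2 y, adj_spectral_subspace p phi F y &
    exists2 f, hardy p f & y f <> 0.
  have N0 : 0 < hnorm p f0 + 1 by rewrite ltr_wpDl ?hnorm_ge0.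
  have x00 : 0 < cabs (x f0) by rewrite cabs_gt0; apply/eqP.
  have [y Fy Hy] := Hx _ (divr_gt0 x00 N0); exists y => //.
  apply: contrapT => /forall2NP ny.
  have yf0 : y f0 = 0 by case: (ny f0) => // /contrapT.
  have := dnorm_bound p0 (hdual_sub hx (let: conj h _ := Fy in h)) hf0.
  rewrite yf0 subr0 leNgt => /negP; apply.
  apply: le_lt_trans (ler_wpM2r (hnorm_ge0 _ _) (ltW Hy)) _.
  rewrite -mulrA gtr_pMr // mulrC ltr_pdivrMr // mul1r ltrDl //.
have inF l : cabs l < rho -> F l.
  move=> lrho; apply: ysp => H; apply: yf1; exact: inner_local_resolvent lrho H _ hf1.
move=> l /= nl; apply: cF => e e0.
have lrho : cabs l <= rho.
  rewrite leNgt; apply/negP => rl; apply: nl.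
  exact: (outer_local_resolvent p0 K10 rho0 bound_iter).
have rho1 : 0 < rho + 1 by rewrite addr_gt0.
(* Shrinking [l] by the factor [1 - s] enters the open disc, already contained in [F], and moves it
   by less than [e]; closedness of [F] covers the critical circle. *)
pose s := Num.min (1 / 2) (e / (rho + 1)) : R.
have s0 : 0 < s by rewrite lt_min !divr_gt0.
have s1 : s <= 1 / 2 by rewrite ge_min lexx.
have se : s * (rho + 1) <= e by rewrite -ler_pdivlMr // ge_min lexx orbT.
exists (((1 - s)%:C)%C * l).
  apply: inF; rewrite cabsM cabs_real ger0_norm; last by lra.
  apply: le_lt_trans (_ : (1 - s) * rho < _); first by rewrite ler_wpM2l //; lra.
  by rewrite gtr_pMl // gtrBl.
have -> : l - ((1 - s)%:C)%C * l = (s%:C)%C * l by rewrite rmorphB /=; ring.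
rewrite cabsM cabs_real gtr0_norm //; apply: lt_le_trans se.
by rewrite ltr_pM2l // (le_lt_trans lrho) // ltrDl.
Qed.

End LocalSpectrum.

(** * Linearization of the symbol *)

Section Blaschke.
Variable R : realType.
Local Notation C := R[i].
Local Notation cabs := (@ComplexField.Normc.normc R).
Local Notation re := (@complex.Re R).
Local Notation im := (@complex.Im R).
Implicit Types (al w v z : C).

Definition blaschke al w : C := (w - al) / (1 - conjc al * w).

Lemma blaschke_sqr al w :
  cabs (1 - conjc al * w) ^+ 2 - cabs (w - al) ^+ 2 = (1 - cabs al ^+ 2) * (1 - cabs w ^+ 2).
Proof.
rewrite !cabs_sqr; case: al w => a b [x y]; rewrite (_ : (1 : C) = Complex 1 0) //.
rewrite [conjc _]/= mulcE !oppcE !addcE /=; ring.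
Qed.

Lemma blaschke_den al w : cabs al < 1 -> cabs w <= 1 -> 1 - conjc al * w != 0.
Proof.
move=> a1 w1; rewrite subr_eq0; apply/negP => /eqP /(congr1 cabs).
rewrite cabs1 cabsM cabs_conj => H; have a0 := cabs_ge0 al; have w0 := cabs_ge0 w.
have : cabs al * cabs w <= cabs al by rewrite ler_piMr.
by rewrite -H leNgt a1.
Qed.

Lemma cabs_blaschke al w : cabs al < 1 -> cabs w <= 1 ->
  1 - cabs (blaschke al w) ^+ 2 =
  (1 - cabs al ^+ 2) * (1 - cabs w ^+ 2) / cabs (1 - conjc al * w) ^+ 2.
Proof.
move=> a1 w1; have d0 := blaschke_den a1 w1.
rewrite -blaschke_sqr /blaschke cabsM cabsV; field.
by rewrite gt_eqF // cabs_gt0.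
Qed.

Lemma blaschke_disc al w : cabs al < 1 -> cabs w < 1 -> cabs (blaschke al w) < 1.
Proof.
move=> a1 w1; have d0 := blaschke_den a1 (ltW w1).
rewrite -(@ltr_pXn2r _ 2) ?nnegrE ?cabs_ge0 // expr1n -subr_gt0 cabs_blaschke // ?ltW //.
rewrite divr_gt0 ?exprn_gt0 ?cabs_gt0 // mulr_gt0 // subr_gt0 expr_lt1 ?cabs_ge0 //.
Qed.

Lemma blaschke_circle al w : cabs al < 1 -> cabs w = 1 -> cabs (blaschke al w) = 1.
Proof.
move=> a1 w1; have := cabs_blaschke a1 (eq_ind_r (fun x => x <= 1) (lexx 1) w1).
rewrite w1 expr1n subrr mulr0 mul0r => /eqP; rewrite subr_eq0 eq_sym => /eqP H.
by apply/eqP; rewrite -(@eqrXn2 _ 2) ?cabs_ge0 // H expr1n.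
Qed.

Lemma diff_blaschke al : cabs al < 1 -> diff_disc (blaschke al).
Proof.
move=> a1 w w1; apply: cdiffM; first by apply: cdiffB; [exact: cdiff_id|exact: cdiff_cst].
apply: cdiffV; last exact: blaschke_den (ltW w1).
by apply: cdiffB; [exact: cdiff_cst|apply: cdiffM; [exact: cdiff_cst|exact: cdiff_id]].
Qed.

Lemma blaschkeK al w : cabs al < 1 -> cabs w <= 1 -> blaschke (- al) (blaschke al w) = w.
Proof.
move=> a1 w1; have d0 := blaschke_den a1 w1.
have aa : 1 - conjc al * al != 0 by apply: blaschke_den => //; exact: ltW.
have -> : blaschke (- al) (blaschke al w) =
    (blaschke al w + al) / (1 + conjc al * blaschke al w).
  by rewrite {1}/blaschke rmorphN opprK mulNr opprK.
rewrite /blaschke; move: (conjc al) d0 aa => c d0 aa.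
have -> : (w - al) / (1 - c * w) + al = w * (1 - c * al) / (1 - c * w) by field.
have -> : 1 + c * ((w - al) / (1 - c * w)) = (1 - c * al) / (1 - c * w) by field.
by field; rewrite aa d0.
Qed.

(** In [(1 - t ^ 2) * D ^ 2 = (1 - |al| ^ 2) * (1 - |w| ^ 2)] the denominator [D] is at least
    [1 - |al|], and the factors [1 + |al|] and [1 + |w|] contribute at most [4]. *)
Lemma blaschke_lower al w : cabs al < 1 -> cabs w < 1 ->
  (1 - cabs al) / 4 * (1 - cabs (blaschke al w)) <= 1 - cabs w.
Proof.
move=> a1 w1; set t := cabs (blaschke al w).
have t1 : t < 1 by exact: blaschke_disc.
have t0 : 0 <= t by exact: cabs_ge0.
have a0 := cabs_ge0 al; have w0 := cabs_ge0 w.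
have := cabs_blaschke a1 (ltW w1); rewrite -/t.
set D := cabs (1 - conjc al * w) => E.
have D1 : 1 - cabs al <= D.
  have := cabs_lbB 1 (conjc al * w); rewrite cabs1 cabsM cabs_conj -/D => H.
  by apply: le_trans H; rewrite lerB // ler_piMr // ltW.
have D0 : 0 < D by rewrite (lt_le_trans _ D1) // subr_gt0.
have E' : (1 - t ^+ 2) * D ^+ 2 = (1 - cabs al ^+ 2) * (1 - cabs w ^+ 2).
  by rewrite E divfK // expf_neq0 // gt_eqF.
move: (cabs al) (cabs w) D t a0 a1 w0 w1 D0 D1 t0 t1 E' {E} => A W D' t' a0 a1 w0 w1 D0 D1 t0 t1 E.
have H1 : (1 - t') * (1 - A) ^+ 2 <= (1 - t' ^+ 2) * D' ^+ 2.
  apply: ler_pM; rewrite ?subr_ge0 ?sqr_ge0 ?(ltW t1) //.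
    by rewrite lerB // expr2 ler_piMr // ltW.
  by rewrite ler_sqr ?nnegrE ?subr_ge0 ?(ltW a1) ?(ltW D0).
have H2 : (1 - A ^+ 2) * (1 - W ^+ 2) <= (1 - A) * 4 * (1 - W).
  have -> : (1 - A ^+ 2) * (1 - W ^+ 2) = (1 - A) * ((1 + A) * (1 + W)) * (1 - W) by ring.
  rewrite ler_wpM2r ?subr_ge0 ?(ltW w1) // ler_wpM2l ?subr_ge0 ?(ltW a1) //; nra.
have a10 : 0 < 1 - A by rewrite subr_gt0.
rewrite -(ler_pM2l a10); have := le_trans H1 (eq_ind_r (fun x => x <= _) H2 E); nra.
Qed.

(** The image is the disc of centre [1 - mu] and radius [|mu|], so [|1 - mu| + |mu| <= 1]. The real
    parts of [1 - mu] and [mu] already sum to [1], hence [mu = |mu|]. *)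
Lemma affine_disc (mu : C) : (forall v, cabs v < 1 -> cabs (1 - mu * (1 - v)) < 1) ->
  exists m : R, mu = (m%:C)%C /\ 0 <= m <= 1.
Proof.
move=> H; have Hle : cabs (1 - mu) + cabs mu <= 1.
  have [->|m0] := eqVneq mu 0; first by rewrite subr0 cabs0 cabs1 addr0.
  have [A0|A0] := eqVneq (1 - mu) 0.
    by rewrite A0 cabs0 add0r; move/subr0_eq: A0 => <-; rewrite cabs1.
  have cm0 : 0 < cabs mu by rewrite cabs_gt0.
  have cA0 : 0 < cabs (1 - mu) by rewrite cabs_gt0.
  apply/ler_addgt0Pr => e e0.
  pose s := Num.max 0 (1 - e / cabs mu) : R.
  have s0 : 0 <= s by rewrite le_max lexx.
  have s1 : s < 1 by rewrite gt_max ltr01 gtrBl divr_gt0.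
  have se : cabs mu - e <= s * cabs mu.
    have : 1 - e / cabs mu <= s by rewrite le_max lexx orbT.
    by rewrite -(ler_pM2r cm0) mulrBl mul1r divfK // gt_eqF.
  (* The point of modulus [s] for which [mu * v] has the direction of [1 - mu], so that the moduli
     add; [s] is below [1] but within [e / |mu|] of it. *)
  pose v := (s%:C)%C * ((1 - mu) / ((cabs (1 - mu))%:C)%C) * (((cabs mu)%:C)%C / mu).
  have cabsr (x : R) : 0 < x -> cabs ((x%:C)%C : C) = x.
    by move=> x0; rewrite cabs_real gtr0_norm.
  have cn (x : R) : 0 < x -> ((x%:C)%C : C) != 0 by move=> x0; rewrite -cabs_gt0 cabsr.
  have cv : cabs v = s.
    rewrite /v !cabsM !cabsV (cabsr _ cA0) (cabsr _ cm0).
    rewrite (divff (lt0r_neq0 cA0)) (divff (lt0r_neq0 cm0)) !mulr1.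
    by rewrite cabs_real ger0_norm.
  have := H v; rewrite cv => /(_ s1).
  have -> : 1 - mu * (1 - v) = (1 - mu) / ((cabs (1 - mu))%:C)%C *
      (((cabs (1 - mu))%:C)%C + (s%:C)%C * ((cabs mu)%:C)%C).
    by rewrite /v; field; rewrite m0 (cn _ cA0).
  rewrite cabsM cabsM cabsV (cabsr _ cA0) (divff (lt0r_neq0 cA0)) mul1r.
  rewrite -[X in cabs X](_ : ((cabs (1 - mu) + s * cabs mu)%:C)%C = _); last by rewrite rmorphD rmorphM.
  rewrite cabs_real.
  rewrite ger0_norm => [H1|]; last by rewrite addr_ge0 ?mulr_ge0 // ltW.
  lra.
have reB : re (1 - mu) = 1 - re mu by case: (mu).
have R1 := Re_cabs (1 - mu); rewrite reB in R1.
have R2 := Re_cabs mu.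
have Rc : cabs mu = re mu by apply/eqP; rewrite eq_le R2 andbT; lra.
exists (re mu); split; last by rewrite -Rc cabs_ge0 /=; have := cabs_ge0 (1 - mu); lra.
have I0 : im mu ^+ 2 = 0 by have := cabs_sqr mu; rewrite Rc; lra.
by move/eqP: I0; rewrite sqrf_eq0; case: (mu) => x y /= /eqP ->.
Qed.

End Blaschke.

Section Linearization.
Variable R : realType.
Local Notation C := R[i].
Local Notation cabs := (@ComplexField.Normc.normc R).
Variables a b c d : C.
Hypothesis hyp : hyperbolic_nonaut_first_kind a b c d.
Local Notation phi := (lft a b c d).

Lemma lft_disc w : cabs w < 1 -> c * w + d != 0 /\ cabs (phi w) < 1.
Proof. by case: hyp => _ H _ _; exact: H. Qed.

Lemma diff_lft : diff_disc phi.
Proof.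
move=> w w1; have [d0 _] := lft_disc w1.
have lin (p q : C) : differentiable (fun w : C => p * w + q) w.
  by apply: cdiffD; [apply: cdiffM; [exact: cdiff_cst|exact: cdiff_id]|exact: cdiff_cst].
by apply: cdiffM; [exact: lin|apply: cdiffV => //; exact: lin].
Qed.

(** [be] is the reciprocal of the exterior fixed point, and [0] when that point is infinity, so both
    cases share one formula. Divided by [c * w + d], the identity says that [1 - be * phi w] is
    proportional to [(1 - be * w) / (c * w + d)]. *)
Lemma second_fixed_point : exists2 be : C, cabs be < 1 &
  exists2 nu, nu != 0 & forall w, c * w + d - be * (a * w + b) = (1 - be * w) * nu.
Proof.
case: hyp => det _ _ [zeta [eta [_ _ feta oeta _]]].
case: eta feta oeta => [e|] /= fe oe.
  have e0 : e != 0 by rewrite -cabs_gt0 (lt_trans ltr01).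
  exists e^-1; first by rewrite cabsV invf_lt1 // (lt_trans ltr01).
  have Eb : b = e * (c * e + d) - a * e by rewrite -fe; ring.
  exists (a - c * e).
    apply: contra_neq det => /subr0_eq Ea; rewrite Eb Ea; ring.
  by move=> w; rewrite Eb; field.
exists 0; first by rewrite cabs0.
exists d; last by move=> w; rewrite fe; ring.
by apply: contra_neq det => d0; rewrite d0 fe; ring.
Qed.

(* [sigma] is the disc automorphism sending the exterior fixed point to infinity and the
   boundary fixed point to [1]; it conjugates [phi] to [w |-> 1 - r * (1 - w)]. *)
Lemma linearization : exists (sigma sigmai : C -> C) (r k : R),
  [/\ [/\ diff_disc sigma, forall w, cabs w < 1 -> cabs (sigma w) < 1,
         diff_disc sigmai & forall w, cabs w < 1 -> cabs (sigmai w) < 1],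
      forall w, cabs w < 1 -> sigmai (sigma w) = w,
      0 < r < 1,
      forall w, cabs w < 1 -> 1 - sigma (phi w) = (r%:C)%C * (1 - sigma w) &
      0 < k /\ forall w, cabs w < 1 -> k * (1 - cabs (sigma w)) <= 1 - cabs w].
Proof.
have [be be1 [nu nu0 Hnu]] := second_fixed_point.
case: hyp => det Hd naut [zeta [eta [zeta1 fzeta _ _ _]]]; rewrite /= in fzeta.
(* The pole of [blaschke al] is then the exterior fixed point. *)
pose al := conjc be.
have al1 : cabs al < 1 by rewrite cabs_conj.
have nal1 : cabs (- al) < 1 by rewrite cabsN.
have zle : cabs zeta <= 1 by rewrite zeta1.
pose k1 := blaschke al zeta; have ck1 : cabs k1 = 1 by exact: blaschke_circle.
have k10 : k1 != 0 by rewrite -cabs_gt0 ck1.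
pose sigma w := k1^-1 * blaschke al w.
pose sigmai v := blaschke (- al) (k1 * v).
have csigma w : cabs (sigma w) = cabs (blaschke al w) by rewrite cabsM cabsV ck1 invr1 mul1r.
have dsigma : diff_disc sigma := diff_discZ k1^-1 (diff_blaschke al1).
have sigma1 w : cabs w < 1 -> cabs (sigma w) < 1 by move=> w1; rewrite csigma blaschke_disc.
have ck w : cabs (k1 * w) = cabs w by rewrite cabsM ck1 mul1r.
have dsigmai : diff_disc sigmai.
  move=> w w1; apply: (@cdiff_comp _ (fun w => k1 * w) (blaschke (- al))).
    by apply: cdiffM; [exact: cdiff_cst|exact: cdiff_id].
  by apply: diff_blaschke => //; rewrite ck.
have sigmai1 w : cabs w < 1 -> cabs (sigmai w) < 1 by move=> w1; rewrite blaschke_disc // ck.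
have sigmaK w : cabs w < 1 -> sigmai (sigma w) = w.
  by move=> w1; rewrite /sigmai /sigma mulVKf // blaschkeK // ltW.
have sigmaiK w : cabs w < 1 -> sigma (sigmai w) = w.
  move=> w1; rewrite /sigmai /sigma -{1}(opprK al) blaschkeK ?mulKf //.
  by rewrite ck ltW.
have conjal : conjc al = be by exact: conjcK.
have bz : 1 - be * zeta != 0 by rewrite -conjal blaschke_den.
have za : zeta - al != 0.
  by apply: contraTneq al1 => /subr0_eq <-; rewrite zeta1 ltxx.
(* [1 - sigma] has its zero and its pole at the two fixed points of [phi], so [phi] acts on it by a
   constant factor, [mu] below. *)
have u_sigma w : cabs w <= 1 ->
    1 - sigma w = (1 - be * al) * (zeta - w) / ((zeta - al) * (1 - be * w)).
  move=> w1; have bw : 1 - be * w != 0 by rewrite -conjal blaschke_den.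
  rewrite /sigma /k1 /blaschke conjal; field.
  by rewrite bw bz za.
have Eb : b = zeta * (c * zeta + d) - a * zeta by rewrite -fzeta; ring.
pose mu := (a - c * zeta) / nu.
have mu0 : mu != 0.
  rewrite mulf_neq0 ?invr_eq0 //; apply: contra_neq det => /subr0_eq Ea.
  by rewrite Eb Ea; ring.
have u_phi w : cabs w < 1 -> 1 - sigma (phi w) = mu * (1 - sigma w).
  move=> w1; have [D0 p1] := lft_disc w1.
  rewrite (u_sigma (phi w) (ltW p1)) (u_sigma w (ltW w1)) /mu.
  have bw : 1 - be * w != 0 by rewrite -conjal blaschke_den // ltW.
  have -> : zeta - phi w = (zeta - w) * (a - c * zeta) / (c * w + d).
    by rewrite /lft Eb; field.
  have -> : 1 - be * phi w = (1 - be * w) * nu / (c * w + d).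
    by rewrite -Hnu /lft; field.
  field; by rewrite nu0 bw za D0.
(* The conjugate of [phi] by [sigma] is [v |-> 1 - mu * (1 - v)] and maps the disc into itself. *)
have [m [mE /andP[m0 m1]]] : exists m : R, mu = (m%:C)%C /\ 0 <= m <= 1.
  apply: affine_disc => v v1; have w1 := sigmai1 v v1.
  rewrite -{1}(sigmaiK v v1) -u_phi // subKr; apply: sigma1.
  by have [] := lft_disc w1.
have mpos : 0 < m.
  by rewrite lt_neqAle m0 andbT eq_sym; apply: contra_neq mu0 => m00; rewrite mE m00.
(* For [m = 1] the map [phi] would be the identity on the disc, hence onto. *)
have mlt : m < 1.
  rewrite lt_neqAle m1 andbT; apply/negP => /eqP mm; apply: naut => w w1.
  exists w => //; have [_ p1] := lft_disc w1.
  have := u_phi w w1; rewrite mE mm mul1r => /addrI/oppr_inj E.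
  by rewrite -(sigmaK _ p1) E sigmaK.
exists sigma, sigmai, m, ((1 - cabs al) / 4); split=> //; first by rewrite mpos.
  by move=> w w1; rewrite u_phi // mE.
split; first by rewrite divr_gt0 // subr_gt0.
by move=> w w1; rewrite csigma; exact: blaschke_lower.
Qed.

End Linearization.

(** * Growth of the iterates and conclusion *)

Lemma diff_disc_iter (R : realType) (phi : R[i] -> R[i]) : diff_disc phi ->
  (forall w, disc w -> disc (phi w)) ->
  forall n, diff_disc (iter n phi) /\ forall w, disc w -> disc (iter n phi w).
Proof.
move=> dphi phi1; elim=> [|n [dn n1]]; first by split=> // w _; exact: cdiff_id.
split=> [w w1|w w1]; last by apply: phi1; exact: n1.
exact (cdiff_comp (dn w w1) (dphi _ (n1 w w1))).
Qed.

Theorem theorem4p1 (R : realType) (a b c d : R[i]) :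
  hyperbolic_nonaut_first_kind a b c d ->
  (forall p : R, 1 <= p -> ~ svep_comp p (lft a b c d)) /\
  (forall p : R, 1 < p -> adj_property_C p (lft a b c d)).
Proof.
move=> hyp; have [sigma [sigmai [r [k [[dsigma sigma1 dsigmai sigmai1] sigmaK r01 u_phi [k0 Hk]]]]]] :=
  linearization hyp.
have du : diff_disc (fun w => 1 - sigma w) := diff_one_minus dsigma.
split=> p p1.
  have p0 : 0 < p by exact: lt_le_trans p1.
  exact: (not_svep du (re_one_minus sigma1) (cabs_one_minus sigma1) r01 u_phi p0).
have p0 : 0 < p by exact: lt_trans p1.
have /andP[r0 r1] := r01.
have self w : disc w -> disc (lft a b c d w) by move=> w1; case: (lft_disc hyp w1).
have iterP := diff_disc_iter (diff_lft hyp) self.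
set s0 := ComplexField.Normc.normc (sigma 0).
have s01 : s0 < 1 by apply: sigma1; rewrite cabs0.
have k1 : 0 < k * (1 - s0) by rewrite mulr_gt0 // subr_gt0.
have d0 : disc (0 : R[i]) by rewrite /disc /= -[_ < 1]/(ComplexField.Normc.normc (0 : R[i]) < 1) cabs0.
(* In the linearizing coordinate the orbit of [0] is explicit: [sigma (phi ^ n 0)] is the convex
   combination of [1] and [sigma 0] with weight [r ^ n] on the latter, so its modulus is at most
   [1 - r ^ n * (1 - s0)]. *)
have iter0 n : k * (1 - s0) * r ^+ n <= 1 - ComplexField.Normc.normc (iter n (lft a b c d) 0).
  have [_ Hn] := iterP n; have w1 := Hn 0 d0.
  apply: le_trans (Hk _ w1); rewrite -mulrA ler_pM2l //.
  have E : 1 - sigma (iter n (lft a b c d) 0) = ((r ^+ n)%:C)%C * (1 - sigma 0).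
    elim: n {Hn w1} => [|n IH]; first by rewrite mul1r.
    have [_ Hn] := iterP n; rewrite /= u_phi ?IH; last exact: Hn.
    by rewrite exprS rmorphM /= mulrA.
  have -> : sigma (iter n (lft a b c d) 0) = (1 - r ^+ n)%:C%C + ((r ^+ n)%:C)%C * sigma 0.
    by rewrite -[LHS](subKr 1) E rmorphB /=; ring.
  have rn0 : 0 <= r ^+ n by rewrite exprn_ge0 // ltW.
  have rn1 : r ^+ n <= 1 by rewrite exprn_ile1 // ltW.
  rewrite lerBrDr -lerBrDl; apply: le_trans (cabsD _ _) _.
  rewrite cabsM !cabs_real !ger0_norm ?subr_ge0 // -/s0.
  by rewrite le_eqVlt; apply/orP; left; apply/eqP; ring.
have K0 : 0 <= (4 / (k * (1 - s0))) `^ p^-1 by exact: powR_ge0.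
apply: (property_C p1 r01 K0 dsigma sigma1 dsigmai sigmai1 sigmaK u_phi).
move=> n f hf; have [dn n1] := iterP n.
have [h H] := littlewood (ltW p1) hf dn n1; split => //.
apply: le_trans H _; apply: ler_wpM2r; first exact: hnorm_ge0.
have rn0 : 0 < r ^+ n by rewrite exprn_gt0.
have pi0 : 0 <= p^-1 by rewrite invr_ge0 ltW.
have w1 := n1 0 d0.
(* Inserting the orbit estimate in Littlewood's constant separates the factor
   [(r ^ - n) ^ (1 / p) = rho ^ n]. *)
apply: le_trans (_ : (4 / (k * (1 - s0)) * r^-1 ^+ n) `^ p^-1 <= _).
  apply: (ge0_ler_powR pi0).
  - by rewrite nnegrE divr_ge0 // subr_ge0 ltW.
  - by rewrite nnegrE mulr_ge0 ?exprn_ge0 ?invr_ge0 ?(ltW r0) // divr_ge0 // ltW.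
  have A1 : 0 < 1 - ComplexField.Normc.normc (iter n (lft a b c d) 0) by rewrite subr_gt0.
  rewrite -mulrA exprVn -invfM ler_pM2l // lef_pV2 ?posrE //.
  exact: mulr_gt0 k1 rn0.
rewrite powRM ?exprn_ge0 ?invr_ge0 ?(ltW r0) ?divr_ge0 ?(ltW k1) //.
apply: (ler_wpM2l K0).
have -> : r^-1 ^+ n = r^-1 `^ n%:R by rewrite powR_mulrn // invr_ge0 ltW.
by rewrite powRAC powR_mulrn // powR_ge0.
Qed.
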